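(* There is some $\sigma_0>0$ that only depends on $C_G$ and $C_h$ such that $$(u_h,u_h)_{A_h} \gtrsim \|u_h\|_{Q_h}^2\quad\mbox{and}\quad (u_h,v_h)_{A_h} \lesssim \|u_h\|_{Q_h}\,\|v_h\|_{Q_h}$$ holds for all $u_h,v_h\in V_h$ and all $\sigma\ge p^2\sigma_0$.
   Context: **Geometry.** $\Omega\subset\mathbb R^2$ is an open, simply connected Lipschitz domain, $\overline\Omega=\bigcup_{k=1}^K\overline{\Omega_k}$ with pairwise disjoint open patches $\Omega_k=G_k(\widehat\Omega)$, $\widehat\Omega=(0,1)^2$, where $G_k:\widehat\Omega\to\Omega_k$ is a bijection that extends continuously to the closure with $G_k(\overline{\widehat\Omega})=\overline{\Omega_k}$. For a function $v$ on $\Omega$, $v_k:=v|_{\Omega_k}$ and $\widehat v_k:=v_k\circ G_k$. For $k\ne l$ the set $\partial\Omega_k\cap\partial\Omega_l$ is either empty, a common vertex, or a common edge $I_{k,l}=I_{l,k}$ such that $\widehat I_{k,l}:=G_k^{-1}(I_{k,l})$ is one of the four open edges $\{0\}\times(0,1),\{1\}\times(0,1),(0,1)\times\{0\},(0,1)\times\{1\}$ of $\widehat\Omega$. Let $\mathcal N(k)$ be the set of $l$ such that $\Omega_k,\Omega_l$ have a common edge, $\mathcal N:=\{(k,l):k<l,\ l\in\mathcal N(k)\}$, $\mathcal N^*:=\{(k,l):k>l,\ l\in\mathcal N(k)\}$. Let $\gamma_{k,l}:(0,1)\to\widehat I_{k,l}$, $\gamma_{k,l}(t)=(t,s)$ if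 $\widehat I_{k,l}=(0,1)\times\{s\}$ and $\gamma_{k,l}(t)=(s,t)$ if $\widehat I_{k,l}=\{s\}\times(0,1)$, $s\in\{0,1\}$. It is assumed that for all $(k,l)\in\mathcal N^*$ either $\gamma_{k,l}(t)=G_k^{-1}\circ G_l\circ\gamma_{l,k}(t)$ for all $t\in(0,1)$ or $\gamma_{k,l}(t)=G_k^{-1}\circ G_l\circ\gamma_{l,k}(1-t)$ for all $t\in(0,1)$. It is assumed that there is $C_G>0$ with $\sup_{x\in\widehat\Omega}\|\nabla^rG_k(x)\|_{\ell_2}\le C_G$ for $r=1,2$ and $\sup_{x\in\widehat\Omega}\|(\nabla G_k(x))^{-1}\|_{\ell_2}\le C_G$ for all $k$. **Discretization.** For a grid $Z=(\zeta_0,\dots,\zeta_n)$, $0=\zeta_0<\dots<\zeta_n=1$, of size $\max_i|\zeta_{i+1}-\zeta_i|$, and degree $p\in\mathbb N$, $S_{p,Z}(0,1):=\{v\in C^{p-1}(0,1): v|_{(\zeta_i,\zeta_{i+1}]}$ is a polynomial of degree at most $p$ for all $i=0,\dots,n-1\}$. For each patch there are a degree $p_k$ and grids $Z_{k,1},Z_{k,2}$ with sizes $h_{k,1},h_{k,2}$ and smallest knot spans $h_{k,1,\min},h_{k,2,\min}$; $\widehat V_k:=S_{p_k,Z_{k,1}}(0,1)\otimes S_{p_k,Z_{k,2}}(0,1)$. With $L_2^\circ(\Omega):=\{v\in L_2(\Omega):(v,1)_{L_2(\Omega)}=0\}$, set $V_h:=\{u_h\in L_2^\circ(\Omega):u_h\circ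 G_k\in\widehat V_k,\ k=1,\dots,K\}$. Put $p:=\max_kp_k$, $p_{\min}:=\min_kp_k$, $h:=\max_{k,\delta}h_{k,\delta}$. It is assumed that $p_{\min}\ge2$ and $\min_{k,\delta}h_{k,\delta,\min}\ge C_hh$ for some constant $C_h>0$. **Forms and norms.** $|\cdot|_{H^r}$ is the usual seminorm of order $r$. On $I_{k,l}$, $(k,l)\in\mathcal N$: jump $\llbracket v\rrbracket:=v_k-v_l$, average $\{v\}:=\frac12(v_k+v_l)$; $\mathbf n_k$ is the outer unit normal on $\partial\Omega_k$. With penalty parameter $\sigma>0$, $$(u,v)_{\mathcal H^1(\Omega)}:=\sum_{k=1}^K(\nabla u,\nabla v)_{L_2(\Omega_k)},\quad (u,v)_{B_h}:=\sum_{(k,l)\in\mathcal N}(\llbracket u\rrbracket,\{\nabla v\}\cdot\mathbf n_k)_{L_2(I_{k,l})},\quad (u,v)_{C_h}:=\frac\sigma h\sum_{(k,l)\in\mathcal N}(\llbracket u\rrbracket,\llbracket v\rrbracket)_{L_2(I_{k,l})},$$ $$(u,v)_{A_h}:=(u,v)_{\mathcal H^1(\Omega)}-(u,v)_{B_h}-(v,u)_{B_h}+(u,v)_{C_h},\qquad \|u\|_{Q_h}^2:=(u,u)_{\mathcal H^1(\Omega)}+(u,u)_{C_h}.$$ **Generic constants.** $a\lesssim b$ (equivalently $b\gtrsim a$) means $a\le c\,b$ with a constant $c>0$ independent of $h$, $p$, $K$ and of the quantities over which the estimate is quantified; $c$ may depend on $C_G$ and $C_h$. *)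

(* Defs.v *)
(* The plane is the product type R * R for R : realType. *)
From HB Require Import structures.
From mathcomp Require Import all_boot all_order all_algebra.
From mathcomp Require Import all_classical all_reals all_analysis.

Set Implicit Arguments.
Unset Strict Implicit.
Unset Printing Implicit Defensive.

Import Order.TTheory GRing.Theory Num.Theory.
Import numFieldNormedType.Exports.

Local Open Scope classical_set_scope.
Local Open Scope ring_scope.

Section Plane.
Context {R : realType}.
Implicit Types (x y : R * R) (A : set (R * R)).

Definition dot x y : R := x.1 * y.1 + x.2 * y.2.

(* The library norm on R * R is the sup norm. *)
Definition enorm x : R := Num.sqrt (dot x x).

Definition bvec (i : 'I_2) : R * R := if i == 0 then (1, 0) else (0, 1).

Definition coord (i : 'I_2) x : R := if i == 0 then x.1 else x.2.

Definition pd (i : 'I_2) (f : R * R -> R) (x : R * R) : R := 'D_(bvec i) f x.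

Definition grad (f : R * R -> R) (x : R * R) : R * R := (pd 0 f x, pd 1 f x).

Definition jac (F : R * R -> R * R) (x : R * R) : 'M[R]_2 :=
  \matrix_(m, i) pd i (coord m \o F) x.

Definition frob (M : 'M[R]_2) : R := Num.sqrt (\sum_i \sum_j M i j ^+ 2).

Definition hess_norm (F : R * R -> R * R) (x : R * R) : R :=
  Num.sqrt (\sum_m \sum_i \sum_j pd j (pd i (coord m \o F)) x ^+ 2).

Definition frontier A : set (R * R) := closure A `\` interior A.

Definition leb2 := (@lebesgue_measure R \x @lebesgue_measure R)%E.

Definition path_in A (c : R -> R * R) : Prop :=
  {within `[0, 1], continuous c} /\ c @` `[0, 1] `<=` A.

Definition simply_connected A : Prop :=
  (forall x y, A x -> A y -> exists2 c, path_in A c & c 0 = x /\ c 1 = y) /\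
  (forall c, path_in A c -> c 0 = c 1 ->
    exists H : R * R -> R * R,
      [/\ {within `[0, 1] `*` `[0, 1], continuous H},
          H @` (`[0, 1] `*` `[0, 1]) `<=` A,
          forall t, t \in `[0, 1] -> H (0, t) = c t /\ H (1, t) = c 0 &
          forall s, s \in `[0, 1] -> H (s, 0) = c 0 /\ H (s, 1) = c 0]).

(* Near each boundary point x, in the orthonormal frame obtained by rotating
   the standard one so that its first vector is a, A is the strict epigraph of
   a Lipschitz function. *)
Definition lipschitz_boundary A : Prop :=
  forall x, frontier A x ->
  exists (a : R * R) (r L : R) (phi : R -> R),
    [/\ enorm a = 1, 0 < r, L.-lipschitz_setT phi, phi 0 = 0 &
        forall s t, `|s| < r -> `|t| < r ->
          A (x + s *: a + t *: (- a.2, a.1)) <-> phi s < t].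

(* n is the outer unit normal of A at x: the blow-up of A at x is the half
   plane {z | dot z n < 0}. *)
Definition is_outer_normal A x (n : R * R) : Prop :=
  enorm n = 1 /\
  forall e, 0 < e -> \forall y \near x,
    (dot (y - x) n < - (e * enorm (y - x)) -> A y) /\
    (e * enorm (y - x) < dot (y - x) n -> ~ A y).

Definition outer_normal A x : R * R := xget 0 [set n | is_outer_normal A x n].

(* One-sided boundary value: the limit at x from within A. This is the trace of
   functions that, like those below, are continuous up to the boundary. *)
Definition trace {T : normedModType R} A (f : R * R -> T) (x : R * R) : T :=
  lim (f y @[y --> within A (nbhs x)]).

(* Integral with respect to arc length along the curve c on (0,1). *)
Definition line_integral (c : R -> R * R) (f : R * R -> R) : R :=
  \int[@lebesgue_measure R]_(t in `]0, 1[)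
    (f (c t) * enorm (derive1 (fst \o c) t, derive1 (snd \o c) t)).

Definition usq : set (R * R) := `]0, 1[ `*` `]0, 1[.

Definition cusq : set (R * R) := `[0, 1] `*` `[0, 1].

Definition vertex (c : bool * bool) : R * R := (c.1%:R, c.2%:R).

(* (true, s) codes the edge (0,1) x {s} and (false, s) the edge {s} x (0,1). *)
Definition edge_par (e : bool * bool) (t : R) : R * R :=
  if e.1 then (t, e.2%:R) else (e.2%:R, t).

Definition edge (e : bool * bool) : set (R * R) := edge_par e @` `]0, 1[.

End Plane.

Section Splines.
Context {R : realType}.

Record grid := Grid {
  spans : nat;
  knot : nat -> R;
  knot_first : knot 0 = 0;
  knot_last : knot spans = 1;
  knot_lt : forall i, (i < spans)%N -> knot i < knot i.+1 }.

Definition knot_span (Z : grid) (i : nat) : R := `|knot Z i.+1 - knot Z i|.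

Definition grid_size (Z : grid) : R :=
  \big[Order.max/0]_(i < spans Z) knot_span Z i.

(* The default value 1 is harmless: no span exceeds 1 and there is at least one. *)
Definition grid_min (Z : grid) : R :=
  \big[Order.min/1]_(i < spans Z) knot_span Z i.

(* Only the values of v on (0,1) matter; meant for p >= 1. *)
Definition spline (p : nat) (Z : grid) (v : R -> R) : Prop :=
  [/\ forall j x, (j < p.-1)%N -> x \in `]0, 1[ -> derivable (derive1n j v) x 1,
      forall x, x \in `]0, 1[ -> {for x, continuous (derive1n p.-1 v)} &
      forall i, (i < spans Z)%N ->
        exists2 q : {poly R}, (size q <= p.+1)%N &
          forall x, x \in `]knot Z i, knot Z i.+1] -> x < 1 -> v x = q.[x]].

Definition tensor_spline (p : nat) (Z1 Z2 : grid) (w : R * R -> R) : Prop :=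
  exists (m : nat) (a b : 'I_m -> R -> R),
    (forall i, spline p Z1 (a i) /\ spline p Z2 (b i)) /\
    (forall x, usq x -> w x = \sum_i a i x.1 * b i x.2).

End Splines.
Arguments grid : clear implicits.

(* geo k restricted to usq is the k-th parametrization, its values on cusq are
   those of the continuous extension, other values are irrelevant.
   iedge k l is the edge of the unit square parametrizing the interface
   of the patches k and l seen from k, and None if they have no common edge. *)
Record multipatch (R : realType) := Multipatch {
  npatch : nat;
  dom : set (R * R);
  geo : 'I_npatch -> R * R -> R * R;
  iedge : 'I_npatch -> 'I_npatch -> option (bool * bool);
  deg : 'I_npatch -> nat;
  grid1 : 'I_npatch -> grid R;
  grid2 : 'I_npatch -> grid R }.

Arguments geo {R} m.
Arguments iedge {R} m.
Arguments deg {R} m.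
Arguments grid1 {R} m.
Arguments grid2 {R} m.

Section Multipatch.
Context {R : realType} (M : multipatch R).
Local Notation K := (npatch M).
Implicit Types (k l : 'I_K) (u v : R * R -> R) (x : R * R).

Definition subdom k : set (R * R) := geo M k @` usq.

Definition interface_cond k l : Prop :=
  let common := frontier (subdom k) `&` frontier (subdom l) in
  match iedge M k l, iedge M l k with
  | None, None =>
      common = set0 \/
      exists c d, common = [set geo M k (vertex c)] /\
                  common = [set geo M l (vertex d)]
  | Some e, Some e' =>
      let I := geo M k @` edge e in
      [/\ I = geo M l @` edge e', common = closure I,
          cusq `&` geo M k @^-1` I = edge e &
          cusq `&` geo M l @^-1` I = edge e']
  | _, _ => False
  end.

(* "x is the inverse image of y under geo M k": y has x as its only preimage. *)
Definition geo_inv k (y x : R * R) : Prop :=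
  cusq `&` geo M k @^-1` [set y] = [set x].

Definition conforming k l : Prop :=
  forall e e', iedge M k l = Some e -> iedge M l k = Some e' ->
    (forall t, t \in `]0, 1[ ->
       geo_inv k (geo M l (edge_par e' t)) (edge_par e t)) \/
    (forall t, t \in `]0, 1[ ->
       geo_inv k (geo M l (edge_par e' (1 - t))) (edge_par e t)).

Record geometry : Prop := Geometry {
  dom_open : open (dom M);
  dom_nonempty : dom M !=set0;
  dom_simply_connected : simply_connected (dom M);
  dom_lipschitz : lipschitz_boundary (dom M);
  patch_open : forall k, open (subdom k);
  geo_inj : forall k, set_inj usq (geo M k);
  geo_cont : forall k, {within cusq, continuous (geo M k)};
  geo_closure : forall k, geo M k @` cusq = closure (subdom k);
  patch_disjoint : forall k l, k != l -> subdom k `&` subdom l = set0;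
  patch_cover : closure (dom M) = \bigcup_k closure (subdom k);
  patch_interface : forall k l, k != l -> interface_cond k l;
  patch_conforming : forall k l, (l < k)%N -> conforming k l }.

(* The matrix and tensor norms are the l2 norms of the arrays of entries. *)
Record geo_bounds (CG : R) : Prop := GeoBounds {
  geo_diff1 : forall k m x, usq x -> differentiable (coord m \o geo M k) x;
  geo_diff2 : forall k m i x, usq x ->
    differentiable (pd i (coord m \o geo M k)) x;
  geo_bound1 : forall k x, usq x -> frob (jac (geo M k) x) <= CG;
  geo_bound2 : forall k x, usq x -> hess_norm (geo M k) x <= CG;
  geo_unit : forall k x, usq x -> jac (geo M k) x \in unitmx;
  geo_bound_inv : forall k x, usq x -> frob (invmx (jac (geo M k) x)) <= CG }.

(* The default values in pmin, hmax and hmin are harmless: there is at least one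
   patch since dom M is nonempty. *)
Definition pmax : nat := \max_(k < K) deg M k.

Definition pmin : nat := \big[minn/pmax]_(k < K) deg M k.

Definition hmax : R :=
  \big[Order.max/0]_(k < K)
    Order.max (grid_size (grid1 M k)) (grid_size (grid2 M k)).

Definition hmin : R :=
  \big[Order.min/hmax]_(k < K)
    Order.min (grid_min (grid1 M k)) (grid_min (grid2 M k)).

(* u is a function, not a class; its representative is the one that is a spline
   everywhere inside each patch, and its values on the interfaces are irrelevant. *)
Definition Vh u : Prop :=
  [/\ measurable_fun (dom M) (u : measurableTypeR R * measurableTypeR R -> R),
      leb2.-integrable (dom M) (fun x => (u x ^+ 2)%:E),
      \int[leb2]_(x in dom M) u x = 0 &
      forall k, tensor_spline (deg M k) (grid1 M k) (grid2 M k) (u \o geo M k)].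

Definition interfaces : {set 'I_K * 'I_K} :=
  [set kl : 'I_K * 'I_K | (kl.1 < kl.2)%N && iedge M kl.1 kl.2]%SET.

Definition interface_integral k l (f : R * R -> R) : R :=
  if iedge M k l is Some e then line_integral (geo M k \o edge_par e) f else 0.

Definition jump k l v x : R := trace (subdom k) v x - trace (subdom l) v x.

Definition avg_grad k l v x : R * R :=
  2^-1 *: (trace (subdom k) (grad v) x + trace (subdom l) (grad v) x).

Definition ipH1 u v : R :=
  \sum_k \int[leb2]_(x in subdom k) dot (grad u x) (grad v x).

Definition ipB u v : R :=
  \sum_(kl in interfaces) interface_integral kl.1 kl.2 (fun x =>
    jump kl.1 kl.2 u x *
    dot (avg_grad kl.1 kl.2 v x) (outer_normal (subdom kl.1) x)).

Definition ipC (sigma : R) u v : R :=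
  sigma / hmax * \sum_(kl in interfaces) interface_integral kl.1 kl.2 (fun x =>
    jump kl.1 kl.2 u x * jump kl.1 kl.2 v x).

Definition ipA (sigma : R) u v : R :=
  ipH1 u v - ipB u v - ipB v u + ipC sigma u v.

Definition normQ (sigma : R) u : R :=
  Num.sqrt (ipH1 u u + ipC sigma u u).

End Multipatch.

(* Main.v *)
Require Import Defs.
From HB Require Import structures.
From mathcomp Require Import all_boot all_order all_algebra.
From mathcomp Require Import all_classical all_reals all_analysis.
From mathcomp Require Import measurable_realfun ring lra.
(* Required again because vector.v shadows coord. *)
Require Import Defs.

Set Implicit Arguments.
Unset Strict Implicit.
Unset Printing Implicit Defensive.

Import Order.TTheory GRing.Theory Num.Theory.
Import numFieldNormedType.Exports.

Local Open Scope classical_set_scope.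
Local Open Scope ring_scope.

(* A polynomial q of degree at most p satisfies q(0)^2 <= (p+1)^2 int_0^1 q^2.
   Applied on the grid cells touching an edge of the unit square to the partial
   derivatives of a tensor spline, this bounds the L2 norm of the gradient on the
   edge by a multiple of p^2/h times the L2 norm of the gradient on the square, and
   the bounds on G_k transport the estimate to the patches. Since the patches are
   disjoint, of diameter at most and area at least a constant, a patch has boundedly
   many neighbours, so Young's inequality gives, for every a > 0,
   |(u,v)_B| <= a/2 sum |[u]|^2 + c p^2/(a h) |v|_{H^1}^2. With a of order p^2/h the
   consistency terms are absorbed into the penalty and the H^1 seminorm, which is
   coercivity; optimizing a gives boundedness. *)

(** * Polynomial trace inequality *)

(** Two obstacles shape the proof. The parametrizations are controlled only on the open square,
    through bounds on first and second derivatives. The energy is therefore moved in one direction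
    only: the integral of the pulled-back gradient over the square is bounded by the energy on the
    patch, by means of an inverse function theorem with explicit constants and a comparison of
    areas. On the edges, speeds and traces exist only as one-sided limits, and the gradient may have
    no trace at all. Every edge integrand is therefore replaced by a measurable function of the edge
    parameter, equal to the jump or dominating the squared gradient trace. The powers of [C] add up
    as follows: 4C^2 for the gradient on the edge, 64C^4 for the energy on the square, 2C for the
    arc length, 1600C^4 for the number of neighbours. *)

Section PolynomialTrace.
Context {R : realType}.
Implicit Types (q r : {poly R}) (a b : R) (s : bool).

(** At index 0 the coefficient is a quotient by 0, hence 0: this is the primitive that vanishes at
    0. *)
Definition primitive q : {poly R} :=
  \poly_(i < (size q).+1) (q`_i.-1 / i%:R).

Lemma coef_primitive q i : (primitive q)`_i = q`_i.-1 / i%:R.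
Proof.
rewrite coef_poly; case: ltnP => // qi.
by rewrite nth_default ?mul0r// -ltnS (leq_trans qi)// leqSpred.
Qed.

Lemma deriv_primitive q : (primitive q)^`() = q.
Proof.
apply/polyP => i; rewrite coef_deriv coef_primitive/= -mulrnAr -[X in _ * X]mulr_natr mulVf ?mulr1//.
Qed.

Lemma primitive_linear c q r : primitive (c *: q + r) = c *: primitive q + primitive r.
Proof.
by apply/polyP => i; rewrite !(coefD, coefZ, coef_primitive); ring.
Qed.

Lemma deriv_eq0_horner q a b : q^`() = 0 -> q.[a] = q.[b].
Proof.
move=> q'0; suff -> : q = (q`_0)%:P by rewrite !hornerC.
apply/polyP => -[|i]; rewrite coefC//=.
have /eqP := coef_deriv q i; rewrite q'0 coef0 eq_sym mulrn_eq0/=.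
by move/eqP.
Qed.

(** Integration as an algebraic operation on polynomials, with the bounds in either order;
    [integral_poly] links it to the Lebesgue integral. *)
Definition poly_int a b q : R := (primitive q).[b] - (primitive q).[a].

Lemma poly_int_linear a b c q r :
  poly_int a b (c *: q + r) = c * poly_int a b q + poly_int a b r.
Proof. by rewrite /poly_int primitive_linear !(hornerD, hornerZ); ring. Qed.

Lemma poly_int0 a b : poly_int a b 0 = 0.
Proof.
by have := poly_int_linear a b (-1) 0 0; rewrite scaler0 add0r mulN1r addNr.
Qed.

Lemma poly_int_sum a b n (c : 'I_n -> R) (f : 'I_n -> {poly R}) :
  poly_int a b (\sum_i c i *: f i) = \sum_i c i * poly_int a b (f i).
Proof.
elim/big_ind2 : _ => [|x1 x2 y1 y2 <- <-|i _]; first exact: poly_int0.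
  by rewrite -(scale1r x2) poly_int_linear mul1r scale1r.
by rewrite -[c i *: f i]addr0 poly_int_linear poly_int0 addr0.
Qed.

Lemma poly_int_ge0 a b q : a <= b -> (forall x, 0 <= q.[x]) -> 0 <= poly_int a b q.
Proof.
move=> ab q0; rewrite /poly_int.
have [c _ ->] := @MVT_segment R (horner (primitive q)) (horner q) a b ab
  (fun x _ => eq_ind _ (fun r => is_derive x 1 (horner (primitive q)) r.[x])
     (is_derive_poly _ _) _ (deriv_primitive q))
  (continuous_subspaceT (@continuous_horner R (primitive q))).
by rewrite mulr_ge0// subr_ge0.
Qed.

(** The composed primitive and (b - a) times the primitive of the composition have the same
    derivative. As the bounds may be in either order, [poly_trace] can send either endpoint to 0. *)
Lemma poly_int_affine a b q : 
  poly_int a b q = (b - a) * poly_int 0 1 (q \Po ((b - a)%:P * 'X + a%:P)).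
Proof.
set l := _%:P * _ + _; pose P := primitive q \Po l - (b - a) *: primitive (q \Po l).
have P'0 : P^`() = 0.
  rewrite /P derivB derivZ deriv_comp !deriv_primitive /l derivD !derivC addr0.
  by rewrite derivM derivC mul0r add0r derivX mulr1 -mul_polyC mulrC subrr.
have := deriv_eq0_horner 0 1 P'0.
rewrite /P /l /poly_int !hornerE !horner_comp !hornerE.
by rewrite subrK => H; lra.
Qed.

Lemma poly_int01_Xn k : poly_int 0 1 'X^k = k.+1%:R^-1.
Proof.
have : (primitive 'X^k - k.+1%:R^-1 *: 'X^(k.+1))^`() = 0.
  rewrite derivB deriv_primitive derivZ derivXn/= -[X in _ *: X]scaler_nat scalerA.
  by rewrite mulVf ?pnatr_eq0// scale1r subrr.
move/(deriv_eq0_horner 0 1); rewrite /poly_int !hornerE expr1n expr0n/=.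
by rewrite mulr0 subr0 mulr1 => ->; rewrite opprB addrC subrK.
Qed.

Section kernel.
Variable p : nat.

Let node (i : nat) : R := - i.+1%:R.
(** For a kernel with coefficients c_j the k-th moment is the sum of c_j / (k + j + 1), a rational
    function of k with denominator (k + 1) ... (k + p + 1). The moments of order 1, ..., p have to
    vanish, so the numerator is a multiple of (1 - X) ... (p - X), and its partial fraction
    decomposition yields the c_j. *)
Let num : {poly R} := \prod_(i < p) (i.+1%:R%:P - 'X).
Let base (j : 'I_p.+1) : {poly R} := \prod_(i < p.+1 | i != j) ('X + i.+1%:R%:P).
Let weight (j : 'I_p.+1) : R := num.[node j] / (base j).[node j].

Let node_inj i j : (node i == node j) = (i == j).
Proof. by rewrite /node eqr_opp eqr_nat eqSS. Qed.

Let base_node i j : i != j -> (base j).[node i] = 0.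
Proof.
move=> ij; rewrite /base (bigD1 i)//= hornerM hornerD hornerX hornerC /node.
by rewrite addNr mul0r.
Qed.

Let base_node_neq0 j : (base j).[node j] != 0.
Proof.
rewrite horner_prod; apply/prodf_neq0 => i ij; rewrite hornerD hornerX hornerC /node.
by rewrite addrC subr_eq0 eqr_nat eqSS.
Qed.

(* Lagrange interpolation of num at the nodes -1, ..., -(p+1). *)
Let num_interpolation : num = \sum_j weight j *: base j.
Proof.
have bnd (n : nat) (P : pred 'I_n) (F : 'I_n -> {poly R}) :
    (forall i, size (F i) <= 2)%N -> (size (\prod_(i | P i) F i)%R <= (\sum_(i | P i) 1).+1)%N.
  move=> F2; elim/big_ind2 : _ => [|f a g b fa gb|//]; first by rewrite size_poly1.
  by rewrite (leq_trans (size_polyMleq _ _))// -subn1 leq_subLR add1n -addSn -addnS leq_add.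
apply/eqP; rewrite -subr_eq0; apply/eqP.
pose s : seq R := [seq node i | i <- iota 0 p.+1].
apply: (@roots_geq_poly_eq0 _ _ s).
- apply/allP => x /mapP[i]; rewrite mem_iota => /= ip ->{x}.
  rewrite rootE hornerD hornerN horner_sum (bigD1 (Ordinal ip))//= big1 ?addr0.
    by rewrite hornerZ /weight/= mulfVK ?subrr// (base_node_neq0 (Ordinal ip)).
  by move=> j ji; rewrite hornerZ (@base_node (Ordinal ip)) ?mulr0// eq_sym.
- by rewrite map_inj_uniq ?iota_uniq// => i j /eqP; rewrite node_inj => /eqP.
- rewrite size_map size_iota (leq_trans (size_polyD _ _))// geq_max size_polyN.
  apply/andP; split.
    rewrite (leq_trans (bnd _ _ _ _))//; last by rewrite sum1_card card_ord.
    move=> i; rewrite (leq_trans (size_polyD _ _))// geq_max size_polyN size_polyX.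
    by rewrite (leq_trans (size_polyC_leq1 _)).
  rewrite (leq_trans (size_sum _ _ _))//; apply/bigmax_leqP => j _.
  rewrite (leq_trans (size_scale_leq _ _))// (leq_trans (bnd _ _ _ _))//.
    by move=> i; rewrite size_XaddC.
  by rewrite sum1_card cardC1 card_ord.
Qed.

(** The factor p + 1 normalizes the moment of order 0, which would otherwise be p! / (p + 1)!. *)
Definition endpoint_kernel : {poly R} := \poly_(j < p.+1) (p.+1%:R * weight (inord j)).

Let int_kernel k : (k <= p)%N -> poly_int 0 1 ('X^k * endpoint_kernel) = (k == 0)%:R.
Proof.
move=> kp; rewrite /endpoint_kernel poly_def mulr_sumr.
under eq_bigr do rewrite -scalerAr -exprD.
rewrite poly_int_sum.
pose D := \prod_(i < p.+1) (k + i.+1)%:R : R.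
have D0 : D != 0.
  by apply/prodf_neq0 => i _; rewrite pnatr_eq0 addnS.
have -> : \sum_(i < p.+1) p.+1%:R * weight (inord i) * poly_int 0 1 'X^(k + i) =
          p.+1%:R * num.[k%:R] / D.
  rewrite [in RHS]num_interpolation horner_sum mulr_sumr mulr_suml.
  apply: eq_bigr => i _; rewrite inord_val hornerZ poly_int01_Xn -!mulrA.
  congr (_ * (_ * _)).
  (* Splitting the factor of index [i] off [D] identifies 1 / (k + i + 1) with the value of [base i]
     at k divided by [D]. *)
  suff : D = (k + i).+1%:R * (base i).[k%:R].
    move=> ->; congr (_ * _); rewrite invfM mulrCA divff ?mulr1// horner_prod; apply/prodf_neq0 => j _.
    by
 rewrite !hornerE -natrD pnatr_eq0 addnS.
  rewrite horner_prod /D (bigD1 i)//= addnS; congr (_ * _).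
  by apply: eq_bigr => j _; rewrite !hornerE natrD.
rewrite horner_prod; have [k0|k0] := posnP k.
  have DE : D = p.+1%:R * \prod_(i < p) (i.+1%:R%:P - 'X).[k%:R].
    rewrite /D big_ord_recr/= k0 mulrC; congr (_ * _).
    by apply: eq_bigr => i _; rewrite !hornerE subr0.
  by rewrite -DE divff.
have k1p : (k.-1 < p)%N by rewrite prednK.
(* For 1 <= k <= p the factor of index k - 1 of [num] vanishes at k. *)
rewrite (bigD1 (Ordinal k1p))//= [_.[_]](_ : _ = 0); last by rewrite !hornerE prednK// subrr.
by rewrite mul0r mulr0 mul0r.
Qed.

(** At the node -1 the numerator is (p + 1)! and the base polynomial is p!, so the weight is p + 1;
    the normalization contributes the second factor. *)
Let kernel_at_0 : endpoint_kernel.[0] = p.+1%:R ^+ 2.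
Proof.
rewrite horner_coef0 coef_poly/= /weight.
have -> : inord 0 = ord0 :> 'I_p.+1 by apply: val_inj; rewrite /= inordK.
suff -> : num.[node 0] = p.+1%:R * (base ord0).[node 0].
  by rewrite /node mulfK// ?expr2//; exact: base_node_neq0.
rewrite !horner_prod (eq_bigr (fun i : 'I_p => i.+2%:R)); last first.
  by move=> i _; rewrite !hornerE /node opprK -natrD addn1.
rewrite [in RHS]big_mkcond big_ord_recl/= mul1r.
rewrite [X in _ = _ * X](eq_bigr (fun i : 'I_p => i.+1%:R)); last first.
  move=> i _; rewrite hornerD hornerX hornerC /node /= /bump/= add1n.
  by rewrite -[i.+2]addn1 natrD; ring.
elim: (p) => [|n IH]; first by rewrite !big_ord0 mulr1.
by rewrite !big_ord_recr/= IH; ring.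
Qed.

Lemma endpoint_kernelP q : (size q <= p.+1)%N -> poly_int 0 1 (q * endpoint_kernel) = q.[0].
Proof.
move=> sq; rewrite -[q in LHS]coefK poly_def mulr_suml.
under eq_bigr do rewrite -scalerAl.
rewrite poly_int_sum horner_coef; apply: eq_bigr => i _.
rewrite int_kernel ?(leq_trans (ltn_ord i))//; last by rewrite -ltnS (leq_trans (ltn_ord i)).
by rewrite expr0n.
Qed.

(* Cauchy-Schwarz for the pairing of q with the kernel that represents evaluation
   at 0; the squared norm of the kernel is its value (p+1)^2 at 0. *)
Lemma poly_trace01 q : (size q <= p.+1)%N -> q.[0] ^+ 2 <= p.+1%:R ^+ 2 * poly_int 0 1 (q ^+ 2).
Proof.
move=> sq; set n2 := _ ^+ 2 * _.
set N : R := p.+1%:R ^+ 2; have N0 : 0 < N by rewrite exprn_gt0// ltr0n.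
(* With this scaling the square integrates to N times the difference of the two sides of the
   claim. *)
have : 0 <= poly_int 0 1 ((N *: q - q.[0] *: endpoint_kernel) ^+ 2).
  by apply: poly_int_ge0 => // x; rewrite horner_exp sqr_ge0.
have -> : (N *: q - q.[0] *: endpoint_kernel) ^+ 2 =
   (N ^+ 2) *: (q ^+ 2) + ((- (2 * N * q.[0])) *: (q * endpoint_kernel) +
   ((q.[0] ^+ 2) *: (endpoint_kernel * endpoint_kernel) + 0)).
  by rewrite -!mul_polyC !(polyCN, polyCM, rmorphXn)/=; ring.
rewrite !poly_int_linear poly_int0 !endpoint_kernelP ?size_poly// kernel_at_0 -/N.
rewrite (_ : _ + _ = N * (n2 - q.[0] ^+ 2)); last by rewrite /n2 -/N; ring.
by rewrite pmulr_rge0// subr_ge0.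
Qed.
End kernel.

(** An affine substitution sends the chosen endpoint to 0. For the right endpoint it reverses the
    orientation, and the two resulting signs cancel. *)
Lemma poly_trace p q a b s : a <= b -> (size q <= p.+1)%N ->
  (b - a) * q.[if s then b else a] ^+ 2 <= p.+1%:R ^+ 2 * poly_int a b (q ^+ 2).
Proof.
move=> ab sq; have half c d : q.[c] ^+ 2 <= p.+1%:R ^+ 2 *
    poly_int 0 1 ((q ^+ 2) \Po ((d - c)%:P * 'X + c%:P)).
  set l := _ * _ + _; have -> : q.[c] = (q \Po l).[0] by rewrite horner_comp !hornerE.
  rewrite expr2 comp_polyM -expr2; apply: poly_trace01.
  rewrite (leq_trans (size_comp_poly_leq _ _))// ltnS.
  have : (size l <= 2)%N by rewrite size_MXaddC; case: ifP => // _; rewrite ltnS size_polyC_leq1.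
  by case: (size l) => [|[|[|n]]]//= _; rewrite ?muln0// muln1 -subn1 leq_subLR add1n.
have intC : poly_int b a (q ^+ 2) = - poly_int a b (q ^+ 2) by rewrite /poly_int opprB.
case: s; last first.
  by rewrite [poly_int a b _]poly_int_affine [leRHS]mulrCA ler_wpM2l ?subr_ge0.
rewrite -[poly_int a b _]opprK -intC poly_int_affine -mulNr opprB [leRHS]mulrCA.
by rewrite ler_wpM2l ?subr_ge0.
Qed.

Lemma integral_poly a b q : a < b ->
  (\int[@lebesgue_measure R]_(x in `[a, b]) (q.[x])%:E = (poly_int a b q)%:E)%E.
Proof.
move=> ab; rewrite (@continuous_FTC2 R (horner q) (horner (primitive q)))//.
- exact/continuous_subspaceT/continuous_horner.
- split=> [x _||].
  + exact: derivable_horner.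
  + exact/cvg_at_right_filter/continuous_horner.
  + exact/cvg_at_left_filter/continuous_horner.
- by move=> x _; rewrite -derivE deriv_primitive.
Qed.

End PolynomialTrace.

(** * Charts with bounded derivatives *)

Section MeanValue.
Context {R : realType}.
Implicit Types (x y z : R * R) (f : R * R -> R) (i : 'I_2) (s t : R).

Lemma ord2P (P : 'I_2 -> Prop) : P 0 -> P 1 -> forall i, P i.
Proof.
move=> P0 P1 [[|[|//]] ?]; [rewrite (_ : Ordinal _ = 0)|rewrite (_ : Ordinal _ = 1)] => //;
  exact: val_inj.
Qed.

Lemma sum_ord2 (V : nmodType) (F : 'I_2 -> V) : \sum_i F i = F 0 + F 1.
Proof. by rewrite big_ord_recl big_ord1; congr (_ + F _); apply: val_inj. Qed.

Lemma norm_pair_le x (r : R) : (`|x| <= r) = (`|x.1| <= r) && (`|x.2| <= r).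
Proof. by rewrite prod_normE ge_max. Qed.

Lemma norm_pair_lt x (r : R) : (`|x| < r) = (`|x.1| < r) && (`|x.2| < r).
Proof. by rewrite prod_normE gt_max. Qed.

Lemma norm_coord_le i x : `|coord i x| <= `|x|.
Proof. by rewrite prod_normE le_max /coord; case: ifP; rewrite lexx ?orbT. Qed.

Lemma usqE x : usq x <-> [/\ 0 < x.1, x.1 < 1, 0 < x.2 & x.2 < 1].
Proof.
rewrite /usq /= !in_itv/=.
by split=> [[/andP[? ?] /andP[? ?]]|[? ? ? ?]]; split=> //; apply/andP.
Qed.

Definition slice i x s : R * R := if i == 0 then (s, x.2) else (x.1, s).

Lemma slice_coord i x : slice i x (coord i x) = x.
Proof. by case: x => a b; elim/ord2P: i. Qed.

Lemma coord_slice i x s : coord i (slice i x s) = s.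
Proof. by elim/ord2P: i. Qed.

Lemma slice_slice i x s t : slice i (slice i x s) t = slice i x t.
Proof. by elim/ord2P: i. Qed.

(** The difference quotients agree as functions of the increment, so derivability and the derivative
    transfer at once to one variable. *)
Lemma slice_quotient i f x :
  (fun h : R => h^-1 *: ((f \o shift x) (h *: bvec i) - f x)) =
  (fun h : R => h^-1 *: ((f \o slice i x \o shift (coord i x)) (h *: (1 : R)) -
                         (f \o slice i x) (coord i x))).
Proof.
apply/funext => h /=; rewrite slice_coord; congr (_ *: (f _ - _)).
by case: x => a b; elim/ord2P: i; congr pair; rewrite /= ?scaler0 ?mulr0 ?add0r.
Qed.

Lemma derivable_sliceP i f x :
  derivable f x (bvec i) <-> derivable (f \o slice i x) (coord i x) 1.
Proof. by rewrite /derivable slice_quotient. Qed.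

Lemma pd_slice i f x : pd i f x = 'D_1 (f \o slice i x) (coord i x).
Proof. by rewrite /pd /derive slice_quotient. Qed.

Lemma is_derive_slice i f x s : derivable f (slice i x s) (bvec i) ->
  is_derive s 1 (f \o slice i x) (pd i f (slice i x s)).
Proof.
move=> df; have -> : f \o slice i x = f \o slice i (slice i x s).
  by apply/funext => t/=; rewrite slice_slice.
have cs : s = coord i (slice i x s) by rewrite coord_slice.
rewrite [s in is_derive s]cs; apply: DeriveDef; first exact/derivable_sliceP.
by rewrite pd_slice.
Qed.

Lemma pd_mean_value_le i f x s t : s <= t ->
  (forall r, s <= r <= t -> derivable f (slice i x r) (bvec i)) ->
  exists2 c, s <= c <= t &
    f (slice i x t) - f (slice i x s) = pd i f (slice i x c) * (t - s).
Proof.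
move=> st df.
have dfs r : r \in `[s, t] -> is_derive r 1 (f \o slice i x) (pd i f (slice i x r)).
  by rewrite in_itv/= => /df/is_derive_slice.
have cf : {within `[s, t], continuous (f \o slice i x)}.
  by apply: derivable_within_continuous => r /dfs[].
have dfo r : r \in `]s, t[ -> is_derive r 1 (f \o slice i x) (pd i f (slice i x r)).
  by move=> /subset_itv_oo_cc; exact: dfs.
have [c] := MVT_segment st dfo cf.
by rewrite in_itv/=; exists c.
Qed.

Lemma pd_mean_value i f x s t :
  (forall r, Num.min s t <= r <= Num.max s t -> derivable f (slice i x r) (bvec i)) ->
  exists2 c, Num.min s t <= c <= Num.max s t &
    f (slice i x t) - f (slice i x s) = pd i f (slice i x c) * (t - s).
Proof.
have [st|ts] := leP s t => df; first exact: pd_mean_value_le.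
have [c cst E] := pd_mean_value_le (ltW ts) df; exists c => //.
by rewrite -[LHS]opprB E -mulrN opprB.
Qed.

(** The path from x to y runs parallel to the axes through the corner (y.1, x.2), with one mean
    value on each leg. In the sup norm it stays in every ball that contains x and y, which is the
    last clause. *)
Lemma mean_value2 f x y : usq x -> usq y ->
  (forall i z, usq z -> derivable f z (bvec i)) ->
  exists xi eta, [/\ usq xi, usq eta,
    f y - f x = pd 0 f xi * (y.1 - x.1) + pd 1 f eta * (y.2 - x.2) &
    forall z r, `|x - z| <= r -> `|y - z| <= r -> `|xi - z| <= r /\ `|eta - z| <= r].
Proof.
move=> /usqE[x1 x1' x2 x2'] /usqE[y1 y1' y2 y2'] df.
have [|c cxy Ec] := @pd_mean_value 0 f (x.1, x.2) x.1 y.1.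
  move=> r; rewrite ge_min le_max => /andP[/orP r1 /orP r2]; apply: df.
  by apply/usqE; rewrite /slice/=; split=> //; lra.
have [|d dxy Ed] := @pd_mean_value 1 f (y.1, x.2) x.2 y.2.
  move=> r; rewrite ge_min le_max => /andP[/orP r1 /orP r2]; apply: df.
  by apply/usqE; rewrite /slice/=; split=> //; lra.
move: cxy dxy; rewrite !ge_min !le_max => /andP[/orP c1 /orP c2] /andP[/orP d1 /orP d2].
exists (slice 0 (x.1, x.2) c), (slice 1 (y.1, x.2) d); split.
- by apply/usqE; rewrite /slice/=; split=> //; lra.
- by apply/usqE; rewrite /slice/=; split=> //; lra.
- rewrite -Ec -Ed /slice/= -!surjective_pairing; ring.
move=> z r; rewrite !norm_pair_le /slice/= => /andP[xz1 xz2] /andP[yz1 yz2].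
rewrite xz2 yz1/=; move: xz1 xz2 yz1 yz2; rewrite !ler_norml.
by move=> /andP[? ?] /andP[? ?] /andP[? ?] /andP[? ?]; split; rewrite ?andbT; lra.
Qed.

Lemma mean_value_bound f x y (C : R) : usq x -> usq y ->
  (forall i z, usq z -> derivable f z (bvec i)) ->
  (forall i z, usq z -> `|pd i f z| <= C) -> `|f y - f x| <= 2 * C * `|y - x|.
Proof.
move=> ux uy df Cf; have [xi [eta [uxi ueta -> _]]] := mean_value2 ux uy df.
rewrite (le_trans (ler_normD _ _))// !normrM (_ : 2 * C * _ = C * `|y - x| + C * `|y - x|).
  by rewrite lerD// ler_pM ?Cf// ?(norm_coord_le 0 (y - x))// (norm_coord_le 1 (y - x)).
ring.
Qed.

End MeanValue.

(** * Quantitative inverse function theorem for a chart *)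

Section Chart.
Context {R : realType}.
Implicit Types (A : 'M[R]_2) (x y z : R * R).

Definition mxact A x : R * R :=
  (A 0 0 * x.1 + A 0 1 * x.2, A 1 0 * x.1 + A 1 1 * x.2).

Lemma mxactM A B x : mxact (A *m B) x = mxact A (mxact B x).
Proof. by rewrite /mxact !mxE !sum_ord2/=; congr pair; ring. Qed.

Lemma mxact1 x : mxact 1%:M x = x.
Proof. by case: x => a b; rewrite /mxact !mxE/= !(mul1r, mul0r, addr0, add0r). Qed.

Lemma mxactB A x y : mxact A (x - y) = mxact A x - mxact A y.
Proof. by rewrite /mxact; congr pair => /=; ring. Qed.

Lemma mxactZ A c x : mxact A (c *: x) = c *: mxact A x.
Proof. by congr pair => /=; rewrite /GRing.scale/=; ring. Qed.

Lemma sqrt_sum_ge (I : finType) (F : I -> R) i : 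
  (forall j, 0 <= F j) -> F i <= \sum_j F j.
Proof. by move=> F0; rewrite (bigD1 i)//= lerDl sumr_ge0. Qed.

Lemma frob_ge A i j : `|A i j| <= frob A.
Proof.
rewrite -sqrtr_sqr ler_wsqrtr// (le_trans _ (sqrt_sum_ge i _))//.
  by rewrite (le_trans _ (sqrt_sum_ge j _))// => k; rewrite sqr_ge0.
by move=> k; rewrite sumr_ge0// => l _; rewrite sqr_ge0.
Qed.

Lemma hess_norm_ge (F : R * R -> R * R) x m i j :
  `|pd j (pd i (coord m \o F)) x| <= hess_norm F x.
Proof.
rewrite -sqrtr_sqr ler_wsqrtr// (le_trans _ (sqrt_sum_ge m _))//.
  rewrite (le_trans _ (sqrt_sum_ge i _))//.
    by rewrite (le_trans _ (sqrt_sum_ge j _))// => k; rewrite sqr_ge0.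
  by move=> k; rewrite sumr_ge0// => l _; rewrite sqr_ge0.
by move=> k; rewrite !sumr_ge0// => l _; rewrite sumr_ge0// => n _; rewrite sqr_ge0.
Qed.

Lemma mxact_le A x : `|mxact A x| <= 2 * frob A * `|x|.
Proof.
have h i : `|A i 0 * x.1 + A i 1 * x.2| <= 2 * frob A * `|x|.
  rewrite (le_trans (ler_normD _ _))// !normrM.
  rewrite (_ : 2 * _ * _ = frob A * `|x| + frob A * `|x|); last ring.
  by rewrite lerD// ler_pM ?frob_ge ?(norm_coord_le 0 x) ?(norm_coord_le 1 x).
by rewrite norm_pair_le/= !h.
Qed.

(** One parametrization with a single constant for all bounds, so that the analysis on a patch is
    independent of the multipatch. *)
Record chart (C : R) (F : R * R -> R * R) : Prop := Chart {
  chart_diff1 : forall m x, usq x -> differentiable (coord m \o F) x;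
  chart_diff2 : forall m i x, usq x -> differentiable (pd i (coord m \o F)) x;
  chart_bound1 : forall x, usq x -> frob (jac F x) <= C;
  chart_bound2 : forall x, usq x -> hess_norm F x <= C;
  chart_unit : forall x, usq x -> jac F x \in unitmx;
  chart_bound_inv : forall x, usq x -> frob (invmx (jac F x)) <= C;
  chart_inj : set_inj usq F }.

Context (C : R) (F : R * R -> R * R) (C0 : 0 < C) (FC : chart C F).

Lemma chart_derivable m i x : usq x -> derivable (coord m \o F) x (bvec i).
Proof. by move=> ux; apply/diff_derivable/(chart_diff1 FC). Qed.

Lemma chart_pd_le m i x : usq x -> `|pd i (coord m \o F) x| <= C.
Proof.
by move=> ux; rewrite -[pd _ _ _](mxE matrix_key (fun m i => pd i (coord m \o F) x))
  (le_trans _ (chart_bound1 FC ux))// (le_trans _ (frob_ge _ m i))// mxE mxE.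
Qed.

Lemma chart_pd_lip m i x y : usq x -> usq y ->
  `|pd i (coord m \o F) y - pd i (coord m \o F) x| <= 2 * C * `|y - x|.
Proof.
move=> ux uy; apply: mean_value_bound => // j z uz; first exact/diff_derivable/(chart_diff2 FC).
by rewrite (le_trans _ (chart_bound2 FC uz))// hess_norm_ge.
Qed.

Lemma chart_lip x y : usq x -> usq y -> `|F y - F x| <= 2 * C * `|y - x|.
Proof.
move=> ux uy; have h m : `|coord m (F y) - coord m (F x)| <= 2 * C * `|y - x|.
  apply: (@mean_value_bound _ (coord m \o F)) => // i z uz.
    exact: chart_derivable.
  exact: chart_pd_le.
by rewrite norm_pair_le (h 0) (h 1).
Qed.

(** The base point [z] need not be x or y. The mean value points stay within r of z and the partial
    derivatives are 2C-Lipschitz, so freezing them at z costs 2Cr in each of the two directions. *)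
Lemma chart_linearization z x y r : usq z -> usq x -> usq y ->
  `|x - z| <= r -> `|y - z| <= r ->
  `|F y - F x - mxact (jac F z) (y - x)| <= 4 * C * r * `|y - x|.
Proof.
move=> uz ux uy xz yz.
have r0 : 0 <= r by rewrite (le_trans _ xz).
have h m : `|coord m (F y) - coord m (F x) -
    (pd 0 (coord m \o F) z * (y.1 - x.1) + pd 1 (coord m \o F) z * (y.2 - x.2))|
    <= 4 * C * r * `|y - x|.
  have [xi [eta [uxi ueta + /(_ z r xz yz)[xir etar]]]] := mean_value2 ux uy (fun i u => @chart_derivable m i u).
  rewrite /= => ->; set a := pd 0 _ xi; set b := pd 1 _ eta; set a' := pd 0 _ z; set b' := pd 1 _ z.
  rewrite (_ : _ - _ = (a - a') * (y.1 - x.1) + (b - b') * (y.2 - x.2)); last ring.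
  rewrite (le_trans (ler_normD _ _))// !normrM.
  rewrite (_ : 4 * _ * _ * _ = 2 * C * r * `|y - x| + 2 * C * r * `|y - x|); last ring.
  have lip i u : usq u -> `|u - z| <= r -> 
      `|pd i (coord m \o F) u - pd i (coord m \o F) z| <= 2 * C * r.
    move=> uu uz'; rewrite (le_trans (chart_pd_lip _ _ uz uu))// ler_wpM2l//.
    by rewrite mulr_ge0// ltW.
  by rewrite lerD// ler_pM ?lip ?(norm_coord_le 0 (y - x)) ?(norm_coord_le 1 (y - x)).
have := h 0; have := h 1; rewrite norm_pair_le /mxact !mxE/= => -> ->.
by [].
Qed.

(** Applying the inverse Jacobian to the linearization gives the error 8C^2 r |y - x|. The condition
    on r makes it at most half of the left-hand side, which absorbs it. *)
Lemma chart_expand z x y r : usq z -> usq x -> usq y -> 16 * C ^+ 2 * r <= 1 ->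
  `|x - z| <= r -> `|y - z| <= r -> `|y - x| <= 4 * C * `|F y - F x|.
Proof.
move=> uz ux uy r1 xz yz; set J := jac F z.
have E : y - x = mxact (invmx J) (mxact J (y - x)).
  by rewrite -mxactM mulVmx ?mxact1// (chart_unit FC).
have h1 : `|y - x| <= 2 * C * `|mxact J (y - x)|.
  rewrite [in leLHS]E (le_trans (mxact_le _ _))// ler_wpM2r// ler_wpM2l//.
  exact: (chart_bound_inv FC).
have h2 : `|mxact J (y - x)| <= `|F y - F x| + 4 * C * r * `|y - x|.
  rewrite -[X in `|X|](subKr (F y - F x)) (le_trans (ler_normB _ _))// lerD2l.
  exact: chart_linearization.
have h3 : 8 * C ^+ 2 * r * `|y - x| <= 2^-1 * `|y - x|.
  by rewrite ler_wpM2r//; lra.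
have : `|y - x| <= 2 * C * (`|F y - F x| + 4 * C * r * `|y - x|).
  by rewrite (le_trans h1)// ler_wpM2l// mulr_ge0// ltW.
by rewrite mulrDr; move: h3; lra.
Qed.

Lemma chart_coord_continuous m x : usq x -> {for x, continuous (coord m \o F)}.
Proof. by move=> ux; apply: differentiable_continuous; exact: (chart_diff1 FC). Qed.

(** Newton's map [T] with the derivative frozen at z has the solutions of F x = y as fixed points.
    It contracts by 1/2, since 2C * 4Cr <= 1/2, and moves z by at most half of [r'], so it maps the
    closed ball of radius [r'] into itself. *)
Lemma chart_open z r y : 16 * C ^+ 2 * r <= 1 ->
  (forall x, `|x - z| < r -> usq x) -> 4 * C * `|y - F z| < r ->
  exists x, `|x - z| < r /\ F x = y.
Proof.
move=> r1 Br; set r' := _ * _ => r'r.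
have r'0 : 0 <= r' by rewrite !mulr_ge0// ltW.
pose B := [set x | `|x - z| <= r'].
have Bu x : B x -> usq x by move=> Bx; apply/Br/(le_lt_trans Bx).
have Bz : B z by rewrite /B/= subrr normr0.
have uz := Bu _ Bz.
set J := jac F z; pose A := invmx J; pose T x := x - mxact A (F x - y).
have A_le u : `|mxact A u| <= 2 * C * `|u|.
  rewrite (le_trans (mxact_le _ _))// ler_wpM2r// ler_wpM2l//.
  exact: (chart_bound_inv FC).
have zz (a b c d : R * R) : a - b - (c - d) = - (b - d - (a - c)).
  by case: a b c d => ? ? [? ?] [? ?] [? ?]; congr pair => /=; ring.
have T_contr u v : B u -> B v -> `|T v - T u| <= 2^-1 * `|v - u|.
  move=> Bu' Bv; have -> : T v - T u = - mxact A (F v - F u - mxact J (v - u)).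
    rewrite [in RHS]mxactB -mxactM mulVmx ?(chart_unit FC)// mxact1.
    have -> : F v - F u = (F v - y) - (F u - y) by rewrite opprB addrA subrK.
    by rewrite mxactB; exact: zz.
  rewrite normrN (le_trans (A_le _))//.
  have : `|F v - F u - mxact J (v - u)| <= 4 * C * r * `|v - u|.
    by apply: chart_linearization; rewrite ?(le_trans _ (ltW r'r))//; exact: Bu.
  rewrite -(ler_pM2l (_ : 0 < 2 * C)) ?mulr_gt0// => /le_trans; apply.
  rewrite !mulrA ler_wpM2r//; move: r1; rewrite expr2; lra.
have TB u : B u -> B (T u).
  move=> Bu'; rewrite /B/= -(subrK (T z) (T u)) -addrA (le_trans (ler_normD _ _))//.
  rewrite [leRHS](splitr r') lerD//.
    by rewrite (le_trans (T_contr _ _ _ _))// mulrC ler_wpM2r.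
  rewrite /T addrAC subrr add0r normrN (le_trans (A_le _))// distrC /r'.
  by rewrite (_ : 4 * C * _ / 2 = 2 * C * `|y - F z|)//; field.
have cB : compact B.
  have -> : B = `[z.1 - r', z.1 + r'] `*` `[z.2 - r', z.2 + r'].
    apply/seteqP; split=> u; rewrite /B /= norm_pair_le/= !in_itv/= !ler_distl.
      by move=> /andP[-> ->].
    by move=> [-> ->].
  by apply: compact_setX; exact: segment_compact.
(* A minimizer of |T x - x| over the compact ball is a fixed point, because another application of
   [T] would halve the value. *)
have [|x Bx xmin] := @compact_EVT_min _ _ (fun x => `|T x - x|) B (ex_intro _ z Bz) cB.
  apply: continuous_in_subspaceT => x /set_mem/Bu ux.
  have -> : (fun x => `|T x - x|) = fun x => `|mxact A (F x - y)|.
    by apply/funext => u; rewrite /T addrAC subrr add0r normrN.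
  have cF m : coord m (F u - y) @[u --> x] --> coord m (F x - y).
    have -> : (fun u => coord m (F u - y)) = fun u => coord m (F u) - coord m y.
      by apply/funext => u; elim/ord2P: m.
    have -> : coord m (F x - y) = coord m (F x) - coord m y by elim/ord2P: m.
    apply: cvgB; last exact: cvg_cst.
    exact: chart_coord_continuous.
  have cL (a b : R) : a * coord 0 (F u - y) + b * coord 1 (F u - y) @[u --> x] -->
      a * coord 0 (F x - y) + b * coord 1 (F x - y).
    by apply: cvgD; apply: cvgM; try exact: cvg_cst; exact: cF.
  have cP : mxact A (F u - y) @[u --> x] --> mxact A (F x - y).
    exact: (cvg_pair (cL (A 0 0) (A 0 1)) (cL (A 1 0) (A 1 1))).
  exact: cvg_norm cP.
move/set_mem : Bx => Bx; exists x; split; first exact: le_lt_trans Bx r'r.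
have /xmin : T x \in B by rewrite inE; exact: TB.
move=> /le_trans/(_ (T_contr _ _ Bx (TB _ Bx))) h.
have : `|T x - x| <= 0 by move: h; lra.
rewrite normr_le0 /T addrAC subrr add0r oppr_eq0 => /eqP AF0.
have : mxact J (mxact A (F x - y)) = 0 by rewrite AF0 /mxact/= !mulr0 !addr0.
by rewrite -mxactM mulmxV ?mxact1 ?(chart_unit FC)// => /eqP; rewrite subr_eq0 => /eqP.
Qed.

End Chart.

(** * Planar measure under a chart *)

(** The integral of a nonnegative function is a supremum over the simple functions below it, so it
    is monotone on arbitrary functions. Edge integrands built from traces and normals are of this
    kind. *)
Lemma ge0_le_integral_all d (T : measurableType d) (R : realType)
    (mu : {measure set T -> \bar R}) (D : set T) (f g : T -> \bar R) :
  (forall x, D x -> 0 <= f x)%E -> (forall x, D x -> f x <= g x)%E ->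
  (\int[mu]_(x in D) f x <= \int[mu]_(x in D) g x)%E.
Proof.
move=> f0 fg; rewrite !ge0_integralE//; last by move=> x Dx; exact: le_trans (f0 _ Dx) (fg _ Dx).
apply: le_ereal_sup => _ [h hf <-]; exists h => // x.
by apply: (le_trans (hf x)); exact: lee_restrict.
Qed.

Section PlaneMeasure.
Context {R : realType}.
Implicit Types (x y z : R * R) (U V : set (R * R)).

Lemma openP U : open U <-> forall x, U x -> exists2 e : R, 0 < e & forall y, `|y - x| < e -> U y.
Proof.
split=> [oU x Ux|H].
  have /nbhs_ballP[e/= e0 eU] : nbhs x U by apply: open_nbhs_nbhs.
  by exists e => // y yx; apply: eU; rewrite -ball_normE/= distrC.
rewrite openE => x /H[e e0 eU]; apply/nbhs_ballP; exists e => //= y.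
by rewrite -ball_normE/= distrC => /eU.
Qed.

Lemma open_dist_lt z (r : R) : open [set y | `|y - z| < r].
Proof.
apply/openP => x /= xz; exists (r - `|x - z|) => [|y yx]; first by rewrite subr_gt0.
by rewrite -(subrK x y) -addrA (le_lt_trans (ler_normD _ _))// -ltrBrDr.
Qed.

Lemma usq_dist : usq = [set y : R * R | `|y - (2^-1, 2^-1)| < 2^-1].
Proof.
apply/seteqP; split=> y /=; rewrite norm_pair_lt/= !ltr_distl.
  by move=> /usqE[? ? ? ?]; apply/andP; split; apply/andP; split; lra.
by move=> /andP[/andP[? ?] /andP[? ?]]; apply/usqE; split; lra.
Qed.

Lemma open_usq : open (@usq R).
Proof. by rewrite usq_dist; exact: open_dist_lt. Qed.

Local Notation RR := (measurableTypeR R * measurableTypeR R)%type.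

Definition mplane U : Prop := measurable (U : set RR).

Lemma mplane_box (I J : interval R) : mplane ([set` I] `*` [set` J]).
Proof. by apply: measurableX; exact: measurable_itv. Qed.

Lemma mplane_usq : mplane usq. Proof. exact: mplane_box. Qed.

Lemma ball_box z (r : R) : [set y | `|y - z| < r] =
  `]z.1 - r, z.1 + r[ `*` `]z.2 - r, z.2 + r[.
Proof.
apply/seteqP; split=> u; rewrite /= norm_pair_lt/= !in_itv/= !ltr_distl.
  by move=> /andP[-> ->].
by move=> [-> ->].
Qed.

(** An open set is the countable union of the sup-norm balls with rational centre and radius 1/(n+1)
    that it contains, and these are products of intervals. *)
Lemma open_mplane U : open U -> mplane U.
Proof.
move=> /openP oU.
pose box (q : rat * rat * nat) : set (R * R) :=
  [set y | `|y - (ratr q.1.1, ratr q.1.2)| < q.2.+1%:R^-1].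
have -> : U = \bigcup_q (if `[< box q `<=` U >] then box q else set0).
  apply/seteqP; split=> [x Ux|x [q _]]; last first.
    by case: asboolP => [bU /bU|].
  have [e e0 eU] := oU _ Ux.
  have [n] := @ltr_add_invr R 0 (e / 2) (divr_gt0 e0 (ltr0Sn _ 1)).
  rewrite add0r => ne; have n0 : 0 < n.+1%:R^-1 :> R by rewrite invr_gt0.
  have rat_near (t d : R) : 0 < d -> exists q : rat, `|t - ratr q| < d.
    move=> d0; have [|q] := @rat_in_itvoo R t (t + d); first by rewrite ltrDl.
    by rewrite in_itv/= => /andP[tq qt]; exists q; rewrite ltr_distlC; apply/andP; split; lra.
  have [[a xa] [b xb]] := (rat_near x.1 _ n0, rat_near x.2 _ n0).
  have xbox : box (a, b, n) x by rewrite /box /= norm_pair_lt xa xb.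
  exists (a, b, n) => //=; case: asboolP => // -[] y; rewrite /box/= => yab.
  apply: eU; rewrite (splitr e) -(subrK (ratr a, ratr b) y) -addrA.
  rewrite (le_lt_trans (ler_normD _ _))// ltrD//; first exact: lt_trans ne.
  by rewrite distrC (lt_trans _ ne).
apply: countable_bigcupT_measurable => // q; case: asboolP => // _.
by rewrite /box ball_box; exact: mplane_box.
Qed.

Let leb1 (u v : R) b b' : u <= v ->
  lebesgue_measure [set` Interval (BSide b u) (BSide b' v)] = (v - u)%:E.
Proof.
move=> uv; rewrite lebesgue_measure_itv/=.
by case: ifPn => // /negbTE; rewrite lte_fin lt_neqAle uv andbT => /negbFE/eqP ->; rewrite subrr.
Qed.

Lemma leb2_box (a b c d : R) b1 b2 b3 b4 : a <= b -> c <= d ->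
  leb2 ([set` Interval (BSide b1 a) (BSide b2 b)] `*`
        [set` Interval (BSide b3 c) (BSide b4 d)]) = ((b - a) * (d - c))%:E.
Proof.
move=> ab cd; rewrite EFinM -(leb1 b1 b2 ab) -(leb1 b3 b4 cd).
by apply: product_measure1E; exact: measurable_itv.
Qed.

Lemma leb2_usq : leb2 (@usq R) = 1%:E.
Proof. by rewrite leb2_box// !subr0 mulr1. Qed.

Lemma leb2_ball z (r : R) : 0 <= r -> leb2 [set y | `|y - z| < r] = ((2 * r) ^+ 2)%:E.
Proof.
by move=> r0; rewrite ball_box leb2_box; [congr EFin; ring | lra..].
Qed.

Section chart_measure.
Context (C : R) (F : R * R -> R * R) (C0 : 0 < C) (FC : chart C F).

Lemma chart_open_image V : open V -> V `<=` usq -> open (F @` V).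
Proof.
move=> /openP oV Vu; apply/openP => _ [x Vx <-]; have [e e0 eV] := oV _ Vx.
pose r := Num.min e (16 * C ^+ 2)^-1.
have C2 : 0 < 16 * C ^+ 2 by rewrite mulr_gt0// exprn_gt0.
have r0 : 0 < r by rewrite lt_min e0 invr_gt0.
exists (r / (4 * C)) => [|y yx]; first by rewrite divr_gt0// mulr_gt0.
have [|u ux||z [zx <-]] := @chart_open _ C F C0 FC x r y.
- by rewrite -ler_pdivlMl// mulr1 ge_min lexx orbT.
- by apply/Vu/eV/(lt_le_trans ux); rewrite ge_min lexx.
- by rewrite -ltr_pdivlMl ?mulr_gt0// mulrC.
by exists z => //; apply/eV/(lt_le_trans zx); rewrite ge_min lexx.
Qed.

Section cells.
Context (V : set (R * R)) (oV : open V) (Vu : V `<=` usq).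
Context (N : nat) (N0 : 8 * C ^+ 2 <= N.+1%:R).
Implicit Types (p q : 'I_N.+1 * 'I_N.+1).
Let s : R := N.+1%:R^-1.
Let s0 : 0 < s. Proof. by rewrite invr_gt0. Qed.
Let ctr p : R * R := (s * (p.1%:R + 2^-1), s * (p.2%:R + 2^-1)).
Let cell p : set (R * R) :=
  `[s * p.1%:R, s * p.1.+1%:R[ `*` `[s * p.2%:R, s * p.2.+1%:R[.
Let ball_in p := forall y, `|y - ctr p| < s / 2 -> V y.
(** [s / (8 * C)] is the radius that [chart_open] reaches from the ball of radius s/2. The area of
    [img p] is that of the cell divided by 16C^2, which is where this constant originates. *)
Let img p : set (R * R) := [set y | `|y - F (ctr p)| < s / (8 * C)].

Let near_index (a : R) (i j : 'I_N.+1) :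
  `|a - s * (i%:R + 2^-1)| < s / 2 -> `|a - s * (j%:R + 2^-1)| < s / 2 -> i = j.
Proof.
rewrite !ltr_distl => /andP[i1 i2] /andP[j1 j2].
have h (k l : 'I_N.+1) : s * (k%:R + 2^-1) - s / 2 < s * (l%:R + 2^-1) + s / 2 -> (k <= l)%N.
  move=> kl; rewrite -ltnS -(ltr_nat R) -(ltr_pM2l s0) -natr1; lra.
apply/val_inj/eqP; rewrite eqn_leq/=.
by rewrite (h i j (lt_trans i1 j2)) (h j i (lt_trans j1 i2)).
Qed.

Let img_sub p : ball_in p -> img p `<=` F @` [set y | `|y - ctr p| < s / 2].
Proof.
move=> bp y yp; have [|x /bp/Vu//||x [xp <-]] := @chart_open _ C F C0 FC (ctr p) (s / 2) y.
- have : 8 * C ^+ 2 * s <= 1 by rewrite -ler_pdivlMr// invrK mul1r.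
  by rewrite mulrA; lra.
- rewrite -ltr_pdivlMl ?mulr_gt0//; move: yp; rewrite /img/=.
  by rewrite (_ : s / (8 * C) = (4 * C)^-1 * (s / 2))//; field; rewrite gt_eqF.
by exists x.
Qed.

(** A common point would have its preimages in two open cells; injectivity makes these preimages
    equal, and so the cells coincide. *)
Let trivIset_img : trivIset ball_in img.
Proof.
move=> p q bp bq [y [/(img_sub bp)[x xp xy] /(img_sub bq)[x' x'q x'y]]].
have xx : x = x'.
  by apply: (chart_inj FC); rewrite ?xy// inE; [apply/Vu/bp|apply/Vu/bq].
subst x'; move: xp x'q; rewrite /= !norm_pair_lt => /andP[p1 p2] /andP[q1 q2].
by case: p q {bp bq} p1 p2 q1 q2 => i j [k l]/= p1 p2 q1 q2;
  congr pair; [exact: near_index p1 q1|exact: near_index p2 q2].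
Qed.

Lemma chart_measure_cells :
  (leb2 (\bigcup_(p in ball_in) cell p) <= (16 * C ^+ 2)%:E * leb2 (F @` V))%E.
Proof.
have tcell : trivIset setT cell.
  move=> [i j] [k l] _ _ [x [[/= +] + []]]; rewrite /= !in_itv/=.
  have h (a : R) (m n : 'I_N.+1) : s * m%:R <= a -> a < s * n.+1%:R -> (m <= n)%N.
    by move=> ma an; rewrite -ltnS -(ltr_nat R) -(ltr_pM2l s0) (le_lt_trans ma).
  move=> /andP[i1 i2] /andP[j1 j2] /andP[k1 k2] /andP[l1 l2].
  congr pair; apply/val_inj/eqP; rewrite eqn_leq/=.
    by rewrite (h _ _ _ i1 k2) (h _ _ _ k1 i2).
  by rewrite (h _ _ _ j1 l2) (h _ _ _ l1 j2).
rewrite [leLHS]measure_fin_bigcup; last 3 first.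
- exact: finite_finset.
- by move=> p q _ _; apply: tcell.
- by move=> p _; exact: mplane_box.
have -> : (\sum_(p \in ball_in) leb2 (cell p) = \sum_(p \in ball_in) (16 * C ^+ 2)%:E * leb2 (img p))%E.
  apply: eq_fsbigr => p _; rewrite /cell /img leb2_ball ?divr_ge0 ?mulr_ge0// ?(ltW s0)// ?ltW//.
  rewrite leb2_box ?ler_wpM2l ?ler_nat// ?(ltW s0)// -EFinM; congr EFin.
  by rewrite -!natr1; field; rewrite gt_eqF.
rewrite -ge0_mule_fsumr//.
rewrite lee_wpmul2l ?lee_fin ?mulr_ge0 ?exprn_ge0 ?(ltW C0)//.
rewrite -measure_fin_bigcup; [|exact: finite_finset|exact: trivIset_img|]; last first.
  by move=> p _; rewrite /img ball_box; exact: mplane_box.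
apply: le_measure.
- rewrite inE; apply: fin_bigcup_measurable => [|p _]; first exact: finite_finset.
  by rewrite /img ball_box; exact: mplane_box.
- by apply/mem_set; apply: open_mplane; exact: chart_open_image.
by move=> y [p bp /(img_sub bp)[x /bp Vx <-]]; exists x.
Qed.

(** The centre of the cell containing x is within s/2 of x, so the ball of radius s/2 about the
    centre stays within s <= e of x. *)
Lemma mem_cell x e : usq x -> s <= e -> (forall y, `|y - x| < e -> V y) ->
  (\bigcup_(p in ball_in) cell p) x.
Proof.
move=> /usqE[x1 x1' x2 x2'] se eV.
have idx (a : R) : 0 < a -> a < 1 -> exists i : 'I_N.+1, s * i%:R <= a < s * i.+1%:R.
  move=> a0 a1; have iN : (Num.truncn (a / s) < N.+1)%N.
    by rewrite truncn_lt_nat ?divr_ge0// ?ltW// ltr_pdivrMr// mulfV ?gt_eqF.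
  exists (Ordinal iN) => /=; have : 0 <= a / s by rewrite divr_ge0// ltW.
  by move=> /truncn_itv/andP[]; rewrite ler_pdivlMr// ltr_pdivrMr// !(mulrC s) => -> ->.
have [[i xi] [j xj]] := (idx _ x1 x1', idx _ x2 x2').
exists (i, j) => /=; last by rewrite /cell/= !in_itv/=.
have half (a : R) (k : 'I_N.+1) : s * k%:R <= a < s * k.+1%:R -> `|s * (k%:R + 2^-1) - a| <= s / 2.
  by rewrite -natr1 ler_distl => /andP[h1 h2]; apply/andP; split; lra.
move=> y; rewrite /ctr/= => yc; apply/eV/(lt_le_trans _ se).
rewrite (splitr s) -(subrK (ctr (i, j)) y) -addrA (le_lt_trans (ler_normD _ _))//.
by rewrite ltr_leD// norm_pair_le/= !half.
Qed.

End cells.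

(* A quantitative inverse function theorem puts inside the image of every small
   square a square of comparable size; no change of variables is needed. *)
Lemma chart_measure V : open V -> V `<=` usq ->
  (leb2 V <= (16 * C ^+ 2)%:E * leb2 (F @` V))%E.
Proof.
move=> oV Vu; set K := (_ * _)%E.
(* The points of [V] at distance at least 1/(n+1) from its complement. They are covered by the cells
   of side 1/(n+1) inside [V] and increase to [V], so the estimate passes to the limit. *)
pose W n : set (R * R) := [set x | V x /\ forall y, `|y - x| < n.+1%:R^-1 -> V y].
have mW n : mplane (W n).
  have -> : W n = V `\` \bigcup_(y in ~` V) [set x | `|x - y| < n.+1%:R^-1].
    apply/seteqP; split=> x [Vx h]; split=> //.
      by move=> [y Vy xy]; apply/Vy/h; rewrite distrC.
    by move=> y xy; apply: contrapT => Vy; apply: h; exists y => //=; rewrite distrC.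
  apply: measurableD; first exact: open_mplane.
  by apply: open_mplane; apply: bigcup_open => y _; exact: open_dist_lt.
have VW : V = \bigcup_n W n.
  apply/seteqP; split=> [x Vx|x [n _ []]//].
  have [e e0 eV] := (openP V).1 oV x Vx; have [n] := @ltr_add_invr R 0 e e0.
  by rewrite add0r => ne; exists n => //; split=> // y xy; apply/eV/(lt_trans xy).
have ndW : {homo W : n m / (n <= m)%N >-> (n <= m)%O}.
  move=> n m nm; apply/subsetPset => x [Vx h]; split=> // y xy; apply/h/(lt_le_trans xy).
  by rewrite lef_pV2 ?posrE// ler_nat.
have cvgW : leb2 (W n) @[n --> \oo] --> leb2 V.
  by rewrite VW; apply: nondecreasing_cvg_mu => //; rewrite -VW; exact: open_mplane.
rewrite -(cvg_lim _ cvgW)//; apply: lime_le; first by apply/cvg_ex; exists (leb2 V).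
near=> n; have N0 : 8 * C ^+ 2 <= n.+1%:R.
  by rewrite (@le_trans _ _ n%:R) ?ler_nat//; near: n; exact: nbhs_infty_ger.
apply: (le_trans _ (chart_measure_cells oV Vu N0)).
apply: le_measure; rewrite ?inE; first exact: mW.
  by apply: fin_bigcup_measurable => // p _; exact: mplane_box.
by move=> x [/Vu ux h]; exact: (mem_cell ux (lexx _)).
Unshelve. all: end_near. Qed.

(** The sum is h times the number of levels h, 2h, ..., nh below v: the staircase approximation of v
    from below, with error at most h if the levels reach v. Removing one level drives the
    induction. *)
Lemma count_levels (h v : R) n : 0 < h -> 0 <= v ->
  \sum_(j < n) h * (j.+1%:R * h < v)%R%:R <= v /\
  (v <= n%:R * h -> v <= h + \sum_(j < n) h * (j.+1%:R * h < v)%R%:R).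
Proof.
move=> h0; elim: n v => [|n IH] v v0.
  by rewrite big_ord0 mul0r addr0; split=> // /le_trans; apply; exact: ltW.
rewrite big_ord_recl/= mul1r.
have [hv|vh] := ltP h v; last first.
  rewrite big1; last first.
    move=> i _; rewrite ltNge (le_trans vh) ?mulr0// ler_peMl ?(ltW h0)//.
    by rewrite ler1n.
  by rewrite mulr0 !addr0; split.
have /IH[IH1 IH2] : 0 <= v - h by rewrite subr_ge0 ltW.
have E : \sum_(i < n) h * ((bump 0 i).+1%:R * h < v)%R%:R = \sum_(j < n) h * (j.+1%:R * h < v - h)%R%:R.
  apply: eq_bigr => i _; rewrite /bump/= add1n -[i.+2]addn1 natrD mulrDl mul1r.
  by rewrite ltrBrDr.
rewrite E mulr1; split=> [|vn]; first lra.
have := IH2 _; rewrite -natr1 mulrDl mul1r in vn; lra.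
Qed.

(* Layer-cake argument: only the open superlevel sets are compared. *)
Lemma chart_integral (f : R * R -> R) (B : R) :
  (forall x, usq x -> 0 <= f (F x) <= B) ->
  (forall t, open [set x | usq x /\ t < f (F x)]) ->
  (\int[leb2]_(x in usq) (f (F x))%:E <= 
   (16 * C ^+ 2)%:E * \int[leb2]_(x in F @` usq) (f x)%:E)%E.
Proof.
move=> fB openf; apply/lee_addgt0Pr => e e0; have e0' : 0 <= e by exact: ltW.
have B0 : 0 <= B.
  have /fB/andP[] : @usq R (2^-1, 2^-1) by apply/usqE; split=> /=; lra.
  exact: le_trans.
(* [n] steps of height [e] cover the range [0, B] of [f]. *)
have [n] : exists n : nat, B < n%:R * e.
  exists (Num.truncn (B / e)).+1; rewrite -ltr_pdivrMr//.
  exact: truncnS_gt.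
move=> Bn.
pose E (j : 'I_n) : set (R * R) := [set x | usq x /\ j.+1%:R * e < f (F x)].
pose E' (j : 'I_n) : set (R * R) := [set y | (F @` usq) y /\ j.+1%:R * e < f y].
have E'E j : E' j = F @` E j.
  by apply/seteqP; split=> y; [move=> [[x ux <-] fx]; exists x|move=> [x [ux fx] <-]; split=> //; exists x].
have oE j : open (E j) by exact: openf.
have mE j : mplane (E j) by exact: open_mplane.
have mE' j : mplane (E' j).
  by rewrite E'E; apply: open_mplane; apply: chart_open_image => // x [].
pose lev (A : 'I_n -> set RR) j (x : RR) : \bar R := (e * \1_(A j) x)%:E.
have mlev A j (D : set RR) : mplane (A j) -> measurable_fun D (lev A j).
  move=> mA; apply/measurable_EFinP; apply: measurable_funM; first exact: measurable_cst.
  exact: measurable_indic.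
have lev0 A j x : (0 <= lev A j x)%E by rewrite lee_fin mulr_ge0.
have int_lev A (D : set RR) : mplane D -> (forall j, mplane (A j)) -> (forall j, A j `<=` D) ->
    (\int[leb2]_(x in D) \sum_j lev A j x = \sum_j e%:E * leb2 (A j))%E.
  move=> mD mA AD; rewrite ge0_integral_sum; [|exact: mD|by move=> j; exact: mlev|by []].
  apply: eq_bigr => j _; under eq_integral do rewrite /lev EFinM.
  rewrite ge0_integralZl_EFin //.
    rewrite integral_indic; [|exact: mD|exact: mA].
    by congr (_ * leb2 _)%E; exact/setIidPl/AD.
  by apply/measurable_EFinP; apply: measurable_indic; exact: mA.
have mimg : mplane (F @` usq) by apply: open_mplane; apply: chart_open_image => //; exact: open_usq.
have levE A x : (\sum_j lev A j x = (\sum_j e * (x \in A j)%:R)%:E)%E.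
  by rewrite -sumEFin; apply: eq_bigr => j _; rewrite /lev indicE.
apply: (@le_trans _ _ (\int[leb2]_(x in usq) (e%:E + \sum_j lev E j x))%E).
  apply: ge0_le_integral_all => x ux; first by rewrite lee_fin; have /andP[] := fB x ux.
  have /andP[f0 fBx] := fB x ux; rewrite levE -EFinD lee_fin.
  rewrite (eq_bigr (fun j : 'I_n => e * (j.+1%:R * e < f (F x))%R%:R)); last first.
    move=> j _; have -> // : (x \in E j) = (j.+1%:R * e < f (F x)).
    by apply/idP/idP => [/set_mem[]//|h]; apply/mem_set.
  by apply: (count_levels n e0 f0).2; rewrite (le_trans fBx)// ltW.
rewrite ge0_integralD//; last 3 first.
- exact: mplane_usq.
- by move=> x _; rewrite sume_ge0.
- by apply: emeasurable_sum => j; exact: mlev.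
(* The unit square has measure 1, so the slack [e] of the staircase costs exactly [e]. *)
rewrite [X in (X + _)%E](_ : _ = e%:E); last first.
  transitivity (e%:E * leb2 (@usq R))%E; last by rewrite leb2_usq mule1.
  by apply: integral_cst; exact: mplane_usq.
rewrite [X in (_ + X)%E](_ : _ = \sum_j e%:E * leb2 (E j))%E; last first.
  by apply: int_lev => //; [exact: mplane_usq|move=> j x []].
rewrite addeC leeD2r//.
apply: (@le_trans _ _ ((16 * C ^+ 2)%:E * \sum_j e%:E * leb2 (E' j))%E).
  rewrite ge0_sume_distrr; last by move=> j _; rewrite mule_ge0// lee_fin.
  apply: lee_sum => j _; rewrite muleCA E'E lee_wpmul2l ?lee_fin //.
  by apply: chart_measure => // x [].
rewrite lee_wpmul2l ?lee_fin ?mulr_ge0 ?exprn_ge0 ?(ltW C0)//.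
rewrite -(int_lev E' (F @` usq))//; last by move=> j y [].
apply: ge0_le_integral_all => y Fy; first by rewrite sume_ge0.
have /andP[f0 _] : 0 <= f y <= B by case: Fy => x ux <-; exact: fB.
rewrite levE lee_fin.
rewrite (eq_bigr (fun j : 'I_n => e * (j.+1%:R * e < f y)%R%:R)); last first.
  move=> j _; have -> // : (y \in E' j) = (j.+1%:R * e < f y).
  by apply/idP/idP => [/set_mem[]//|h]; apply/mem_set.
exact: (count_levels n e0 f0).1.
Qed.

End chart_measure.

End PlaneMeasure.

(** * Splines up to the boundary *)

Section Splines.
Context {R : realType}.
Implicit Types (Z : grid R) (s : bool) (p : nat) (v : R -> R) (r l t x : R).

Lemma spans_gt0 Z : (0 < spans Z)%N.
Proof.
rewrite lt0n; apply/eqP => Z0; have := knot_last Z; rewrite Z0 knot_first.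
by move/eqP; rewrite eq_sym oner_eq0.
Qed.

Lemma knot_le Z i j : (i <= j <= spans Z)%N -> knot Z i <= knot Z j.
Proof.
move=> /andP[+ jn]; elim: j jn => [|j IH] jn; first by rewrite leqn0 => /eqP ->.
rewrite leq_eqVlt => /predU1P[->//|ij]; rewrite (le_trans (IH _ _))//; first exact: ltnW.
exact/ltW/knot_lt.
Qed.

(** [end_lo] and [end_hi] delimit the grid cell touching 0 ([s] false) or 1 ([s] true), on which the
    polynomial trace inequality is applied. *)
Definition end_lo Z s : R := if s then knot Z (spans Z).-1 else 0.
Definition end_hi Z s : R := if s then 1 else knot Z 1.

Lemma end_lo_ge0 Z s : 0 <= end_lo Z s.
Proof. by case: s => //=; rewrite -(knot_first Z) knot_le// leq_pred. Qed.

Lemma end_hi_le1 Z s : end_hi Z s <= 1.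
Proof. by case: s => //=; rewrite -(knot_last Z) knot_le// leqnn spans_gt0. Qed.

Lemma end_lo_hi Z s : end_lo Z s < end_hi Z s.
Proof.
case: s => /=.
  by rewrite -[X in _ < X](knot_last Z) -[X in _ < knot _ X](prednK (spans_gt0 Z)) knot_lt// ltn_predL spans_gt0.
by rewrite -[X in X < _](knot_first Z) knot_lt// spans_gt0.
Qed.

Lemma end_endpoint Z s : (if s then end_hi Z s else end_lo Z s) = s%:R.
Proof. by case: s. Qed.

Lemma grid_min_le_end Z s : grid_min Z <= end_hi Z s - end_lo Z s.
Proof.
have i_lt : ((if s then (spans Z).-1 else 0) < spans Z)%N.
  by case: s; rewrite ?ltn_predL spans_gt0.
apply: (@bigmin_inf _ _ _ _ (Ordinal i_lt)) => //.
rewrite /knot_span /end_lo /end_hi/=; case: s i_lt => /= i_lt.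
  rewrite prednK ?spans_gt0// knot_last ger0_norm// subr_ge0.
  by rewrite -(knot_last Z) knot_le// leq_pred/=.
by rewrite knot_first ger0_norm// subr0 -(knot_first Z) knot_le// spans_gt0.
Qed.

Lemma spline_end p Z v s : spline p Z v ->
  exists2 q : {poly R}, (size q <= p.+1)%N &
    forall x, end_lo Z s < x < end_hi Z s -> v x = q.[x].
Proof.
move=> [_ _ vq]; case: s => /=.
  have [|q sq vE] := vq (spans Z).-1; first by rewrite ltn_predL spans_gt0.
  exists q => // x /andP[x0 x1]; apply: vE => //.
  by rewrite in_itv/= x0 prednK ?spans_gt0// knot_last ltW.
have [|q sq vE] := vq 0%N; first exact: spans_gt0.
exists q => // x /andP[x0 x1]; apply: vE.
  by rewrite in_itv/= knot_first x0 ltW.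
by rewrite (lt_le_trans x1)// (end_hi_le1 Z false).
Qed.

Lemma spline_derivable p Z v x : (2 <= p)%N -> spline p Z v -> 0 < x < 1 ->
  derivable v x 1.
Proof.
move=> p2 [dv _ _] x01; apply: (dv 0%N); last by rewrite in_itv.
by case: p p2 {dv} => [|[|]].
Qed.

Lemma spline_continuous p Z v x : (2 <= p)%N -> spline p Z v -> 0 < x < 1 ->
  {for x, continuous v}.
Proof.
move=> p2 sv x01; apply: differentiable_continuous; apply/derivable1_diffP.
exact: spline_derivable sv x01.
Qed.

Lemma spline_derive_continuous p Z v x : (2 <= p)%N -> spline p Z v -> 0 < x < 1 ->
  {for x, continuous (derive1 v)}.
Proof.
move=> p2 [dv cv _] x01; have xin : x \in `]0, 1[ by rewrite in_itv.
(* For p = 2 the first derivative has order p - 1 and its continuity is part of [spline]; for p >= 3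
   it is itself derivable. *)
case: p p2 dv cv => [|[|[|p]]]// _ dv cv; first exact: cv.
apply: differentiable_continuous; apply/derivable1_diffP.
exact: (dv 1%N).
Qed.

Lemma spline_derive_end Z v s (q : {poly R}) : 
  (forall x, end_lo Z s < x < end_hi Z s -> v x = q.[x]) ->
  forall x, end_lo Z s < x < end_hi Z s -> derive1 v x = q^`().[x].
Proof.
move=> vq x xs; rewrite [RHS](_ : _ = derive1 (horner q) x); last by rewrite -derivE.
rewrite !derive1E; apply: near_eq_derive.
near=> y; apply: vq; near: y.
by apply: (near_in_itvoo (a := end_lo Z s)); rewrite in_itv.
Unshelve. all: end_near. Qed.

Lemma horner_bounded (q : {poly R}) : exists B, forall x, 0 <= x <= 1 -> `|q.[x]| <= B.
Proof.
have [c _ cmax] := @EVT_max R (fun x => `|q.[x]|) 0 1 ler01 (continuous_subspaceT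
  (fun x => continuous_comp (@continuous_horner R q x) (@norm_continuous _ _ _))).
by exists `|q.[c]| => x x01; apply: cmax; rewrite in_itv.
Qed.

(** Continuity holds only on the open interval. Near the two ends the function is a polynomial, and
    what remains in the middle is a compact interval. *)
Lemma end_pieces_bounded Z v (q : bool -> {poly R}) :
  (forall s x, end_lo Z s < x < end_hi Z s -> v x = (q s).[x]) ->
  (forall x, 0 < x < 1 -> {for x, continuous v}) ->
  exists B, forall x, 0 < x < 1 -> `|v x| <= B.
Proof.
move=> vq cv.
have [[B0 HB0] [B1 HB1]] := (horner_bounded (q false), horner_bounded (q true)).
have ends s x : 0 < x < 1 -> end_lo Z s < x < end_hi Z s -> `|v x| <= Num.max B0 B1.
  move=> /andP[x0 x1] xs; rewrite (vq _ _ xs) le_max.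
  have x01 : 0 <= x <= 1 by rewrite !ltW.
  by case: s xs => _; rewrite ?HB0 ?HB1// orbT.
have h0 : 0 < end_hi Z false := end_lo_hi Z false.
have l1 : end_lo Z true < 1 := end_lo_hi Z true.
have [kl|lk] := leP (end_hi Z false) (end_lo Z true); last first.
  exists (Num.max B0 B1) => x /andP[x0 x1].
  have [xk|kx] := ltP x (end_hi Z false).
    by apply: (ends false); rewrite ?x0 ?x1//= xk andbT.
  by apply: (ends true); rewrite ?x0 ?x1//= andbT (lt_le_trans lk).
have [|c _ cmax] := @EVT_max R (fun x => `|v x|) _ _ kl.
  apply: continuous_in_subspaceT => x /set_mem; rewrite /= in_itv/= => /andP[hx xl].
  apply: continuous_comp; last exact: norm_continuous.
  by apply: cv; rewrite (lt_le_trans h0)// (le_lt_trans xl).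
exists (Num.max (Num.max B0 B1) `|v c|) => x /andP[x0 x1].
have [xk|kx] := ltP x (end_hi Z false).
  by rewrite le_max (ends false)// ?x0 ?x1//= xk andbT.
have [xl|lx] := leP x (end_lo Z true).
  by rewrite le_max orbC cmax// in_itv/= kx.
by rewrite le_max (ends true)// ?x0 ?x1//= lx.
Qed.

(* The continuous extension of v to [0, 1]. *)
Definition ext v r : R := lim (v x @[x --> within `]0, 1[ (nbhs r)]).

Lemma closure_unit r : 0 <= r <= 1 -> closure (`]0, 1[ : set R) r.
Proof.
move=> /andP[r0 r1] B /nbhs_normP[e/= e0 eB].
have [d [d0 d1 de]] : exists d, [/\ 0 < d, 2 * d <= 1 & 2 * d <= e].
  exists (Num.min 1 e / 2); rewrite divr_gt0 ?lt_min ?ltr01//.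
  by rewrite mulrC mulfVK// !ge_min !lexx orbT.
have h : r * d <= r / 2 by rewrite ler_wpM2l//; lra.
have h' : (1 - r) * d <= (1 - r) / 2 by rewrite ler_wpM2l ?subr_ge0//; lra.
have rd : 0 <= r * d by rewrite mulr_ge0// ltW.
have rd' : 0 <= (1 - r) * d by rewrite mulr_ge0 ?subr_ge0// ltW.
(* A small step from r towards the midpoint lands strictly inside, whether r is an endpoint or
   not. *)
exists (r + (2^-1 - r) * d); split.
  by rewrite /= in_itv/=; apply/andP; split; lra.
by apply: eB; rewrite /ball_/= ltr_distlC; apply/andP; split; lra.
Qed.

Lemma ext_cvg v r l : 0 <= r <= 1 ->
  v x @[x --> within `]0, 1[ (nbhs r)] --> l -> ext v r = l.
Proof.
move=> r01; apply: cvg_lim => //; apply: within_nbhs_proper.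
exact: closure_unit.
Qed.

Lemma ext_id v r : 0 < r < 1 -> {for r, continuous v} -> ext v r = v r.
Proof.
by move=> /andP[r0 r1] cv; apply: ext_cvg; [rewrite !ltW|exact: cvg_within_filter].
Qed.

Lemma end_near Z s : \forall x \near within `]0, 1[ (nbhs (s%:R : R)),
  end_lo Z s < x < end_hi Z s.
Proof.
have h : 0 < end_hi Z s - end_lo Z s by rewrite subr_gt0 end_lo_hi.
have H x : 0 < x -> x < 1 -> `|s%:R - x| < end_hi Z s - end_lo Z s -> end_lo Z s < x < end_hi Z s.
  by case: s h => /= h x0 x1; rewrite ltr_distlC => /andP[? ?]; apply/andP; split; lra.
rewrite near_withinE; near=> x => /=; rewrite in_itv/= => /andP[x0 x1].
by apply: H => //; near: x; apply/nbhs_normP; exists (end_hi Z s - end_lo Z s).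
Unshelve. all: end_near. Qed.

Lemma end_cvg Z s v (q : {poly R}) :
  (forall x, end_lo Z s < x < end_hi Z s -> v x = q.[x]) ->
  v x @[x --> within `]0, 1[ (nbhs (s%:R : R))] --> q.[s%:R].
Proof.
move=> vq; have h : q.[x] @[x --> within `]0, 1[ (nbhs (s%:R : R))] --> q.[s%:R].
  by apply: cvg_within_filter; exact: continuous_horner.
apply: cvg_trans h; apply: near_eq_cvg; near=> x; apply/esym/vq; near: x; exact: end_near.
Unshelve. all: end_near. Qed.

Lemma cvg_ord_sum (T : Type) (F : set_system T) (FF : Filter F) n (f : 'I_n -> T -> R)
    (l : 'I_n -> R) :
  (forall i, f i x @[x --> F] --> l i) -> \sum_i f i x @[x --> F] --> \sum_i l i.
Proof.
elim: n f l => [|n IH] f l fl.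
  by under eq_fun do rewrite big_ord0; rewrite big_ord0; exact: cvg_cst.
under eq_fun do rewrite big_ord_recr; rewrite big_ord_recr /=.
by apply: cvgD; [apply: IH|exact: fl].
Qed.

Lemma spline_ext_endE p Z v s q : (2 <= p)%N -> spline p Z v ->
  (forall x, end_lo Z s < x < end_hi Z s -> v x = q.[x]) ->
  ext v s%:R = q.[s%:R] /\ ext (derive1 v) s%:R = (q^`()).[s%:R].
Proof.
move=> p2 sv vq; have s01 : 0 <= (s%:R : R) <= 1 by case: s {vq}; rewrite lexx ler01.
by split; apply: ext_cvg => //; apply: (@end_cvg Z) => //; exact: spline_derive_end vq.
Qed.

Lemma unit_cases r : 0 <= r <= 1 -> (exists s, r = s%:R) \/ 0 < r < 1.
Proof.
move=> /andP[]; rewrite !le_eqVlt => /predU1P[<-|r0] /predU1P[r1|r1].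
- by left; exists false.
- by left; exists false.
- by left; exists true.
by right; rewrite r0 r1.
Qed.

Lemma spline_cvg_ext p Z v r : (2 <= p)%N -> spline p Z v -> 0 <= r <= 1 ->
  v x @[x --> within `]0, 1[ (nbhs r)] --> ext v r /\
  derive1 v x @[x --> within `]0, 1[ (nbhs r)] --> ext (derive1 v) r.
Proof.
move=> p2 sv r01; have [[s rs]|r01'] := unit_cases r01; last first.
  rewrite !ext_id//; [|exact: spline_derive_continuous sv _|exact: spline_continuous sv _].
  by split; apply: cvg_within_filter;
    [exact: spline_continuous sv _|exact: spline_derive_continuous sv _].
have [q sq vq] := spline_end s sv; rewrite rs.
have [-> ->] := spline_ext_endE p2 sv vq.
by split; apply: (@end_cvg Z) => //; exact: spline_derive_end vq.
Qed.

Lemma spline_bounded p Z v : (2 <= p)%N -> spline p Z v ->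
  exists B, forall x, 0 < x < 1 -> `|v x| <= B /\ `|derive1 v x| <= B.
Proof.
move=> p2 sv.
have [q0 _ vq0] := spline_end false sv; have [q1 _ vq1] := spline_end true sv.
have [] := @end_pieces_bounded Z v (fun s => if s then q1 else q0).
- by case.
- by move=> x; exact: (spline_continuous p2 sv).
move=> B HB; have [] := @end_pieces_bounded Z (derive1 v) (fun s => if s then q1^`() else q0^`()).
- by case=> x xs; exact: spline_derive_end xs.
- by move=> x; exact: (spline_derive_continuous p2 sv).
move=> B' HB'; exists (Num.max B B') => x x01.
by rewrite !le_max HB// HB'// orbT.
Qed.

End Splines.

(** * Tensor-product splines and their partial derivatives *)

Section Tensor.
Context {R : realType}.
Implicit Types (x y z : R * R) (r t : R) (m : nat).

Definition tens m (a b : 'I_m -> R -> R) x : R := \sum_i a i x.1 * b i x.2.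

Lemma is_derive_comb m (a : 'I_m -> R -> R) (c : 'I_m -> R) t :
  (forall i, derivable (a i) t 1) ->
  is_derive t 1 (fun s => \sum_i a i s * c i) (\sum_i derive1 (a i) t * c i).
Proof.
move=> da; have -> : (fun s => \sum_i a i s * c i) = \sum_i (c i *: a i).
  by apply/funext => s; rewrite fct_sumE; apply: eq_bigr => i _; rewrite mulrC.
have -> : \sum_i derive1 (a i) t * c i = \sum_i c i *: derive1 (a i) t.
  by apply: eq_bigr => i _; rewrite mulrC.
apply: is_derive_sum => i; apply: is_deriveZ.
by apply: DeriveDef; [exact: da|rewrite derive1E].
Qed.

Lemma cvg_usq_coord i z : coord i x @[x --> within usq (nbhs z)] --> within `]0, 1[ (nbhs (coord i z)).
Proof.
move=> P /= PP.
have : \forall x \near z, `]0, 1[%classic (coord i x) -> P (coord i x).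
  elim/ord2P: i PP => PP.
    have c : fst @ z --> z.1 by exact: cvg_fst.
    exact: c _ PP.
  have c : snd @ z --> z.2 by exact: cvg_snd.
  exact: c _ PP.
move=> H; have : nbhs z [set x | usq x -> P (coord i x)]; last by [].
apply: filterS H => x h /usqE[? ? ? ?]; apply: h.
by elim/ord2P: i PP => PP; rewrite /= in_itv/=; apply/andP.
Qed.

Section spline_tensor.
Context (p : nat) (Z1 Z2 : grid R) (p2 : (2 <= p)%N) (m : nat) (a b : 'I_m -> R -> R).
Context (sa : forall i, spline p Z1 (a i)) (sb : forall i, spline p Z2 (b i)).
Context (w : R * R -> R) (wE : forall x, usq x -> w x = tens a b x).

Let a' i := derive1 (a i).
Let b' i := derive1 (b i).

Let near_usq z : usq z -> \forall x \near z, usq x.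
Proof. by move=> uz; apply: open_nbhs_nbhs; split => //; exact: open_usq. Qed.

Let near_slice i z : usq z -> \forall s \near coord i z, usq (slice i z s).
Proof.
move=> /usqE[z1 z1' z2 z2'].
by elim/ord2P: i => /=; near=> s; apply/usqE; rewrite /slice/=; split=> //; near: s;
  [exact: lt_nbhsr|exact: lt_nbhsl|exact: lt_nbhsr|exact: lt_nbhsl].
Unshelve. all: end_near. Qed.

Lemma tensor_pd z : usq z ->
  [/\ derivable w z (bvec 0), derivable w z (bvec 1),
     pd 0 w z = tens a' b z & pd 1 w z = tens a b' z].
Proof.
move=> uz; have /usqE[z1 z1' z2 z2'] := uz.
have d0 : is_derive (coord 0 z) 1 (w \o slice 0 z) (tens a' b z).
  apply: (near_eq_is_derive (f := fun s => \sum_i a i s * b i z.2)).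
    by near=> s; rewrite /= wE//; near: s; exact: near_slice.
  by apply: is_derive_comb => i; apply: spline_derivable (sa i) _; rewrite ?z1.
have d1 : is_derive (coord 1 z) 1 (w \o slice 1 z) (tens a b' z).
  apply: (near_eq_is_derive (f := fun s => \sum_i b i s * a i z.1)).
    near=> s; rewrite /= wE; last by near: s; exact: near_slice.
    by apply: eq_bigr => i _; rewrite mulrC.
  have -> : tens a b' z = \sum_i b' i z.2 * a i z.1 by apply: eq_bigr => i _; rewrite mulrC.
  by apply: is_derive_comb => i; apply: spline_derivable (sb i) _; rewrite ?z2.
split; first by apply/derivable_sliceP; case: d0.
- by apply/derivable_sliceP; case: d1.
- by rewrite pd_slice; case: d0.
by rewrite pd_slice; case: d1.
Unshelve. all: end_near. Qed.

(* wext, wext0 and wext1 extend w and its two partial derivatives to the closed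
   square. *)
Definition wext z : R := \sum_i ext (a i) z.1 * ext (b i) z.2.
Definition wext0 z : R := \sum_i ext (a' i) z.1 * ext (b i) z.2.
Definition wext1 z : R := \sum_i ext (a i) z.1 * ext (b' i) z.2.

Lemma tensor_cvg_ext z : cusq z ->
  [/\ w x @[x --> within usq (nbhs z)] --> wext z,
      pd 0 w x @[x --> within usq (nbhs z)] --> wext0 z &
      pd 1 w x @[x --> within usq (nbhs z)] --> wext1 z].
Proof.
rewrite /cusq => -[/=]; rewrite !in_itv/= => z1 z2.
have ca i := spline_cvg_ext p2 (sa i) z1; have cb i := spline_cvg_ext p2 (sb i) z2.
have prod (f g : 'I_m -> R -> R) (h : R * R -> R) : 
    (forall x, usq x -> h x = tens f g x) ->
    (forall i, f i r @[r --> within `]0, 1[ (nbhs z.1)] --> ext (f i) z.1) ->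
    (forall i, g i r @[r --> within `]0, 1[ (nbhs z.2)] --> ext (g i) z.2) ->
    h x @[x --> within usq (nbhs z)] --> \sum_i ext (f i) z.1 * ext (g i) z.2.
  move=> hE cf cg.
  have ct : tens f g x @[x --> within usq (nbhs z)] --> \sum_i ext (f i) z.1 * ext (g i) z.2.
    apply: cvg_ord_sum => i; apply: cvgM.
      exact: cvg_comp (@cvg_usq_coord 0 z) (cf i).
    exact: cvg_comp (@cvg_usq_coord 1 z) (cg i).
  apply: cvg_trans ct; apply: near_eq_cvg; near=> x; rewrite hE//; near: x; exact: near_withinT.
split.
- by apply: prod => [//|i|i]; [case: (ca i)|case: (cb i)].
- by apply: prod => [x /tensor_pd[]//|i|i]; [case: (ca i)|case: (cb i)].
- by apply: prod => [x /tensor_pd[]//|i|i]; [case: (ca i)|case: (cb i)].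
Unshelve. all: end_near. Qed.

(** At an interior point the limit within the open square is a full limit, and the extended value is
    the value itself. *)
Lemma tensor_pd_continuous i z : usq z -> {for z, continuous (pd i w)}.
Proof.
move=> uz.
have cz : cusq z.
  by have /usqE[? ? ? ?] := uz; split; rewrite /= in_itv/= !ltW.
have [_ c0 c1] := tensor_cvg_ext cz.
have cvg_in (h : R * R -> R) (l : R) : h x @[x --> within usq (nbhs z)] --> l -> h x @[x --> z] --> l.
  move=> hl P /hl hP.
  by apply: filterS2 (near_usq uz) hP => x ux; apply.
have [_ _ E0 E1] := tensor_pd uz; have /usqE[z1 z1' z2 z2'] := uz.
have z1i : 0 < z.1 < 1 by rewrite z1.
have z2i : 0 < z.2 < 1 by rewrite z2.
elim/ord2P: i; apply: cvg_in.
  rewrite E0 (_ : tens a' b z = wext0 z)//; apply: eq_bigr => i _.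
  by rewrite !ext_id//; [exact: spline_continuous (sb i) _|exact: spline_derive_continuous (sa i) _].
rewrite E1 (_ : tens a b' z = wext1 z)//; apply: eq_bigr => i _.
by rewrite !ext_id//; [exact: spline_derive_continuous (sb i) _|exact: spline_continuous (sa i) _].
Qed.

Lemma tensor_bounded : exists B, forall x, usq x ->
  `|w x| <= B /\ forall i, `|pd i w x| <= B.
Proof.
have [Ba HBa] := choice (fun i => spline_bounded p2 (sa i)).
have [Bb HBb] := choice (fun i => spline_bounded p2 (sb i)).
exists (\sum_i Ba i * Bb i) => x ux; have /usqE[x1 x1' x2 x2'] := ux.
have x1i : 0 < x.1 < 1 by rewrite x1. 
have x2i : 0 < x.2 < 1 by rewrite x2. 
have h (f g : 'I_m -> R -> R) : (forall i, `|f i x.1| <= Ba i) -> (forall i, `|g i x.2| <= Bb i) ->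
    `|tens f g x| <= \sum_i Ba i * Bb i.
  move=> fB gB; rewrite (le_trans (ler_norm_sum _ _ _))// ler_sum// => i _.
  by rewrite normrM ler_pM.
have [_ _ pE0 pE1] := tensor_pd ux.
split; first by rewrite wE//; apply: h => i; [case: (HBa i _ x1i)|case: (HBb i _ x2i)].
elim/ord2P; rewrite ?pE0 ?pE1; apply: h => i.
- by case: (HBa i _ x1i).
- by case: (HBb i _ x2i).
- by case: (HBa i _ x1i).
- by case: (HBb i _ x2i).
Qed.

End spline_tensor.
End Tensor.

(** * Edge integrals of tensor splines *)

Section EdgeIntegral.
Context {R : realType}.
Implicit Types (x y z : R * R) (r t : R) (s : bool).
Local Notation leb := (@lebesgue_measure R).
Local Notation RR := (measurableTypeR R * measurableTypeR R)%type.

Lemma ge0_subset_integral_all d (T : measurableType d) (mu : {measure set T -> \bar R})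
    (A B : set T) (f : T -> \bar R) :
  A `<=` B -> (forall x : T, B x -> 0 <= f x)%E ->
  (\int[mu]_(x in A) f x <= \int[mu]_(x in B) f x)%E.
Proof.
move=> AB f0; rewrite (integral_mkcond A) (integral_mkcond B).
apply: ge0_le_integral_all => x _; rewrite !patchE; case: ifPn => // xA.
- by apply/f0/AB; exact: set_mem.
- by rewrite mem_set//; exact/AB/set_mem.
- by case: ifPn => // /set_mem; exact: f0.
Qed.

Lemma integral_poly_oo (a b : R) (q : {poly R}) : a < b ->
  (\int[leb]_(x in `]a, b[) (q.[x])%:E = (poly_int a b q)%:E)%E.
Proof.
move=> ab; rewrite -(integral_poly _ ab) [RHS](@integral_itv_bndoo R)//.
apply/measurable_EFinP; apply: open_continuous_measurable_fun => //.
by move=> x _; exact: continuous_horner.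
Qed.

(** Only the grid cell at the endpoint contributes, and its length is at least [h]. There are two
    functions because a gradient has two components. *)
Lemma end_bound p (Z : grid R) s (q0 q1 : {poly R}) (f0 f1 : R -> R) (h : R) : 
  (size q0 <= p.+1)%N -> (size q1 <= p.+1)%N -> 0 < h -> h <= grid_min Z ->
  (forall x : R, end_lo Z s < x < end_hi Z s -> f0 x = q0.[x] /\ f1 x = q1.[x]) ->
  ((q0.[s%:R] ^+ 2 + q1.[s%:R] ^+ 2)%:E <=
   (p.+1%:R ^+ 2 / h)%:E * \int[leb]_(x in `]0%R, 1%R[) (f0 x ^+ 2 + f1 x ^+ 2)%:E)%E.
Proof.
move=> sq0 sq1 h0 hZ fq; set N : R := p.+1%:R ^+ 2.
pose lo := end_lo Z s; pose hi := end_hi Z s; have lohi : lo < hi := end_lo_hi Z s.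
have N0 : 0 < N by rewrite exprn_gt0// ltr0n.
have sub : `]lo, hi[ `<=` `]0, 1[%classic.
  move=> x /=; rewrite !in_itv/= => /andP[lx xh].
  by rewrite (le_lt_trans (end_lo_ge0 Z s) lx) (lt_le_trans xh (end_hi_le1 Z s)).
apply: (@le_trans _ _ ((N / h)%:E * \int[leb]_(x in `]lo, hi[) (f0 x ^+ 2 + f1 x ^+ 2)%:E)%E); last first.
  rewrite lee_wpmul2l ?lee_fin ?divr_ge0 ?(ltW N0) ?(ltW h0)//.
  by apply: ge0_subset_integral_all => // x _; rewrite lee_fin addr_ge0 ?sqr_ge0.
have -> : (\int[leb]_(x in `]lo, hi[) (f0 x ^+ 2 + f1 x ^+ 2)%:E =
           \int[leb]_(x in `]lo, hi[) ((q0 ^+ 2 + q1 ^+ 2).[x])%:E)%E.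
  apply: eq_integral => x /set_mem; rewrite /= in_itv/= => /fq[-> ->].
  by rewrite hornerD !horner_exp.
rewrite integral_poly_oo// -EFinM lee_fin mulrAC ler_pdivlMr//.
have E : poly_int lo hi (q0 ^+ 2 + q1 ^+ 2) = poly_int lo hi (q0 ^+ 2) + poly_int lo hi (q1 ^+ 2).
  by rewrite -[q0 ^+ 2]scale1r poly_int_linear mul1r scale1r.
have := poly_trace s (ltW lohi) sq0; have := poly_trace s (ltW lohi) sq1.
rewrite /lo /hi end_endpoint -/N => h1 h2.
rewrite (@le_trans _ _ ((hi - lo) * (q0.[s%:R] ^+ 2 + q1.[s%:R] ^+ 2)))//.
  rewrite mulrC ler_wpM2r ?addr_ge0 ?sqr_ge0//.
  exact: le_trans (grid_min_le_end Z s).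
move: E; rewrite /lo /hi => ->; rewrite [leLHS]mulrDr [leRHS]mulrDr; exact: lerD h2 h1.
Qed.

Section spline_tensor.
Context (p : nat) (Z1 Z2 : grid R) (p2 : (2 <= p)%N) (m : nat) (a b : 'I_m -> R -> R).
Context (sa : forall i, spline p Z1 (a i)) (sb : forall i, spline p Z2 (b i)).
Context (w : R * R -> R) (wE : forall x, usq x -> w x = tens a b x).

Definition pd_sqr (v : R * R -> R) x : R := pd 0 v x ^+ 2 + pd 1 v x ^+ 2.

Let pdE x : usq x ->
  pd 0 w x = tens (fun i => derive1 (a i)) b x /\ pd 1 w x = tens a (fun i => derive1 (b i)) x.
Proof. by move=> /(tensor_pd p2 sa sb wE)[]. Qed.

Let usq_pair r t : 0 < r < 1 -> 0 < t < 1 -> usq (r, t).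
Proof. by move=> /andP[? ?] /andP[? ?]; apply/usqE. Qed.

Lemma measurable_spline (v : R -> R) Z : spline p Z v ->
  measurable_fun (`]0, 1[ : set (measurableTypeR R)) v /\
  measurable_fun (`]0, 1[ : set (measurableTypeR R)) (derive1 v).
Proof.
move=> sv; split; apply: open_continuous_measurable_fun => // x /set_mem; rewrite /= in_itv/=.
  exact: spline_continuous sv.
exact: spline_derive_continuous sv.
Qed.

Let measurable_tens (f g : 'I_m -> R -> R) :
  (forall i, measurable_fun (`]0, 1[ : set (measurableTypeR R)) (f i)) ->
  (forall i, measurable_fun (`]0, 1[ : set (measurableTypeR R)) (g i)) ->
  measurable_fun (usq : set RR) (tens f g : RR -> R).
Proof.
move=> mf mg; apply: measurable_sum => i; apply: measurable_funM.
  apply: (@measurable_comp _ _ _ _ _ _ (`]0, 1[ : set (measurableTypeR R)) (f i)) => //.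
    by move=> _ [x [x1 _] <-].
  exact: measurable_funTS.
apply: (@measurable_comp _ _ _ _ _ _ (`]0, 1[ : set (measurableTypeR R)) (g i)) => //.
  by move=> _ [x [_ x2] <-].
exact: measurable_funTS.
Qed.

Lemma measurable_pd_sqr : measurable_fun (usq : set RR) (pd_sqr w : RR -> R).
Proof.
apply: (eq_measurable_fun (fun x => tens (fun i => derive1 (a i)) b x ^+ 2 +
    tens a (fun i => derive1 (b i)) x ^+ 2)).
  by move=> x /set_mem/pdE[E0 E1]; rewrite /pd_sqr E0 E1.
by apply: measurable_funD; apply: measurable_funX; apply: measurable_tens => i;
  [case: (measurable_spline (sa i))|case: (measurable_spline (sb i))|
   case: (measurable_spline (sa i))|case: (measurable_spline (sb i))].
Qed.

(** Extension by 0 to the whole plane, the form in which Tonelli's theorem is applied. *)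
Let W : RR -> \bar R := (fun x => (pd_sqr w x)%:E) \_ (usq : set RR).

Let mW : measurable_fun setT W.
Proof.
apply: (iffLR (measurable_restrictT _ _)); first exact: mplane_usq.
by apply/measurable_EFinP; exact: measurable_pd_sqr.
Qed.

Let W0 x : (0 <= W x)%E.
Proof. by rewrite /W patchE; case: ifPn => // _; rewrite lee_fin addr_ge0 ?sqr_ge0. Qed.

Let W_l t : 0 < t < 1 -> (\int[leb]_r W (r, t) = \int[leb]_(r in `]0%R, 1%R[) (pd_sqr w (r, t))%:E)%E.
Proof.
move=> t01; rewrite [RHS]integral_mkcond; apply: eq_integral => r _.
rewrite /W !patchE; case: ifPn => [/set_mem/usqE[r0 r1 _ _]|nu].
  by rewrite mem_set//= in_itv/= r0.
case: ifPn => // /set_mem; rewrite /= in_itv/= => r01.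
by move: nu; rewrite mem_set//; exact: usq_pair.
Qed.

Let W_r t : 0 < t < 1 -> (\int[leb]_r W (t, r) = \int[leb]_(r in `]0%R, 1%R[) (pd_sqr w (t, r))%:E)%E.
Proof.
move=> t01; rewrite [RHS]integral_mkcond; apply: eq_integral => r _.
rewrite /W !patchE; case: ifPn => [/set_mem/usqE[_ _ r0 r1]|nu].
  by rewrite mem_set//= in_itv/= r0.
case: ifPn => // /set_mem; rewrite /= in_itv/= => r01.
by move: nu; rewrite mem_set//; exact: usq_pair.
Qed.

(** For a fixed tangential coordinate t, both partial derivatives are polynomials in the normal
    variable on the cell at the edge. [end_bound] along the normal line and Tonelli's theorem in t
    give the estimate. *)
Lemma edge_integral (h : R) e : 0 < h -> h <= grid_min Z1 -> h <= grid_min Z2 ->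
  (\int[leb]_(t in `]0%R, 1%R[)
      (wext0 a b (edge_par e t) ^+ 2 + wext1 a b (edge_par e t) ^+ 2)%:E <=
   (p.+1%:R ^+ 2 / h)%:E * \int[leb2]_(x in usq) (pd_sqr w x)%:E)%E.
Proof.
move=> h0 hZ1 hZ2; set K := p.+1%:R ^+ 2 / h.
have K0 : 0 <= K by rewrite divr_ge0 ?exprn_ge0// ltW.
have -> : (\int[leb2]_(x in usq) (pd_sqr w x)%:E = \int[leb2]_x W x)%E.
  by rewrite integral_mkcond.
have finish (G : measurableTypeR R -> \bar R) (f : R -> R) : (forall t, 0 <= f t) -> measurable_fun setT G ->
    (forall t, 0 <= G t)%E -> (forall t, (0 < t < 1)%R -> (f t)%:E <= K%:E * G t)%E ->
    (\int[leb]_(t in `]0%R, 1%R[) (f t)%:E <= K%:E * \int[leb]_t G t)%E.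
  move=> f0 mG G0 fG; rewrite -ge0_integralZl_EFin//.
  apply: (@le_trans _ _ (\int[leb]_(t in `]0%R, 1%R[) (K%:E * G t))%E).
    apply: ge0_le_integral_all => t; rewrite /= in_itv/= => t01; first by rewrite lee_fin.
    exact: fG.
  by apply: ge0_subset_integral_all => // t _; rewrite mule_ge0.
have sz (q : 'I_m -> {poly R}) (c : 'I_m -> R) : (forall i, (size (q i) <= p.+1)%N) ->
    (size (\sum_i c i *: q i)%R <= p.+1)%N.
  move=> sq; rewrite (leq_trans (size_sum _ _ _))//; apply/bigmax_leqP => i _.
  exact: leq_trans (size_scale_leq _ _) (sq i).
have hor (q : 'I_m -> {poly R}) (c : 'I_m -> R) r : (\sum_i c i *: q i).[r] = \sum_i c i * (q i).[r].
  by rewrite horner_sum; apply: eq_bigr => i _; rewrite hornerZ.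
have szd (q : {poly R}) : (size q <= p.+1)%N -> (size q^`() <= p.+1)%N.
  have [->|q0] := eqVneq q 0; first by rewrite deriv0.
  by apply: leq_trans; exact/ltnW/lt_size_deriv.
case: e => -[] s.
(* On a horizontal edge the normal variable is the second one, so it is integrated in the inner
   integral. *)
- rewrite (_ : (\int[leb2]_x W x)%E = (\int[leb]_t (\int[leb]_r W (t, r)))%E); last first.
    exact: fubini_tonelli1.
  apply: finish => [t||t|t t01].
  + by rewrite addr_ge0 ?sqr_ge0.
  + exact: measurable_fun_fubini_tonelli_F.
  + exact: integral_ge0.
  (* The polynomials of the factors in the normal direction; those of the tangential factors at t
     serve as coefficients. *)
  have [q sq] := choice (fun i => let: ex_intro2 q s1 s2 := spline_end s (sb i) in ex_intro _ q (conj s1 s2)).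
  rewrite W_r//.
  have -> : wext0 a b (edge_par (true, s) t) = (\sum_i derive1 (a i) t *: q i).[s%:R].
    rewrite hor; apply: eq_bigr => i _; rewrite /= ext_id//.
      by rewrite (spline_ext_endE p2 (sb i) (sq i).2).1.
    exact: spline_derive_continuous (sa i) _.
  have -> : wext1 a b (edge_par (true, s) t) = (\sum_i a i t *: (q i)^`()).[s%:R].
    rewrite hor; apply: eq_bigr => i _; rewrite /= ext_id//.
      by rewrite (spline_ext_endE p2 (sb i) (sq i).2).2.
    exact: spline_continuous (sa i) _.
  apply: (end_bound _ _ h0 hZ2) => [||r rs].
  + by apply: sz => i; case: (sq i).
  + by apply: sz => i; apply: szd; case: (sq i).
  have r01 : 0 < r < 1.
    by case/andP: rs => lr rh; rewrite (le_lt_trans (end_lo_ge0 Z2 s) lr) (lt_le_trans rh (end_hi_le1 Z2 s)).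
  have [-> ->] := pdE (usq_pair t01 r01); rewrite !hor; split; apply: eq_bigr => i _ /=.
    by rewrite (sq i).2.
  by rewrite (spline_derive_end (sq i).2).
- rewrite (_ : (\int[leb2]_x W x)%E = (\int[leb]_t (\int[leb]_r W (r, t)))%E); last first.
    exact: fubini_tonelli2.
  apply: finish => [t||t|t t01].
  + by rewrite addr_ge0 ?sqr_ge0.
  + exact: measurable_fun_fubini_tonelli_G.
  + exact: integral_ge0.
  have [q sq] := choice (fun i => let: ex_intro2 q s1 s2 := spline_end s (sa i) in ex_intro _ q (conj s1 s2)).
  rewrite W_l//.
  have -> : wext0 a b (edge_par (false, s) t) = (\sum_i b i t *: (q i)^`()).[s%:R].
    rewrite hor; apply: eq_bigr => i _; rewrite /= mulrC ext_id//.
      by rewrite (spline_ext_endE p2 (sa i) (sq i).2).2.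
    exact: spline_continuous (sb i) _.
  have -> : wext1 a b (edge_par (false, s) t) = (\sum_i derive1 (b i) t *: q i).[s%:R].
    rewrite hor; apply: eq_bigr => i _; rewrite /= mulrC ext_id//.
      by rewrite (spline_ext_endE p2 (sa i) (sq i).2).1.
    exact: spline_derive_continuous (sb i) _.
  apply: (end_bound _ _ h0 hZ1) => [||r rs].
  + by apply: sz => i; apply: szd; case: (sq i).
  + by apply: sz => i; case: (sq i).
  have r01 : 0 < r < 1.
    by case/andP: rs => lr rh; rewrite (le_lt_trans (end_lo_ge0 Z1 s) lr) (lt_le_trans rh (end_hi_le1 Z1 s)).
  have [-> ->] := pdE (usq_pair r01 t01); rewrite !hor; split; apply: eq_bigr => i _ /=.
    by rewrite mulrC (spline_derive_end (sq i).2).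
  by rewrite mulrC (sq i).2.
Qed.

End spline_tensor.
End EdgeIntegral.

(** * Gradients under a chart *)

Section Gradient.
Context {R : realType}.
Implicit Types (x y z d : R * R).
Local Notation RR := (measurableTypeR R * measurableTypeR R)%type.
Context (C : R) (F : R * R -> R * R) (C0 : 0 < C) (FC : chart C F).

Lemma small_ball_usq z e : usq z -> 0 < e -> exists r, [/\ 0 < r, r <= e, 16 * C ^+ 2 * r <= 1 &
  forall x, `|x - z| < r -> usq x].
Proof.
move=> uz e0; have [d d0 dU] := (openP usq).1 (@open_usq R) z uz.
have C2 : 0 < 16 * C ^+ 2 by rewrite mulr_gt0// exprn_gt0.
exists (Num.min (Num.min d e) (16 * C ^+ 2)^-1); split.
- by rewrite !lt_min d0 e0 invr_gt0.
- by rewrite !ge_min lexx orbT.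
- by rewrite -ler_pdivlMl// mulr1 ge_min lexx orbT.
by move=> x xz; apply/dU/(lt_le_trans xz); rewrite !ge_min lexx.
Qed.

(** A local inverse of [F] at F z that is Lipschitz at this point with constant 4C: existence comes
    from [chart_open], the estimate from [chart_expand]. *)
Lemma chart_preimage_near z e : usq z -> 0 < e -> exists2 d, 0 < d & forall y, `|y - F z| < d ->
  exists x, [/\ usq x, F x = y, `|x - z| < e & `|x - z| <= 4 * C * `|y - F z|].
Proof.
move=> uz e0; have [r [r0 re rC rU]] := small_ball_usq uz e0.
exists (r / (4 * C)) => [|y]; first by rewrite divr_gt0// mulr_gt0.
rewrite ltr_pdivlMr ?mulr_gt0// mulrC => yr.
have [x [xz Fx]] := chart_open C0 FC rC rU yr; exists x; split=> //.
- exact: rU.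
- exact: lt_le_trans re.
rewrite -Fx; apply: (chart_expand C0 FC uz uz (rU _ xz) rC); rewrite ?ltW//.
by rewrite subrr normr0.
Qed.

Context (v : R * R -> R).
Let w := v \o F.
Context (dw : forall i x, usq x -> derivable w x (bvec i)).
Context (cw : forall i x, usq x -> {for x, continuous (pd i w)}).

Lemma C1_linearization z (e : R) : usq z -> 0 < e -> exists2 r, 0 < r & forall x, usq x -> `|x - z| < r ->
  `|w x - w z - (pd 0 w z * (x.1 - z.1) + pd 1 w z * (x.2 - z.2))| <= e * `|x - z|.
Proof.
move=> uz e0; have e20 : 0 < e / 2 by rewrite divr_gt0.
have c i : exists2 r, 0 < r & forall x, `|x - z| < r -> `|pd i w x - pd i w z| <= e / 2.
  have /cvgrPdist_le/(_ _ e20)/nbhs_normP[r/= r0 rP] := @cw i z uz.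
  by exists r => // x xz; rewrite distrC; apply: rP; rewrite /= distrC.
have [[r r0 rP] [s s0 sP]] := (c 0, c 1).
exists (Num.min r s); first by rewrite lt_min r0.
move=> x ux; rewrite lt_min => /andP[xr xs].
have [xi [eta [_ _ -> /(_ z `|x - z|)]]] := mean_value2 uz ux dw.
rewrite subrr normr0 => /(_ (normr_ge0 _) (lexx _))[xiz etaz].
rewrite (_ : _ - _ = (pd 0 w xi - pd 0 w z) * (x.1 - z.1) + (pd 1 w eta - pd 1 w z) * (x.2 - z.2)); last ring.
rewrite (le_trans (ler_normD _ _))// !normrM.
rewrite (_ : e * _ = e / 2 * `|x - z| + e / 2 * `|x - z|); last by field.
have h0 := rP _ (le_lt_trans xiz xr); have h1 := sP _ (le_lt_trans etaz xs).
have c0 := norm_coord_le 0 (x - z); have c1 := norm_coord_le 1 (x - z).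
apply: lerD; first exact: (ler_pM _ _ h0 c0).
exact: (ler_pM _ _ h1 c1).
Qed.

(** Chain rule for v as the composition of w with the local inverse of [F]. The preimage x of F z +
    h e_m satisfies x - z = h J^-1 e_m - q with q of order h^2, and this is inserted into the
    linearization of w at z. *)
Lemma is_derive_inverse z m : usq z ->
  is_derive (F z) (bvec m) v
    (pd 0 w z * invmx (jac F z) 0 m + pd 1 w z * invmx (jac F z) 1 m).
Proof.
move=> uz; set J := jac F z; set A := invmx J; set L := _ + _.
pose B := `|pd 0 w z| + `|pd 1 w z|.
have B0 : 0 <= B by rewrite addr_ge0.
suff dL : (fun h : R => h^-1 *: ((v \o shift (F z)) (h *: bvec m) - v (F z))) @ 0^' --> L.
  by apply: DeriveDef; [apply/cvg_ex; exists L|exact: cvg_lim].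
apply/cvgrPdist_le => e e0.
(* Since |x - z| <= 4C|h|, this tolerance costs e/2 times |h|. *)
have eC : 0 < e / (8 * C) by rewrite divr_gt0// mulr_gt0.
have [r r0 rP] := C1_linearization uz eC.
have [d d0 dP] := chart_preimage_near uz r0.
(* The contribution of the quadratic remainder [q] is at most (K - 1)/2 times h^2, so |h| <= e/K
   leaves at most e/2 times |h|. The summand 1 keeps [K] positive when the gradient of w vanishes at
   z. *)
pose K := 2 * (B * (2 * C * (4 * C * (4 * C) ^+ 2))) + 1.
have K0 : 0 < K by rewrite ltr_wpDl// !mulr_ge0 ?exprn_ge0 ?mulr_ge0// ltW.
have bm : `|bvec m : R * R| <= 1.
  by rewrite norm_pair_le; elim/ord2P: m {L dP} => /=; rewrite normr1 normr0 lexx ler01.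
have dK0 : 0 < Num.min d (e / K) by rewrite lt_min d0 divr_gt0.
apply/nbhs_normP; exists (Num.min d (e / K)) => //= h.
rewrite /= sub0r normrN lt_min => /andP[hd hK] h0.
have yh : `|h *: bvec m + F z - F z| <= `|h|.
  by rewrite addrK normrZ ler_piMr.
have [x [ux Fx xr xh]] := dP _ (le_lt_trans yh hd).
have {}xh : `|x - z| <= 4 * C * `|h|.
  by rewrite (le_trans xh)// ler_wpM2l// mulr_ge0// ltW.
have := rP x ux xr; rewrite /w /= Fx => E1.
have E2 := chart_linearization C0 FC uz uz ux (r := `|x - z|).
have {}E2 : `|h *: bvec m - mxact J (x - z)| <= 4 * C * `|x - z| * `|x - z|.
  have := E2 _ (lexx _); rewrite subrr normr0 Fx addrK; exact.
have [q Dx qB] : exists2 q, x - z = h *: mxact A (bvec m) - q &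
    `|q| <= 2 * C * (4 * C * (4 * C) ^+ 2 * `|h| ^+ 2).
  exists (mxact A (h *: bvec m - mxact J (x - z))).
    have -> : mxact A (h *: bvec m - mxact J (x - z)) = h *: mxact A (bvec m) - (x - z).
      rewrite (mxactB A (h *: bvec m) (mxact J (x - z))) (mxactZ A h (bvec m)).
      by rewrite -mxactM mulVmx ?(chart_unit FC)// mxact1.
    by rewrite subKr.
  rewrite (le_trans (mxact_le _ _))//.
  rewrite ler_pM ?mulr_ge0 ?sqrtr_ge0//.
    by rewrite ler_wpM2l// (chart_bound_inv FC).
  rewrite (le_trans E2)// -!mulrA ler_wpM2l// ler_wpM2l ?(ltW C0)// -expr2.
  rewrite (_ : 4 * (C * _) = (4 * C * `|h|) ^+ 2); last ring.
  by rewrite ler_sqr ?nnegrE// !mulr_ge0// ltW.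
have Lh : pd 0 w z * (x.1 - z.1) + pd 1 w z * (x.2 - z.2) =
    h * L - (pd 0 w z * q.1 + pd 1 w z * q.2).
  have := congr1 fst Dx; have := congr1 snd Dx; rewrite /= => -> ->.
  rewrite (_ : L = pd 0 w z * (A 0 0 * (bvec m).1 + A 0 1 * (bvec m).2) +
      pd 1 w z * (A 1 0 * (bvec m).1 + A 1 1 * (bvec m).2)).
    by rewrite /GRing.scale/=; ring.
  by rewrite /L; elim/ord2P: (m) => /=; rewrite !(mulr0, mulr1, addr0, add0r).
rewrite Lh in E1.
have qq : `|pd 0 w z * q.1 + pd 1 w z * q.2| <= B * (2 * C * (4 * C * (4 * C) ^+ 2 * `|h| ^+ 2)).
  rewrite (le_trans (ler_normD _ _))// !normrM mulrDl lerD// ler_wpM2l// (le_trans _ qB)//.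
    exact: (norm_coord_le 0 q).
  exact: (norm_coord_le 1 q).
have hn0 : 0 < `|h| by rewrite normr_gt0.
rewrite -(ler_pM2l hn0) -normrM.
set D := (v \o _) _ - _; set P := pd 0 w z * q.1 + _ in E1 Lh qq.
have -> : h * (L - h^-1 *: D) = P - (D - (h * L - P)).
  by rewrite mulrBr /GRing.scale/= mulrA divff// mul1r; ring.
rewrite (le_trans (ler_normB _ _))//.
have half : `|P| <= e / 2 * `|h|.
  rewrite (le_trans qq)// (_ : _ * _ = (K - 1) / 2 * `|h| * `|h|); last by rewrite /K; field.
  rewrite ler_wpM2r// mulrAC ler_pdivrMr// divfK// (le_trans _ (_ : K * `|h| <= e))//.
    by rewrite ler_wpM2r// gerBl.
  by rewrite mulrC -ler_pdivlMr// ltW.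
have half' : `|D - (h * L - P)| <= e / 2 * `|h|.
  rewrite (le_trans E1)// (le_trans (ler_wpM2l (ltW eC) xh))//.
  by rewrite (_ : e / (8 * C) * (4 * C * `|h|) = e / 2 * `|h|)//; field; rewrite gt_eqF.
by rewrite (_ : `|h| * e = e / 2 * `|h| + e / 2 * `|h|); [rewrite lerD|field].
Qed.

Definition grad_sqr (u : R * R -> R) x : R := dot (grad u x) (grad u x).

Lemma grad_sqr_ge0 u x : 0 <= grad_sqr u x.
Proof. by rewrite /grad_sqr /dot addr_ge0// -expr2 sqr_ge0. Qed.

Lemma pd_inverse z m : usq z ->
  pd m v (F z) = pd 0 w z * invmx (jac F z) 0 m + pd 1 w z * invmx (jac F z) 1 m.
Proof. by move=> uz; have [_ <-] := is_derive_inverse m uz. Qed.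

Lemma pd_chart z i : usq z ->
  pd i w z = pd 0 v (F z) * jac F z 0 i + pd 1 v (F z) * jac F z 1 i.
Proof.
move=> uz; rewrite !pd_inverse//; set A := invmx _; set J := jac F z.
have AJ j : A j 0 * J 0 i + A j 1 * J 1 i = (j == i)%:R.
  have : (A *m J) j i = (j == i)%:R by rewrite mulVmx ?(chart_unit FC)// mxE.
  by rewrite mxE sum_ord2.
transitivity (pd 0 w z * (0 == i)%:R + pd 1 w z * (1 == i)%:R); last by rewrite -!AJ; ring.
by elim/ord2P: (i) => /=; rewrite !(mulr0, mulr1, addr0, add0r).
Qed.

Let sqr_comb_le (p q a b : R) : `|a| <= C -> `|b| <= C ->
  (p * a + q * b) ^+ 2 <= 2 * C ^+ 2 * (p ^+ 2 + q ^+ 2).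
Proof.
move=> aC bC.
have sq c : `|c| <= C -> c ^+ 2 <= C ^+ 2.
  by move=> cC; rewrite -[c ^+ 2]real_normK ?num_real// ler_sqr ?nnegrE// ltW.
have h1 : p ^+ 2 * a ^+ 2 <= p ^+ 2 * C ^+ 2 by rewrite ler_wpM2l ?sqr_ge0// sq.
have h2 : q ^+ 2 * b ^+ 2 <= q ^+ 2 * C ^+ 2 by rewrite ler_wpM2l ?sqr_ge0// sq.
have := sqr_ge0 (p * a - q * b); move: h1 h2; rewrite !expr2; nra.
Qed.

Lemma grad_sqr_le z : usq z -> grad_sqr v (F z) <= 4 * C ^+ 2 * pd_sqr w z.
Proof.
move=> uz; rewrite /grad_sqr /dot /grad/= -!expr2 !pd_inverse//.
have h m i : `|invmx (jac F z) m i| <= C.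
  by rewrite (le_trans (frob_ge _ m i))// (chart_bound_inv FC).
rewrite (_ : 4 * _ * _ = 2 * C ^+ 2 * pd_sqr w z + 2 * C ^+ 2 * pd_sqr w z); last ring.
by rewrite lerD// sqr_comb_le.
Qed.

Lemma pd_sqr_le z : usq z -> pd_sqr w z <= 4 * C ^+ 2 * grad_sqr v (F z).
Proof.
move=> uz; rewrite /pd_sqr !pd_chart//.
have h m i : `|jac F z m i| <= C.
  by rewrite (le_trans (frob_ge _ m i))// (chart_bound1 FC).
rewrite (_ : 4 * _ * _ = 2 * C ^+ 2 * (pd 0 v (F z) ^+ 2 + pd 1 v (F z) ^+ 2) +
   2 * C ^+ 2 * (pd 0 v (F z) ^+ 2 + pd 1 v (F z) ^+ 2)).
  by rewrite lerD// sqr_comb_le.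
by rewrite /grad_sqr /dot /grad/=; ring.
Qed.

(** Cramer's rule writes the gradient of v at F x through the partial derivatives of w and the
    Jacobian entries. In this form continuity in x is evident, and the layer-cake estimate needs
    exactly these open sets. *)
Lemma grad_sqr_superlevel (t : R) : open [set x | usq x /\ t < grad_sqr v (F x)].
Proof.
have [J JE] : exists J : 'I_2 -> 'I_2 -> R * R -> R, forall m i x, jac F x m i = J m i x.
  by exists (fun m i x => jac F x m i).
pose D x := J 0 0 x * J 1 1 x - J 0 1 x * J 1 0 x.
pose g0 x := (pd 0 w x * J 1 1 x - pd 1 w x * J 1 0 x) / D x.
pose g1 x := (pd 1 w x * J 0 0 x - pd 0 w x * J 0 1 x) / D x.
have D0 x : usq x -> D x != 0.
  move=> ux; have := mulVmx (chart_unit FC ux).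
  move: (invmx _) => A /matrixP AJ; have e i j := AJ i j.
  have := e 0 0; have := e 0 1; have := e 1 0; have := e 1 1.
  rewrite mxE [in X in _ = X]mxE sum_ord2 !JE => e11.
  rewrite mxE [in X in _ = X]mxE sum_ord2 !JE => e10.
  rewrite mxE [in X in _ = X]mxE sum_ord2 !JE => e01.
  rewrite mxE [in X in _ = X]mxE sum_ord2 !JE => e00.
  have : (A 0 0 * A 1 1 - A 0 1 * A 1 0) * D x = 1.
    transitivity ((A 0 0 * J 0 0 x + A 0 1 * J 1 0 x) * (A 1 0 * J 0 1 x + A 1 1 * J 1 1 x) -
      (A 0 0 * J 0 1 x + A 0 1 * J 1 1 x) * (A 1 0 * J 0 0 x + A 1 1 * J 1 0 x)).
      by rewrite /D; ring.
    by rewrite e00 e01 e10 e11 mulr0 subr0 mulr1.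
  by apply: contra_eq_neq => ->; rewrite mulr0 eq_sym oner_eq0.
have gE x : usq x -> pd 0 v (F x) = g0 x /\ pd 1 v (F x) = g1 x.
  move=> ux; have D0x := D0 x ux; rewrite /g0 /g1 !(pd_chart _ ux) !JE.
  by split; apply/(canRL (mulfK D0x)); rewrite /D; ring.
have cJ m i x : usq x -> {for x, continuous (J m i)}.
  move=> ux; have -> : J m i = pd i (coord m \o F).
    by apply/funext => y; rewrite -JE mxE.
  by apply: differentiable_continuous; exact: (chart_diff2 FC).
rewrite openE => z [uz tz].
have cg : (fun x => g0 x ^+ 2 + g1 x ^+ 2) @ z --> g0 z ^+ 2 + g1 z ^+ 2.
  have cD : D @ z --> D z.
    exact: (cvgB (cvgM (cJ 0 0 z uz) (cJ 1 1 z uz)) (cvgM (cJ 0 1 z uz) (cJ 1 0 z uz))).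
  have cDi : (fun x => (D x)^-1) @ z --> (D z)^-1 by apply: cvgV => //; exact: D0.
  have cq i j m n k l : (fun x => (pd i w x * J j m x - pd n w x * J k l x) / D x) @ z -->
      (pd i w z * J j m z - pd n w z * J k l z) / D z.
    exact: (cvgM (cvgB (cvgM (@cw i z uz) (cJ j m z uz)) (cvgM (@cw n z uz) (cJ k l z uz))) cDi).
  have cg0 : g0 @ z --> g0 z by exact: cq.
  have cg1 : g1 @ z --> g1 z by exact: cq.
  exact: (cvgD (cvgM cg0 cg0) (cvgM cg1 cg1)).
have E x : usq x -> grad_sqr v (F x) = g0 x ^+ 2 + g1 x ^+ 2.
  by move=> ux; rewrite /grad_sqr /dot /grad/= -!expr2; have [-> ->] := gE x ux.
have oU := open_nbhs_nbhs (conj (@open_usq R) uz).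
near=> x.
have ux : usq x by near: x.
split=> //; rewrite E//; near: x; apply: (cvgr_gt _ cg).
by rewrite -E.
Unshelve. all: end_near. Qed.

(** The superlevel sets on the patch are images of open sets, hence open. *)
Lemma grad_sqr_measurable : measurable_fun (F @` usq : set RR) (grad_sqr v : RR -> R).
Proof.
move=> mD; apply: (measurability _ (RGenOInfty.measurableE R)) => //.
move=> _ [_ [t ->] <-]; rewrite set_itvoy.
have -> : F @` usq `&` grad_sqr v @^-1` [set x | t < x] =
    F @` [set x | usq x /\ t < grad_sqr v (F x)].
  apply/seteqP; split=> y; first by move=> [[x ux <-] tx]; exists x.
  by move=> [x [ux tx] <-]; split=> //; exists x.
apply: open_mplane; apply: (chart_open_image C0 FC); last by move=> x [].
exact: grad_sqr_superlevel.
Qed.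

Lemma chart_image_bounded z : usq z -> F @` usq `<=` [set y | `|y - F z| < 2 * C].
Proof.
move=> uz _ [x ux <-] /=; rewrite (le_lt_trans (chart_lip FC uz ux))//.
rewrite gtr_pMr ?mulr_gt0// norm_pair_lt /=.
by have /usqE[? ? ? ?] := ux; have /usqE[? ? ? ?] := uz; rewrite !ltr_norml; 
  apply/andP; split; apply/andP; split; lra.
Qed.

Lemma chart_image_mplane : mplane (F @` usq).
Proof. by apply: open_mplane; apply: (chart_open_image C0 FC) => //; exact: open_usq. Qed.

Lemma chart_image_finite : (leb2 (F @` usq) < +oo)%E.
Proof.
have uc : @usq R (2^-1, 2^-1) by apply/usqE; split=> /=; lra.
apply: (@le_lt_trans _ _ (leb2 [set y | `|y - F (2^-1, 2^-1)| < 2 * C])); last first.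
  by rewrite leb2_ball ?ltry// mulr_ge0// ltW.
apply: le_measure; rewrite ?inE; first exact: chart_image_mplane.
  by apply: open_mplane; exact: open_dist_lt.
exact: chart_image_bounded.
Qed.

Context (B : R) (wB : forall x, usq x -> forall i, `|pd i w x| <= B).

Let grad_sqr_bound x : usq x -> grad_sqr v (F x) <= 4 * C ^+ 2 * (2 * B ^+ 2).
Proof.
move=> ux; rewrite (le_trans (grad_sqr_le ux))// ler_wpM2l//.
  by rewrite mulr_ge0// sqr_ge0.
have sq i : pd i w x ^+ 2 <= B ^+ 2.
  by rewrite -[_ ^+ 2]real_normK ?num_real// ler_sqr ?nnegrE ?wB// (le_trans _ (wB ux i)).
by rewrite /pd_sqr (_ : 2 * _ = B ^+ 2 + B ^+ 2) ?lerD//; ring.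
Qed.

Lemma grad_sqr_integrable : leb2.-integrable (F @` usq) (EFin \o grad_sqr v).
Proof.
apply: measurable_bounded_integrable.
- exact: chart_image_mplane.
- exact: chart_image_finite.
- exact: grad_sqr_measurable.
exists (4 * C ^+ 2 * (2 * B ^+ 2)); split; first exact: num_real.
move=> r Br _ [x ux <-] /=; rewrite ger0_norm ?grad_sqr_ge0//.
exact: (le_trans (grad_sqr_bound ux) (ltW Br)).
Qed.

(** 64C^4 is the product of 4C^2 from the pointwise chain rule and 16C^2 from the comparison of
    areas. *)
Lemma pd_sqr_integral_le :
  (\int[leb2]_(x in usq) (pd_sqr w x)%:E <=
   (64 * C ^+ 4)%:E * \int[leb2]_(x in F @` usq) (grad_sqr v x)%:E)%E.
Proof.
have C2 : 0 < 4 * C ^+ 2 by rewrite mulr_gt0// exprn_gt0.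
apply: (@le_trans _ _ (\int[leb2]_(x in usq) (4 * C ^+ 2 * grad_sqr v (F x))%:E)%E).
  apply: ge0_le_integral_all => x ux; first by rewrite lee_fin addr_ge0 ?sqr_ge0.
  by rewrite lee_fin pd_sqr_le.
have := @chart_integral _ C F C0 FC (fun y => 4 * C ^+ 2 * grad_sqr v y)
  (4 * C ^+ 2 * (4 * C ^+ 2 * (2 * B ^+ 2))).
move=> /(_ _ _)/le_trans; apply.
- move=> x ux; rewrite mulr_ge0 ?grad_sqr_ge0 ?(ltW C2)//=.
  by rewrite ler_wpM2l ?(ltW C2)// grad_sqr_bound.
- move=> t; have := @grad_sqr_superlevel (t / (4 * C ^+ 2)); congr open.
  by apply/seteqP; split=> x [ux h]; split=> //; move: h; rewrite ltr_pdivrMr// mulrC.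
under eq_integral do rewrite EFinM.
rewrite ge0_integralZl_EFin//.
- by rewrite muleA -EFinM (_ : 16 * C ^+ 2 * _ = 64 * C ^+ 4)//; ring.
- exact: chart_image_mplane.
- by move=> x _; rewrite lee_fin grad_sqr_ge0.
- by apply/measurable_EFinP; exact: grad_sqr_measurable.
exact: ltW.
Qed.

End Gradient.

(** * Boundary traces *)

Section BoundaryTrace.
Context {R : realType}.
Implicit Types (x y z : R * R) (t r l : R) (s : bool).

Lemma cvg_le_near (T : Type) (F : set_system T) (FF : ProperFilter F) (g : T -> R) l (M : R) :
  g x @[x --> F] --> l -> (\forall x \near F, g x <= M) -> l <= M.
Proof.
move=> gl gM; rewrite leNgt; apply/negP => Ml.
have near_gt := cvgr_gt _ gl _ Ml.
have [x [/= gx]] := filter_ex (filterI gM (near_gt _)).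
by rewrite ltNge gx.
Qed.

Lemma closure_usq x : cusq x -> closure (@usq R) x.
Proof.
case: x => a b [/= ax bx] B [[U V] [/= Ua Vb] UV].
have [c [c1 Uc]] := closure_unit ax Ua; have [d [d1 Vd]] := closure_unit bx Vb.
by exists (c, d); split; [split|apply: UV].
Qed.

Lemma usq_cusq x : usq x -> cusq x.
Proof. by case=> /= x1 x2; split; [move: x1|move: x2]; rewrite /= !in_itv/= => /andP[? ?]; rewrite !ltW. Qed.

Lemma cusq_compact : compact (@cusq R).
Proof. by apply: compact_setX; exact: segment_compact. Qed.

Lemma trace_cases (T : normedModType R) (A : set (R * R)) (f : R * R -> T) x :
  (f y @[y --> within A (nbhs x)] --> trace A f x) \/ trace A f x = point.
Proof.
have [cf|ncf] := pselect (cvg (f y @[y --> within A (nbhs x)])); first by left.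
by right; rewrite /trace dvgP.
Qed.

Section chart.
Context (C : R) (F : R * R -> R * R) (C0 : 0 < C) (FC : chart C F).
Context (Fc : {within cusq, continuous F}).

Lemma chart_cvg_closed x : cusq x -> F z @[z --> within cusq (nbhs x)] --> F x.
Proof. by have /subspace_continuousP := Fc; apply. Qed.

Lemma chart_cvg_boundary x : cusq x -> F z @[z --> within usq (nbhs x)] --> F x.
Proof.
move=> cx P FP; have h := chart_cvg_closed cx FP.
have : nbhs x [set z | usq z -> P (F z)]; last by [].
have h' : nbhs x [set z | cusq z -> P (F z)] by exact: h.
by apply: filterS h' => z Pz /usq_cusq; exact: Pz.
Qed.

Lemma closure_chart_image x : cusq x -> closure (F @` usq) (F x).
Proof.
move=> cx B FB; have [z [uz Bz]] := closure_usq cx (chart_cvg_closed cx FB).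
by exists (F z); split; [exists z|apply/Bz/usq_cusq].
Qed.

(** Excludes that the boundary of the patch touches itself at F x, where the trace would mix the
    limits at several points of the square. *)
Definition unique_preimage x := forall z, cusq z -> F z = F x -> z = x.

(* By compactness of the closed square, points of the image near F x come only from
   points near x. *)
Lemma near_preimage x (P : set (R * R)) : cusq x -> unique_preimage x ->
  (\forall z \near within usq (nbhs x), P z) ->
  \forall y \near within (F @` usq) (nbhs (F x)), exists z, [/\ usq z, F z = y & P z].
Proof.
move=> cx ux nP.
have [r r0 rP] : exists2 r, 0 < r & forall z, `|z - x| < r -> usq z -> P z.
  move: nP; rewrite near_withinE => /nbhs_normP[r /= r0 rP].
  by exists r => // z zx; apply: rP; rewrite /= distrC.
pose S := cusq `\` [set z | `|z - x| < r].
have cS : compact S.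
  apply: (subclosed_compact _ cusq_compact); last by move=> z [].
  apply: closedI; first exact: (compact_closed (@norm_hausdorff _ _) cusq_compact).
  by apply: open_closedC; exact: open_dist_lt.
have cFS : closed (F @` S).
  apply: compact_closed; first exact: norm_hausdorff.
  by apply: continuous_compact => //; apply: continuous_subspaceW Fc => z [].
have nS : ~ (F @` S) (F x).
  by move=> [z [cz /= zr] /(ux z cz) zx]; apply: zr; rewrite zx subrr normr0.
rewrite near_withinE; have : \forall y \near F x, (~` (F @` S)) y.
  by apply: open_nbhs_nbhs; split => //; exact: closed_openC.
apply: filterS => y nyS [z uz zy]; exists z; split=> //; apply: rP => //.
apply: contrapT => nz; apply: nyS; exists z => //; split => //.
exact: usq_cusq.
Qed.

Lemma trace_cvg x (T : normedModType R) (u : R * R -> T) (l : T) :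
  cusq x -> unique_preimage x ->
  u (F z) @[z --> within usq (nbhs x)] --> l -> 
  u y @[y --> within (F @` usq) (nbhs (F x))] --> l.
Proof.
move=> cx ux ul P /ul /= nP.
by apply: filterS (near_preimage cx ux nP) => y [z [_ <-]].
Qed.

Lemma traceE x (T : normedModType R) (u : R * R -> T) (l : T) :
  cusq x -> unique_preimage x ->
  u (F z) @[z --> within usq (nbhs x)] --> l -> trace (F @` usq) u (F x) = l.
Proof.
move=> cx ux ul; apply: cvg_lim; first exact: norm_hausdorff.
  by apply: within_nbhs_proper; exact: closure_chart_image.
exact: trace_cvg.
Qed.

(* If the limit of the gradient did not exist, its trace would be the default
   value 0 and the bound would still hold. *)
Lemma trace_grad_le x (v : R * R -> R) (M : R) : cusq x -> unique_preimage x -> 0 <= M ->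
  (forall e, 0 < e -> \forall z \near within usq (nbhs x), grad_sqr v (F z) <= M + e) ->
  dot (trace (F @` usq) (grad v) (F x)) (trace (F @` usq) (grad v) (F x)) <= M.
Proof.
move=> cx ux M0 vM.
have [cv|->] := trace_cases (F @` usq) (grad v) (F x); last by rewrite /dot/= !mul0r addr0.
have GF : ProperFilter (within (F @` usq) (nbhs (F x))).
  by apply: within_nbhs_proper; exact: closure_chart_image.
move: (trace _ _ _) cv => l cv; apply/ler_addgt0Pr => e e0.
have c0 : (grad v y).1 @[y --> within (F @` usq) (nbhs (F x))] --> l.1.
  by apply: cvg_comp cv _; exact: cvg_fst.
have c1 : (grad v y).2 @[y --> within (F @` usq) (nbhs (F x))] --> l.2.
  by apply: cvg_comp cv _; exact: cvg_snd.
apply: (cvg_le_near GF (cvgD (cvgM c0 c0) (cvgM c1 c1))).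
by apply: filterS (near_preimage cx ux (vM e e0)) => y [z [_ <-]].
Qed.

End chart.
End BoundaryTrace.

(** * Arc length of the edges *)

Section Arc.
Context {R : realType}.
Implicit Types (x y z : R * R) (t r : R) (m : 'I_2).
Context (C : R) (F : R * R -> R * R) (C0 : 0 < C) (FC : chart C F).
Context (Fc : {within cusq, continuous F}).
Context (e : bool * bool) (s : R) (se : s = e.2%:R).

Let i : 'I_2 := if e.1 then 0 else 1.
(** [P r t] has tangential coordinate t and normal coordinate r relative to the edge [e]; [i] is the
    tangential direction and r tends to [s] from inside the square. *)
Let P r t : R * R := if e.1 then (t, r) else (r, t).
Let U : set R := [set r : R | 0 < r < 1].
Local Notation G := (within U (nbhs (s : R))).

Let s01 : 0 <= s <= 1.
Proof. by rewrite se; case: e.2; rewrite lexx ler01. Qed.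

Let G_proper : ProperFilter G.
Proof.
apply: within_nbhs_proper; rewrite (_ : U = `]0, 1[%classic); first exact: closure_unit s01.
by rewrite predeqE => r; rewrite /= in_itv.
Qed.

Let P_usq r t : 0 < r < 1 -> 0 < t < 1 -> usq (P r t).
Proof. by move=> /andP[? ?] /andP[? ?]; rewrite /P; case: e.1; apply/usqE. Qed.

Let P_cusq t : 0 <= t <= 1 -> cusq (P s t).
Proof.
by move=> t01; rewrite /P; case: e.1; split; rewrite /= in_itv.
Qed.

Let near_G : \forall r \near G, 0 < r < 1.
Proof. by rewrite near_withinE; apply: nearW. Qed.

Let slice_P r t u : slice i (P r t) u = P r u.
Proof. by rewrite /slice /i /P; case: e.1. Qed.

Lemma edge_parE t : edge_par e t = P s t.
Proof. by rewrite /edge_par /P se; case: e => -[]. Qed.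

Let cvg_P t : 0 <= t <= 1 -> P r t @[r --> G] --> within cusq (nbhs (P s t)).
Proof.
move=> t01; have c : P r t @[r --> s] --> P s t.
  have c1 : (r : R) @[r --> s] --> s by exact: cvg_id.
  have c2 : (fun=> t) @ s --> t by exact: cvg_cst.
  by rewrite /P; case: e.1; [exact: (cvg_pair c2 c1)|exact: (cvg_pair c1 c2)].
move=> A /c => h.
have h' : \forall r \near G, cusq (P r t) -> A (P r t) by exact: (@cvg_within _ (nbhs s) _ _ _ h).
apply: filterS2 near_G h' => r /andP[r0 r1]; apply.
by rewrite /P; case: e.1; split; rewrite /= in_itv//= !ltW.
Qed.

Let cvg_FP m t : 0 <= t <= 1 -> coord m (F (P r t)) @[r --> G] --> coord m (F (P s t)).
Proof.
move=> t01; have cF : F (P r t) @[r --> G] --> F (P s t).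
  exact: cvg_comp (cvg_P t01) (chart_cvg_closed Fc (P_cusq t01)).
by elim/ord2P: m; apply: cvg_comp cF _; [exact: cvg_fst|exact: cvg_snd].
Qed.

(* Derivatives of F are only controlled in the open square, so the speed of an edge
   is obtained as the limit of derivatives along parallel segments inside. *)
Definition arc_speed m t : R := lim (pd i (coord m \o F) (P r t) @[r --> G]).

Let P_dist r r' t : P r t - P r' t = P (r - r') 0.
Proof. by rewrite /P; case: e.1; congr pair => /=; rewrite subrr. Qed.

Let P_dist_t r t t' : P r t - P r t' = P 0 (t - t').
Proof. by rewrite /P; case: e.1; congr pair => /=; rewrite subrr. Qed.

Let P_norm_l r : `|P r 0| <= `|r|.
Proof. by rewrite norm_pair_le /P; case: e.1; rewrite /= normr0 normr_ge0 lexx. Qed.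

Let P_norm_r r : `|P 0 r| <= `|r|.
Proof. by rewrite norm_pair_le /P; case: e.1; rewrite /= normr0 normr_ge0 lexx. Qed.

(** The partial derivatives are Lipschitz on the open square, so along the normal line they satisfy
    the Cauchy criterion as the edge is approached. *)
Lemma arc_speed_cvg m t : 0 < t < 1 ->
  pd i (coord m \o F) (P r t) @[r --> G] --> arc_speed m t.
Proof.
move=> t01; apply/cauchy_cvgP; first exact: fmap_proper_filter.
apply: cauchy_exP => a a0.
have d0 : 0 < a / (8 * C) by rewrite divr_gt0// mulr_gt0.
have near_s : \forall r \near G, `|s - r| < a / (8 * C).
  by apply: cvg_within; apply/nbhs_normP; exists (a / (8 * C)).
have [r0 [r001 r0s]] := @filter_ex _ _ G_proper _ (filterI near_G near_s).
exists (pd i (coord m \o F) (P r0 t)).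
apply: filterS2 near_G near_s => r r01 rs; rewrite -ball_normE /=.
rewrite (le_lt_trans (chart_pd_lip FC _ _ (P_usq r01 t01) (P_usq r001 t01)))//.
rewrite P_dist (le_lt_trans (ler_wpM2l _ (P_norm_l _))) ?mulr_ge0 ?(ltW C0)//.
have : `|r0 - r| <= `|s - r0| + `|s - r|.
  by rewrite (distrC s r0); exact: ler_distD.
have -> : a = 2 * C * (4 * (a / (8 * C))) by field; rewrite gt_eqF.
rewrite ltr_pM2l ?mulr_gt0//; move: r0s rs; lra.
Qed.

(** The mean value estimate holds on every parallel segment inside the square, uniformly in r, and
    passes to the limit on the edge. *)
Lemma arc_speed_linearization m t t' : 0 < t < 1 -> 0 < t' < 1 ->
  `|coord m (F (edge_par e t')) - coord m (F (edge_par e t)) - arc_speed m t * (t' - t)| <=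
  2 * C * `|t' - t| ^+ 2.
Proof.
move=> t01 t'01; rewrite !edge_parE.
have t01' : 0 <= t <= 1 by case/andP: t01 => ? ?; rewrite !ltW.
have t'01' : 0 <= t' <= 1 by case/andP: t'01 => ? ?; rewrite !ltW.
have cn : `|coord m (F (P r t')) - coord m (F (P r t)) -
    pd i (coord m \o F) (P r t) * (t' - t)| @[r --> G] -->
    `|coord m (F (P s t')) - coord m (F (P s t)) - arc_speed m t * (t' - t)|.
  apply: cvg_norm; exact: (cvgB (cvgB (@cvg_FP m t' t'01') (@cvg_FP m t t01'))
    (cvgM (@arc_speed_cvg m t t01) (cvg_cst (t' - t)))).
apply: (cvg_le_near G_proper cn).
apply: filterS near_G => r r01.
have [|c ctt] := @pd_mean_value R i (coord m \o F) (P r t) t t'.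
  move=> u /andP[+ +]; rewrite slice_P ge_min le_max => /orP ut /orP ut'.
  apply: (chart_derivable FC); apply: P_usq => //.
  by move: t01 t'01 => /andP[? ?] /andP[? ?]; apply/andP; split; lra.
rewrite !slice_P /= => ->; rewrite -mulrBl normrM expr2 mulrA ler_wpM2r//.
move: ctt => /andP[+ +]; rewrite ge_min le_max => /orP ct /orP ct'.
have c01 : 0 < c < 1.
  by move: t01 t'01 => /andP[? ?] /andP[? ?]; apply/andP; split; lra.
rewrite (le_trans (chart_pd_lip FC _ _ (P_usq r01 t01) (P_usq r01 c01)))//.
rewrite ler_wpM2l ?mulr_ge0 ?(ltW C0)// P_dist_t (le_trans (P_norm_r _))//.
have [tt|tt] := leP t t'.
  by rewrite !ger0_norm; lra.
by rewrite !ler0_norm; lra.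
Qed.

Lemma arc_is_derive m t : 0 < t < 1 ->
  is_derive t 1 (fun u => coord m (F (edge_par e u))) (arc_speed m t).
Proof.
move=> t01; set c := fun u => _.
suff dL : (fun h : R => h^-1 *: ((c \o shift t) (h *: (1 : R)) - c t)) @ 0^' --> arc_speed m t.
  by apply: DeriveDef; [apply/cvg_ex; exists (arc_speed m t)|exact: cvg_lim].
apply/cvgrPdist_le => a a0.
have near_t : \forall h \near (0 : R)^', 0 < h + t < 1.
  case/andP: t01 => t0 t1; apply: nbhs_dnbhs; apply/nbhs_normP.
  exists (Num.min t (1 - t)) => /=; first by rewrite lt_min t0 subr_gt0.
  move=> h /=; rewrite sub0r normrN lt_min => /andP[h1 h2].
  move: (ler_norm h) (ler_norm (- h)); rewrite normrN => h3 h4.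
  by apply/andP; split; lra.
have near_0 : \forall h \near (0 : R)^', `|h| <= a / (2 * C).
  apply: nbhs_dnbhs; apply/nbhs_normP.
  exists (a / (2 * C)) => /=; first by rewrite divr_gt0// mulr_gt0.
  by move=> h /=; rewrite sub0r normrN => /ltW.
near=> h.
have h0 : h != 0 by near: h; exact: nbhs_dnbhs_neq.
have ht : 0 < h + t < 1 by near: h.
have hn0 : 0 < `|h| by rewrite normr_gt0.
have := arc_speed_linearization m t01 ht; rewrite addrK => E.
rewrite -(ler_pM2l hn0) -normrM.
rewrite [h%:A]mulr1 -normrN /= mulrBr /GRing.scale/= mulrA divff// mul1r opprB.
rewrite (mulrC h) /c (le_trans E)// expr2 mulrCA ler_wpM2l//.
rewrite -ler_pdivlMl ?mulr_gt0// mulrC.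
by near: h.
Unshelve. all: end_near. Qed.

Lemma arc_speed_le m t : 0 < t < 1 -> `|arc_speed m t| <= C.
Proof.
move=> t01.
have cn : `|pd i (coord m \o F) (P r t)| @[r --> G] --> `|arc_speed m t|.
  apply: cvg_norm; exact: (@arc_speed_cvg m t t01).
apply: (cvg_le_near G_proper cn).
by apply: filterS near_G => r r01; apply: (chart_pd_le FC); exact: P_usq.
Qed.

Lemma arc_speed_lip m t t' : 0 < t < 1 -> 0 < t' < 1 ->
  `|arc_speed m t' - arc_speed m t| <= 2 * C * `|t' - t|.
Proof.
move=> t01 t'01.
have cn : `|pd i (coord m \o F) (P r t') - pd i (coord m \o F) (P r t)| @[r --> G] -->
    `|arc_speed m t' - arc_speed m t|.
  apply: cvg_norm; exact: (cvgB (@arc_speed_cvg m t' t'01) (@arc_speed_cvg m t t01)).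
apply: (cvg_le_near G_proper cn).
apply: filterS near_G => r r01.
rewrite (le_trans (chart_pd_lip FC _ _ (P_usq r01 t01) (P_usq r01 t'01)))//.
by rewrite ler_wpM2l ?mulr_ge0 ?(ltW C0)// P_dist_t P_norm_r.
Qed.

Lemma arc_speed_continuous m t : 0 < t < 1 -> {for t, continuous (arc_speed m)}.
Proof.
move=> /andP[t0 t1]; apply/cvgrPdist_le => a a0; near=> u.
have u01 : 0 < u < 1.
  by apply/andP; split; near: u; [exact: lt_nbhsr|exact: lt_nbhsl].
rewrite (le_trans (arc_speed_lip m u01 _)) ?t0//.
have : `|t - u| < a / (2 * C).
  by near: u; apply/nbhs_normP; exists (a / (2 * C)) => //=; rewrite divr_gt0// mulr_gt0.
by rewrite ltr_pdivlMr ?mulr_gt0// mulrC => /ltW.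
Unshelve. all: end_near. Qed.

Definition arc_factor t : R :=
  enorm (derive1 (fst \o (F \o edge_par e)) t, derive1 (snd \o (F \o edge_par e)) t).

Lemma arc_factorE t : 0 < t < 1 ->
  arc_factor t = Num.sqrt (arc_speed 0 t * arc_speed 0 t + arc_speed 1 t * arc_speed 1 t).
Proof.
move=> t01; rewrite /arc_factor /enorm /dot /=.
have [_ <-] := arc_is_derive 0 t01; have [_ <-] := arc_is_derive 1 t01.
by rewrite !derive1E.
Qed.

Lemma arc_factor_ge0 t : 0 <= arc_factor t. Proof. exact: sqrtr_ge0. Qed.

Lemma arc_factor_le t : 0 < t < 1 -> arc_factor t <= 2 * C.
Proof.
move=> t01; rewrite arc_factorE// -[leRHS]ger0_norm ?mulr_ge0 ?(ltW C0)// -sqrtr_sqr.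
apply: ler_wsqrtr; rewrite -!expr2.
have sq m : arc_speed m t ^+ 2 <= C ^+ 2.
  by rewrite -[_ ^+ 2]real_normK ?num_real// ler_sqr ?nnegrE ?arc_speed_le// ltW.
rewrite (le_trans (lerD (sq 0) (sq 1)))// -mulr2n -[leLHS]mulr_natl exprMn.
by rewrite ler_wpM2r ?sqr_ge0// -natrX ler_nat.
Qed.

Lemma measurable_arc_factor : measurable_fun (`]0, 1[ : set (measurableTypeR R)) arc_factor.
Proof.
apply: open_continuous_measurable_fun => // t /set_mem; rewrite /= in_itv/= => t01.
have c : (fun u => Num.sqrt (arc_speed 0 u * arc_speed 0 u + arc_speed 1 u * arc_speed 1 u)) @ t -->
    arc_factor t.
  rewrite arc_factorE//; apply: continuous_comp; last exact: sqrt_continuous.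
  by apply: cvgD; apply: cvgM; exact: arc_speed_continuous.
case/andP: t01 => t0 t1.
apply: cvg_trans c; apply: near_eq_cvg; near=> u; rewrite arc_factorE//.
by apply/andP; split; near: u; [exact: lt_nbhsr|exact: lt_nbhsl].
Unshelve. all: end_near. Qed.

End Arc.

(** * Reflection and integral bounds *)

Section Reflection.
Context {R : realType}.
Implicit Types (r t : R) (b : bool).
Local Notation leb := (@lebesgue_measure R).
Local Notation mR := (measurableTypeR R).

(** Unifies the two orientations allowed in [conforming]: the parameters of the two sides agree up
    to [refl b]. *)
Definition refl b t : R := if b then 1 - t else t.

Lemma refl_unit b t : 0 < t < 1 -> 0 < refl b t < 1.
Proof. by rewrite /refl; case: b => // /andP[? ?]; rewrite subr_gt0 gtrBl; apply/andP. Qed.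

Lemma reflK b : involutive (refl b).
Proof. by move=> t; rewrite /refl; case: b => //; rewrite subKr. Qed.

Lemma measurable_refl b (D : set mR) : measurable_fun D (refl b : mR -> mR).
Proof. by rewrite /refl; case: b => //; apply: measurable_funB. Qed.

(** By uniqueness of Lebesgue measure, half-open intervals suffice; the reflection exchanges the
    open and the closed end but keeps the length. *)
Lemma lebesgue_refl b (A : set mR) : measurable A -> leb (refl b @^-1` A) = leb A.
Proof.
move=> mA; have mf : measurable_fun [set: mR] (refl b : mR -> mR) by exact: measurable_refl.
pose nu := (pushforward leb (refl b : mR -> mR) : {measure set mR -> \bar R}).
suff /(_ A mA) -> : forall A, measurable A -> leb A = nu mf A by [].
apply: lebesgue_measure_unique => _ [[c d] _ <-].
rewrite /nu /= /pushforward /refl; case: b mf @nu => // _ _.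
have -> : (fun t : R => 1 - t) @^-1` [set` `]c, d]] = [set` `[1 - d, 1 - c[].
  by apply/seteqP; split=> t /=; rewrite !in_itv/= => /andP[? ?]; apply/andP; split; lra.
rewrite !lebesgue_measure_itv /= !lte_fin ltrD2l ltrN2.
by case: ifP => // _; rewrite -!EFinB; congr EFin; lra.
Qed.

Lemma integral_refl b (f : R -> \bar R) :
  measurable_fun (`]0, 1[ : set mR) f -> (forall t, 0 <= f t)%E ->
  (\int[leb]_(t in `]0%R, 1%R[) f (refl b t) = \int[leb]_(t in `]0%R, 1%R[) f t)%E.
Proof.
move=> mf f0.
have E : refl b @^-1` `]0, 1[%classic = `]0, 1[%classic.
  apply/seteqP; split=> t /=; rewrite !in_itv/=; last exact: refl_unit.
  by move/(refl_unit b); rewrite reflK.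
transitivity (\int[leb]_(t in refl b @^-1` `]0%R, 1%R[) (f \o refl b) t)%E; first by rewrite E.
rewrite -(ge0_integral_pushforward (@measurable_refl b setT))//.
by apply: (eq_measure_integral leb) => [|? A mA _]; [exact: measurable_refl|exact: lebesgue_refl].
Qed.

(* No measurability of f is needed: the integral of a nonnegative function is a
   supremum over simple functions below it. *)
Lemma Rintegral_norm_le d (T : measurableType d) (mu : {measure set T -> \bar R})
    (D : set T) (f g : T -> R) (c : R) :
  (forall x, D x -> `|f x| <= g x) -> (\int[mu]_(x in D) (g x)%:E <= c%:E)%E ->
  `|\int[mu]_(x in D) f x| <= c.
Proof.
move=> fg gc; have g0 x : D x -> 0 <= g x by move=> Dx; exact: le_trans (normr_ge0 _) (fg x Dx).
rewrite /Rintegral integralE.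
(* Positive and negative part each have an integral in [0, c], so their difference lies in
   [-c, c]. *)
have part (h : T -> \bar R) : (forall x, D x -> (0 <= h x)%E) -> (forall x, D x -> (h x <= (g x)%:E)%E) ->
    exists2 r : R, (\int[mu]_(x in D) h x = r%:E)%E & 0 <= r <= c.
  move=> h0 hg; have I0 := @integral_ge0 _ _ _ mu _ _ h0.
  have Ic : (\int[mu]_(x in D) h x <= c%:E)%E by apply: le_trans gc; exact: ge0_le_integral_all.
  move: I0 Ic; case: (\int[mu]_(x in D) h x)%E => [r| |]; rewrite ?lee_fin ?leye_eq//.
  by move=> r0 rc; exists r; rewrite ?r0.
have [r1 -> /andP[r10 r1c]] : exists2 r : R,
    (\int[mu]_(x in D) ((fun x => (f x)%:E)^\+ x)%E = r%:E)%E & 0 <= r <= c.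
  apply: part => x Dx; first exact: funepos_ge0.
  by rewrite funeposE/= -EFin_max lee_fin ge_max g0// (le_trans (ler_norm _) (fg x Dx)).
have [r2 -> /andP[r20 r2c]] : exists2 r : R,
    (\int[mu]_(x in D) ((fun x => (f x)%:E)^\- x)%E = r%:E)%E & 0 <= r <= c.
  apply: part => x Dx; first exact: funeneg_ge0.
  by rewrite funenegE/= -EFin_max lee_fin ge_max g0// andbT (le_trans _ (fg x Dx))// -normrN ler_norm.
by rewrite -EFinB /= ler_norml; apply/andP; split; lra.
Qed.

End Reflection.

(** * Traces on one patch *)

Section EdgeData.
Context {R : realType}.
Implicit Types (x y z : R * R) (r t : R) (s b : bool) (e : bool * bool).
Local Notation leb := (@lebesgue_measure R).
Local Notation RR := (measurableTypeR R * measurableTypeR R)%type.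
Local Notation U01 := (`]0, 1[%classic : set (measurableTypeR R)).

Lemma edge_par_cusq e t : 0 < t < 1 -> cusq (edge_par e t).
Proof.
move=> /andP[t0 t1]; have s01 s : 0 <= (s%:R : R) <= 1 by case: s; rewrite lexx ler01.
by rewrite /edge_par; case: e.1; split; rewrite /= in_itv//= !ltW.
Qed.

Section spline_tensor.
Context (p : nat) (Z1 Z2 : grid R) (p2 : (2 <= p)%N) (m : nat) (a b : 'I_m -> R -> R).
Context (sa : forall i, spline p Z1 (a i)) (sb : forall i, spline p Z2 (b i)).

Let measurable_ext Z (v : R -> R) : spline p Z v ->
  measurable_fun U01 (ext v) /\ measurable_fun U01 (ext (derive1 v)).
Proof.
move=> sv; have [mv mdv] := measurable_spline p2 sv.
split.
- apply: eq_measurable_fun mv => t /set_mem; rewrite /= in_itv/= => t01.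
  by rewrite ext_id//; exact: spline_continuous sv _.
- apply: eq_measurable_fun mdv => t /set_mem; rewrite /= in_itv/= => t01.
  by rewrite ext_id//; exact: spline_derive_continuous sv _.
Qed.

Let measurable_edge (f g : 'I_m -> R -> R) e :
  (forall i, measurable_fun U01 (ext (f i))) -> (forall i, measurable_fun U01 (ext (g i))) ->
  measurable_fun U01 (fun t => \sum_i ext (f i) (edge_par e t).1 * ext (g i) (edge_par e t).2).
Proof.
move=> mf mg; apply: measurable_sum => i; rewrite /edge_par; case: e.1 => /=.
  exact: (measurable_funM (mf i) (measurable_cst (ext (g i) e.2%:R))).
exact: (measurable_funM (measurable_cst (ext (f i) e.2%:R)) (mg i)).
Qed.

Lemma measurable_wext e : measurable_fun U01 (fun t => wext a b (edge_par e t)).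
Proof. by apply: measurable_edge => i; [case: (measurable_ext (sa i))|case: (measurable_ext (sb i))]. Qed.

Lemma measurable_wext0 e : measurable_fun U01 (fun t => wext0 a b (edge_par e t)).
Proof. by apply: measurable_edge => i; [case: (measurable_ext (sa i))|case: (measurable_ext (sb i))]. Qed.

Lemma measurable_wext1 e : measurable_fun U01 (fun t => wext1 a b (edge_par e t)).
Proof. by apply: measurable_edge => i; [case: (measurable_ext (sa i))|case: (measurable_ext (sb i))]. Qed.

End spline_tensor.

Lemma measurable_comp_refl b (f : R -> R) :
  measurable_fun U01 f -> measurable_fun U01 (f \o refl b).
Proof.
move=> mf; apply: (measurable_comp _ _ mf) => //; last exact: measurable_refl.
by move=> _ [t + <-]; rewrite /= !in_itv/=; exact: refl_unit.
Qed.

Section patch.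
Context (C : R) (F : R * R -> R * R) (C0 : 0 < C) (FC : chart C F).
Context (Fc : {within cusq, continuous F}).
Context (p : nat) (Z1 Z2 : grid R) (p2 : (2 <= p)%N) (v : R * R -> R).
Context (vE : tensor_spline p Z1 Z2 (v \o F)).

Lemma patch_derivable i x : usq x -> derivable (v \o F) x (bvec i).
Proof.
have [m [a [b [sab wE]]]] := vE => ux.
have [d0 d1 _ _] := tensor_pd p2 (fun i => (sab i).1) (fun i => (sab i).2) wE ux.
by elim/ord2P: i.
Qed.

Lemma patch_pd_continuous i x : usq x -> {for x, continuous (pd i (v \o F))}.
Proof.
have [m [a [b [sab wE]]]] := vE.
move=> ux; exact: (tensor_pd_continuous p2 (fun i => (sab i).1) (fun i => (sab i).2) wE ux).
Qed.

Lemma patch_bounded : exists B, forall x, usq x -> `|v (F x)| <= B /\ forall i, `|pd i (v \o F) x| <= B.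
Proof.
have [m [a [b [sab wE]]]] := vE.
exact: (tensor_bounded p2 (fun i => (sab i).1) (fun i => (sab i).2) wE).
Qed.

Lemma patch_integrable : leb2.-integrable (F @` usq) (EFin \o grad_sqr v).
Proof.
have [B vB] := patch_bounded.
by apply: (grad_sqr_integrable C0 FC patch_derivable patch_pd_continuous) => x /vB[_]; exact.
Qed.

Definition patch_energy : R := \int[leb2]_(x in F @` usq) grad_sqr v x.

Lemma patch_energyE : (\int[leb2]_(x in F @` usq) (grad_sqr v x)%:E)%E = patch_energy%:E.
Proof. by rewrite fineK//; apply: (integrable_fin_num _ patch_integrable); exact: chart_image_mplane FC. Qed.

(** All that is used of one patch along an edge, in the edge parameter of the neighbour if b holds:
    [U] is the trace, bounded so that its integrals are finite, and [W] dominates the squared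
    gradient trace. 256C^6 is 4C^2 on the edge times 64C^4 on the square. *)
Lemma edge_data e b (h : R) : 0 < h -> h <= grid_min Z1 -> h <= grid_min Z2 ->
  exists (U W : R -> R) (B : R),
    [/\ measurable_fun U01 U, measurable_fun U01 W,
       (forall t, 0 < t < 1 -> `|U t| <= B) /\ (forall t, 0 <= W t),
       (\int[leb]_(t in `]0%R, 1%R[) (W t)%:E <=
          (256 * C ^+ 6 * (p.+1%:R ^+ 2 / h) * patch_energy)%:E)%E &
       forall t, 0 < t < 1 -> unique_preimage F (edge_par e (refl b t)) ->
         trace (F @` usq) v (F (edge_par e (refl b t))) = U t /\
         dot (trace (F @` usq) (grad v) (F (edge_par e (refl b t))))
             (trace (F @` usq) (grad v) (F (edge_par e (refl b t)))) <= W t].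
Proof.
move=> h0 h1 h2; have [m [a [c [sac wE]]]] := vE.
have sa i := (sac i).1; have sc i := (sac i).2.
have [B vB] := patch_bounded.
pose V t := wext0 a c (edge_par e t) ^+ 2 + wext1 a c (edge_par e t) ^+ 2.
have V0 t : 0 <= V t by rewrite addr_ge0 ?sqr_ge0.
have mV : measurable_fun U01 V.
  by apply: measurable_funD; apply: measurable_funX; [exact: (measurable_wext0 p2 sa sc)|exact: (measurable_wext1 p2 sa sc)].
have C2 : 0 <= 4 * C ^+ 2 by rewrite mulr_ge0// sqr_ge0.
have cvg_e t : 0 < t < 1 -> _ := fun t01 => tensor_cvg_ext p2 sa sc wE (edge_par_cusq e t01).
exists (fun t => wext a c (edge_par e (refl b t))), (fun t => 4 * C ^+ 2 * V (refl b t)), B; split.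
- exact: measurable_comp_refl (measurable_wext p2 sa sc e).
- exact: (measurable_funM (measurable_cst (4 * C ^+ 2)) (measurable_comp_refl b mV)).
- split=> [t /(refl_unit b) t01|t]; last exact: mulr_ge0.
  have [cw _ _] := cvg_e _ t01.
  have cn : `|(v \o F) x| @[x --> within usq (nbhs (edge_par e (refl b t)))] -->
      `|wext a c (edge_par e (refl b t))| by exact: cvg_norm.
  apply: (cvg_le_near _ cn); last first.
    by rewrite near_withinE; apply: nearW => x /vB[].
  by apply: within_nbhs_proper; apply: closure_usq; exact: edge_par_cusq.
- have E : (\int[leb]_(t in `]0%R, 1%R[) (V (refl b t))%:E = \int[leb]_(t in `]0%R, 1%R[) (V t)%:E)%E.
    have mV' : measurable_fun U01 (EFin \o V) by exact/measurable_EFinP.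
    have V0' t : (0 <= (EFin \o V) t)%E by rewrite /= lee_fin.
    exact: (integral_refl b mV' V0').
  rewrite (_ : \int[leb]_(t in _) _ = (4 * C ^+ 2)%:E * \int[leb]_(t in `]0%R, 1%R[) (V t)%:E)%E.
    apply: (@le_trans _ _ ((4 * C ^+ 2)%:E * ((p.+1%:R ^+ 2 / h)%:E *
        ((64 * C ^+ 4)%:E * patch_energy%:E)))%E).
      apply: lee_wpmul2l; first by rewrite lee_fin.
      apply: (le_trans (edge_integral p2 sa sc wE e h0 h1 h2)).
      have K0 : 0 <= p.+1%:R ^+ 2 / h by apply: divr_ge0; [exact: exprn_ge0|exact: ltW].
      apply: lee_wpmul2l; first by rewrite lee_fin.
      rewrite -patch_energyE; apply: (pd_sqr_integral_le C0 FC patch_derivable patch_pd_continuous (B := B)).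
      by move=> x /vB[].
    by rewrite -!EFinM lee_fin; rewrite le_eqVlt; apply/orP; left; apply/eqP; ring.
  under eq_integral do rewrite EFinM.
  rewrite ge0_integralZl_EFin; first last.
  + exact: C2.
  + by apply/measurable_EFinP; exact: measurable_comp_refl.
  + by move=> t _; rewrite lee_fin.
  + exact: measurable_itv.
  + by rewrite E.
- move=> t /(refl_unit b) t01 ut; have [cw c0 c1] := cvg_e _ t01.
  have ce := edge_par_cusq e t01.
  split; first exact: (traceE Fc ce ut cw).
  apply: (trace_grad_le Fc ce ut) => [|d d0]; first exact: mulr_ge0.
  have cs : 4 * C ^+ 2 * pd_sqr (v \o F) x @[x --> within usq (nbhs (edge_par e (refl b t)))] -->
      4 * C ^+ 2 * V (refl b t).
    by apply: cvgMr; apply: cvgD; exact: cvgM.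
  have near_le : \forall z \near within usq (nbhs (edge_par e (refl b t))),
      4 * C ^+ 2 * pd_sqr (v \o F) z < 4 * C ^+ 2 * V (refl b t) + d.
    by apply: (cvgr_lt _ cs); rewrite ltrDl.
  have nu : \forall z \near within usq (nbhs (edge_par e (refl b t))), usq z by exact: near_withinT.
  apply: filterS2 nu near_le => z uz /ltW; apply: le_trans.
  exact: (grad_sqr_le C0 FC patch_derivable patch_pd_continuous).
Qed.

End patch.
End EdgeData.

(** * Neighbouring patches *)

Section Interfaces.
Context {R : realType} (M : multipatch R) (C : R) (C0 : 0 < C).
Context (GM : geometry M) (BM : geo_bounds M C).
Implicit Types (x y z : R * R) (t : R) (k l : 'I_(npatch M)) (b : bool) (e : bool * bool).

Lemma geo_chart k : chart C (geo M k).
Proof.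
by split=> *; [exact: (geo_diff1 BM)|exact: (geo_diff2 BM)|exact: (geo_bound1 BM)|
  exact: (geo_bound2 BM)|exact: (geo_unit BM)|exact: (geo_bound_inv BM)|exact: (geo_inj GM)].
Qed.

Lemma edge_par_inj e t t' : edge_par e t = edge_par e t' -> t = t'.
Proof. by rewrite /edge_par; case: e.1 => -[]. Qed.

(** Both sides are described by the parameter of k. Uniqueness on the side of l is part of
    [geo_inv]. On the side of k, [interface_cond] puts every preimage on the edge, where the
    identification with the edge of l determines its parameter. *)
Lemma interface_param k l e : (k < l)%N -> iedge M k l = Some e ->
  exists e' b, forall t, 0 < t < 1 ->
    [/\ geo M k (edge_par e t) = geo M l (edge_par e' (refl b t)),
        unique_preimage (geo M k) (edge_par e t) &
        unique_preimage (geo M l) (edge_par e' (refl b t))].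
Proof.
move=> kl ekl; have kNl : k != l by apply: contraTneq kl => ->; rewrite ltnn.
have := patch_interface GM kNl; have := patch_conforming GM kl.
rewrite /interface_cond ekl; case elk : (iedge M l k) => [e'|//] conf [_ _ Ek _].
have [b hb] : exists b, forall t, 0 < t < 1 ->
    geo_inv l (geo M k (edge_par e (refl b t))) (edge_par e' t).
  by have [h|h] := conf _ _ elk ekl; [exists false|exists true] => t t01; apply: h; rewrite in_itv.
exists e', b => t t01.
have inv s : 0 < s < 1 -> geo_inv l (geo M k (edge_par e s)) (edge_par e' (refl b s)).
  by move=> s01; have := hb _ (refl_unit b s01); rewrite reflK.
have invE s : 0 < s < 1 -> geo M l (edge_par e' (refl b s)) = geo M k (edge_par e s).
  move=> /inv h; suff [] : (cusq `&` geo M l @^-1` [set geo M k (edge_par e s)]) (edge_par e' (refl b s)) by [].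
  by rewrite h.
have uniq_l s : 0 < s < 1 -> unique_preimage (geo M l) (edge_par e' (refl b s)).
  move=> s01 z cz zE; suff : [set edge_par e' (refl b s)] z by [].
  by rewrite -(inv s s01); split=> //=; rewrite zE invE.
split; [by rewrite invE| |exact: uniq_l].
move=> z cz zE; have : edge e z.
  rewrite -Ek; split => //=; rewrite zE; exists (edge_par e t) => //.
  by exists t => //; rewrite /= in_itv.
move=> [s + sz]; rewrite /= in_itv/= => s01; move: zE; rewrite -sz => sE; congr edge_par.
have := uniq_l t t01 (edge_par e' (refl b s)) (edge_par_cusq e' (refl_unit b s01)).
by rewrite !invE// sE => /(_ erefl)/edge_par_inj/(can_inj (reflK b)).
Qed.

Lemma chart_closed_bounded (F : R * R -> R * R) z : chart C F -> {within cusq, continuous F} ->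
  cusq z -> F @` usq `<=` [set y | `|y - F z| <= 2 * C].
Proof.
move=> FC Fc cz _ [x ux <-] /=.
have cF : F x - F y @[y --> within usq (nbhs z)] --> F x - F z.
  exact: cvgB (cvg_cst _) (chart_cvg_boundary Fc cz).
apply: (cvg_le_near _ (cvg_norm cF)); first by apply: within_nbhs_proper; exact: closure_usq.
rewrite near_withinE; apply: nearW => y uy.
by apply/ltW/(chart_image_bounded C0 FC uy); exists x.
Qed.

Definition neighbours k : {set 'I_(npatch M)} :=
  [set l | ((k, l) \in interfaces M) || ((l, k) \in interfaces M)]%SET.

Lemma neighbours_touch k l : l \in neighbours k ->
  exists x y, [/\ cusq x, cusq y & geo M k x = geo M l y].
Proof.
have half : 0 < (2^-1 : R) < 1 by apply/andP; split; lra.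
have touch k' l' : (k', l') \in interfaces M ->
    exists x y, [/\ cusq x, cusq y & geo M k' x = geo M l' y].
  rewrite inE /= => /andP[kl]; case e : (iedge M k' l') => [c|//] _.
  have [e' [b /(_ _ half)[E _ _]]] := interface_param kl e.
  exists (edge_par c 2^-1), (edge_par e' (refl b 2^-1)).
  by split=> //; apply: edge_par_cusq => //; exact: refl_unit.
rewrite inE => /orP[/touch //|/touch[x [y [cx cy E]]]].
by exists y, x.
Qed.

(* Every neighbour lies within 5C of the midpoint of patch k and has area at least
   1/(16C^2), and the patches are disjoint. *)
Lemma neighbours_card k : #|neighbours k|%:R <= 1600 * C ^+ 4.
Proof.
have uc : @usq R (2^-1, 2^-1) by apply/usqE; split=> /=; lra.
set c := geo M k (2^-1, 2^-1); set A := neighbours k.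
(* Two patches with a common boundary point contribute 2C each; 5C instead of 4C makes the ball
   open. *)
have sub l : l \in A -> subdom l `<=` [set y | `|y - c| < 5 * C].
  move=> /neighbours_touch[x [y [cx cy E]]] z lz /=.
  have h1 := chart_closed_bounded (geo_chart l) (@geo_cont _ _ GM l) cy lz.
  have h2 : `|c - geo M k x| <= 2 * C.
    by apply: (chart_closed_bounded (geo_chart k) (@geo_cont _ _ GM k) cx); exists (2^-1, 2^-1).
  have : `|z - c| <= `|z - geo M l y| + `|c - geo M k x|.
    by rewrite (distrC c) E ler_distD.
  by move: h1 h2; rewrite /=; move: C0; lra.
have msub l : mplane (subdom l) by exact: chart_image_mplane (geo_chart l).
have low l : ((16 * C ^+ 2)^-1%:E <= leb2 (subdom l))%E.
  have := chart_measure C0 (geo_chart l) (@open_usq R) (fun x h => h).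
  rewrite leb2_usq -lee_pdivrMl ?mule1//.
  by rewrite mulr_gt0// exprn_gt0.
have : ((#|A|%:R * (16 * C ^+ 2)^-1)%:E <= ((2 * (5 * C)) ^+ 2)%:E)%E.
  rewrite -(leb2_ball c) ?mulr_ge0 ?(ltW C0)//.
  apply: (@le_trans _ _ (leb2 (\bigcup_(l in [set` A]) subdom l))); last first.
    apply: le_measure; rewrite ?inE.
    - by apply: fin_bigcup_measurable => // l _; exact: msub.
    - by apply: open_mplane; exact: open_dist_lt.
    - by move=> z [l /= lA lz]; exact: sub lA _ lz.
  have -> : leb2 (\bigcup_(l in [set` A]) subdom l) = (\sum_(l \in [set` A]) leb2 (subdom l))%R.
    apply: (measure_fin_bigcup leb2) => [|l l' _ _ [z [lz l'z]]|l _]; last exact: msub.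
      exact: finite_finset.
    apply/eqP; apply: contraT => /(patch_disjoint GM) E.
    by suff : set0 z by []; rewrite -E.
  have -> : (\sum_(l \in [set` A]) leb2 (subdom l))%R = (\sum_(l in A) leb2 (subdom l))%E.
    rewrite (fsbigE (enum A)) ?enum_uniq//.
    - rewrite -[RHS]big_enum [RHS]big_seq_cond [LHS]big_seq_cond; apply: eq_bigl => l.
      by rewrite mem_enum andbT; case: (boolP (l \in A)) => //= lA; rewrite mem_set.
    - by move=> l /=; rewrite mem_enum.
    - by move=> l /= lA; rewrite mem_enum lA.
  apply: (@le_trans _ _ (\sum_(l in A) (16 * C ^+ 2)^-1%:E)%E).
    by rewrite sumEFin sumr_const mulr_natl lexx.
  by apply: lee_sum => l _; exact: low.
rewrite lee_fin ler_pdivrMr ?mulr_gt0 ?exprn_gt0//; move=> /le_trans; apply.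
by rewrite le_eqVlt; apply/orP; left; apply/eqP; ring.
Qed.

(** A patch is counted once per interface it bounds, as first or as second entry. Each of the two
    sums is bounded by the number of neighbours, whence the factor 2. *)
Lemma sum_interfaces_le (f : 'I_(npatch M) -> R) : (forall k, 0 <= f k) ->
  \sum_(kl in interfaces M) (f kl.1 + f kl.2) <= 2 * (1600 * C ^+ 4) * \sum_k f k.
Proof.
move=> f0; rewrite big_split/=.
have part (g : 'I_(npatch M) -> 'I_(npatch M) -> bool) : 
    (forall k l, g k l -> l \in neighbours k) ->
    \sum_k \sum_(l | g k l) f k <= 1600 * C ^+ 4 * \sum_k f k.
  move=> gA; rewrite mulr_sumr ler_sum// => k _.
  rewrite sumr_const -[leLHS]mulr_natl ler_wpM2r//.
  rewrite (le_trans _ (neighbours_card k))// ler_nat subset_leq_card//.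
  by apply/fintype.subsetP => l /gA.
have -> : 2 * (1600 * C ^+ 4) * (\sum_k f k) = 1600 * C ^+ 4 * (\sum_k f k) + 1600 * C ^+ 4 * (\sum_k f k).
  by rewrite -mulrA mulr_natl mulr2n.
apply: lerD.
  have -> : \sum_(kl in interfaces M) f kl.1 = \sum_k \sum_(l | (k, l) \in interfaces M) f k.
    by rewrite pair_big_dep; apply: eq_bigl => -[].
  by apply: part => k l h; rewrite inE h.
have -> : \sum_(kl in interfaces M) f kl.2 = \sum_l \sum_(k | (k, l) \in interfaces M) f l.
  rewrite [RHS](exchange_big_dep xpredT)//= [RHS]pair_big_dep.
  by apply: eq_bigl => -[].
by apply: part => k l h; rewrite inE h orbT.
Qed.

End Interfaces.

(** * Young inequalities *)

Section Combination.
Context {R : realType}.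
Implicit Types (x y : R * R) (a r X P Q : R).

Lemma dot_ge0 x : 0 <= dot x x.
Proof. by rewrite addr_ge0 // -expr2 sqr_ge0. Qed.

Lemma young r s a : 0 < a -> `|r * s| <= 2^-1 * (a * r ^+ 2 + a^-1 * s ^+ 2).
Proof.
move=> a0; have ai0 : 0 < a^-1 by rewrite invr_gt0.
(* Taking c = 1 and c = -1 bounds the product from above and from below; the last summand vanishes
   as c^2 = 1. *)
have E c : 2^-1 * (a * r ^+ 2 + a^-1 * s ^+ 2) - c * (r * s) * 1 =
    2^-1 * (a^-1 * (a * r - c * s) ^+ 2) + 2^-1 * (1 - c ^+ 2) * (a^-1 * s ^+ 2).
  by field; rewrite gt_eqF.
have N0 c : 0 <= 2^-1 * (a^-1 * (a * r - c * s) ^+ 2).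
  by apply: mulr_ge0; [rewrite invr_ge0|apply: mulr_ge0; [exact: ltW|exact: sqr_ge0]].
have := N0 1; have := N0 (-1); have := E 1; have := E (-1).
rewrite sqrrN !expr1n !subrr !mulr0 !mul0r !addr0 mulNr !mul1r !mulr1 opprK => <- <- h1 h2.
by rewrite ler_norml; apply/andP; split; lra.
Qed.

Lemma dot_young x y a : 0 < a -> `|dot x y| <= 2^-1 * (a * dot x x + a^-1 * dot y y).
Proof.
move=> a0; rewrite (le_trans (ler_normD _ _))// (le_trans (lerD (young _ _ a0) (young _ _ a0)))//.
by rewrite le_eqVlt; apply/orP; left; apply/eqP; rewrite /dot; ring.
Qed.

Lemma dot_sqr_le x y : dot x y ^+ 2 <= dot x x * dot y y.
Proof.
rewrite -subr_ge0 (_ : _ - _ = (x.1 * y.2 - x.2 * y.1) ^+ 2) ?sqr_ge0//.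
by rewrite /dot; ring.
Qed.

(** The best parameter is the quotient of the square roots of Q and P; if P or Q is 0, letting it
    tend to infinity or to 0 gives X <= 0. *)
Lemma young_optimal X P Q : 0 <= P -> 0 <= Q -> (forall a, 0 < a -> X <= a * P + Q / a) ->
  X <= 2 * (Num.sqrt P * Num.sqrt Q).
Proof.
(* If X' were positive, the parameter X' / (2P') would give X' <= X'/2. *)
have zero P' X' : (forall a, 0 < a -> X' <= a * P') -> X' <= 0.
  move=> h; rewrite leNgt; apply/negP => X0.
  have P0 : 0 < P' by have := h 1 ltr01; rewrite mul1r; exact: lt_le_trans.
  have := h (X' / (2 * P')) (divr_gt0 X0 (mulr_gt0 (ltr0Sn _ 1) P0)).
  rewrite (_ : X' / (2 * P') * P' = X' / 2); last by field; rewrite gt_eqF.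
  lra.
rewrite le_eqVlt => /predU1P[<-|P0].
  move=> _ h; rewrite sqrtr0 mul0r mulr0; apply: (zero Q) => a a0.
  by have := h a^-1; rewrite invr_gt0 mulr0 add0r invrK mulrC; apply.
rewrite le_eqVlt => /predU1P[<-|Q0] h.
  rewrite sqrtr0 !mulr0; apply: (zero P) => a a0.
  by have := h a a0; rewrite mul0r addr0.
have p0 : 0 < Num.sqrt P by rewrite sqrtr_gt0.
have q0 : 0 < Num.sqrt Q by rewrite sqrtr_gt0.
have h' := sqr_sqrtr (ltW P0); have h'' := sqr_sqrtr (ltW Q0).
move: h' h'' p0 q0 h; move: (Num.sqrt P) (Num.sqrt Q) => p q <- <- p0 q0 h.
have := h (q / p) (divr_gt0 q0 p0).
by rewrite (_ : _ + _ = 2 * (p * q))//; field; rewrite !gt_eqF.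
Qed.

Lemma integral_comb_le d (T : measurableType d) (mu : {measure set T -> \bar R}) (D : set T)
    (f g : T -> R) (a b r s : R) :
  measurable D -> measurable_fun D f -> measurable_fun D g ->
  (forall x : T, D x -> 0 <= f x) -> (forall x : T, D x -> 0 <= g x) -> 0 <= a -> 0 <= b ->
  (\int[mu]_(x in D) (f x)%:E <= r%:E)%E -> (\int[mu]_(x in D) (g x)%:E <= s%:E)%E ->
  (\int[mu]_(x in D) (a * f x + b * g x)%:E <= (a * r + b * s)%:E)%E.
Proof.
move=> mD mf mg f0 g0 a0 b0 fr gs.
have scal (h : T -> R) (c t : R) : measurable_fun D h -> (forall x : T, D x -> 0 <= h x) -> 0 <= c ->
    (\int[mu]_(x in D) (h x)%:E <= t%:E)%E -> (\int[mu]_(x in D) (c * h x)%:E <= (c * t)%:E)%E.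
  move=> mh h0 c0 ht; under eq_integral do rewrite EFinM.
  rewrite ge0_integralZl_EFin; first by rewrite EFinM; apply: lee_wpmul2l; rewrite ?lee_fin.
  - exact: mD.
  - by move=> x Dx; rewrite lee_fin h0.
  - exact/measurable_EFinP.
  - exact: c0.
under eq_integral do rewrite EFinD.
rewrite ge0_integralD; first by rewrite EFinD; apply: leeD; apply: scal.
- exact: mD.
- by move=> x Dx; rewrite lee_fin mulr_ge0// f0.
- by apply/measurable_EFinP; exact: (measurable_funM (measurable_cst a) mf).
- by move=> x Dx; rewrite lee_fin mulr_ge0// g0.
- by apply/measurable_EFinP; exact: (measurable_funM (measurable_cst b) mg).
Qed.

(** The value is a unit vector or, where no outer normal exists, the default 0. *)
Lemma outer_normal_le1 (A : set (R * R)) x : dot (outer_normal A x) (outer_normal A x) <= 1.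
Proof.
rewrite /outer_normal; case: xgetP => [n _ [n1 _]|_]; last by rewrite /dot/= !mul0r addr0.
have : Num.sqrt (dot n n) ^+ 2 = 1 by rewrite -/(enorm n) n1 expr1n.
by rewrite sqr_sqrtr ?dot_ge0// => ->.
Qed.

End Combination.

(** * Interface estimates *)

Section Estimates.
Context {R : realType} (M : multipatch R) (C Ch : R) (C0 : 0 < C) (Ch0 : 0 < Ch).
Context (GM : geometry M) (BM : geo_bounds M C).
Context (pmin2 : (2 <= pmin M)%N) (hminmax : Ch * hmax M <= hmin M).
Implicit Types (x y z : R * R) (t : R) (k l : 'I_(npatch M)) (b : bool) (e : bool * bool).
Implicit Types (u v : R * R -> R).
Local Notation leb := (@lebesgue_measure R).
Local Notation U01 := (`]0, 1[%classic : set (measurableTypeR R)).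

(* The only consequence of u in Vh that the estimates need. *)
Definition pgrid u := forall k, tensor_spline (deg M k) (grid1 M k) (grid2 M k) (u \o geo M k).

Lemma deg_ge2 k : (2 <= deg M k)%N.
Proof.
have pk : (\big[Order.min/pmax M]_i deg M i <= deg M k)%O by exact: bigmin_le.
by apply: leq_trans pmin2 _; rewrite /pmin -minEnat -leEnat.
Qed.

Lemma deg_le_pmax k : (deg M k <= pmax M)%N.
Proof. exact: leq_bigmax. Qed.

Lemma grid_size_gt0 (Z : grid R) : 0 < grid_size Z.
Proof.
have i0 := spans_gt0 Z.
apply: (@lt_le_trans _ _ (knot_span Z 0)); last exact: (le_bigmax _ _ (Ordinal i0)).
by rewrite normr_gt0 subr_eq0 gt_eqF// knot_lt.
Qed.

Lemma hmax_gt0 : 0 < hmax M.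
Proof.
have [x /subset_closure] := dom_nonempty GM; rewrite (patch_cover GM) => -[k _ _].
apply: (lt_le_trans (grid_size_gt0 (grid1 M k))).
apply: le_trans (le_bigmax _ _ k); by rewrite le_max lexx.
Qed.

Lemma hmin_gt0 : 0 < hmin M.
Proof. by apply: lt_le_trans hminmax; rewrite mulr_gt0// hmax_gt0. Qed.

Lemma hmin_le_grid k : hmin M <= grid_min (grid1 M k) /\ hmin M <= grid_min (grid2 M k).
Proof.
have h : hmin M <= Order.min (grid_min (grid1 M k)) (grid_min (grid2 M k)) by exact: bigmin_le.
by split; apply: le_trans h _; rewrite ge_min lexx ?orbT.
Qed.

Definition energy u k : R := patch_energy (geo M k) u.

Lemma energy_ge0 u k : 0 <= energy u k.
Proof. by apply: Rintegral_ge0 => x _; exact: grad_sqr_ge0. Qed.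

(** Obtained from the constant of [edge_data] with (p_k + 1)^2 <= 4p^2 and hmin >= Ch hmax, which
    gives twice this value; the factor 1/2 in the averages of both sides removes the 2. *)
Definition trace_const : R := 512 * C ^+ 6 / Ch * ((pmax M)%:R ^+ 2 / hmax M).

Lemma deg_factor k (r : R) : 0 <= r ->
  256 * C ^+ 6 * ((deg M k).+1%:R ^+ 2 / hmin M) * r <= 2 * trace_const * r.
Proof.
move=> r0; apply: ler_wpM2r => //.
have C6 : 0 < C ^+ 6 by rewrite exprn_gt0.
have hM := hmax_gt0; have hm := hmin_gt0.
have dp : (deg M k).+1%:R ^+ 2 <= 4 * (pmax M)%:R ^+ 2 :> R.
  rewrite (_ : 4 * _ = (2 * (pmax M)%:R) ^+ 2); last by ring.
  rewrite ler_sqr ?nnegrE// -natrM ler_nat.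
  by rewrite (leq_trans _ (leq_mul (leqnn 2) (deg_le_pmax k)))// mul2n -addnn -addn1 leq_add2l (leq_trans _ (deg_ge2 k)).
have hh : (hmin M)^-1 <= (Ch * hmax M)^-1 by rewrite lef_pV2 ?posrE ?mulr_gt0.
apply: (@le_trans _ _ (256 * C ^+ 6 * ((4 * (pmax M)%:R ^+ 2) * (Ch * hmax M)^-1))).
  apply: ler_wpM2l; first exact: (mulr_ge0 (ler0n _ 256) (ltW C6)).
  have ih : 0 <= (hmin M)^-1 by rewrite invr_ge0 ltW.
  by apply: ler_pM => //; exact: sqr_ge0.
rewrite le_eqVlt; apply/orP; left; apply/eqP; rewrite /trace_const; field.
by rewrite !gt_eqF.
Qed.

(** The data of both patches in the parameter of k. The squared norm of an average is at most the
    average of the squared norms, by the parallelogram law. *)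
Lemma interface_data k l e u : (k < l)%N -> iedge M k l = Some e -> pgrid u ->
  exists (U W : R -> R) (B : R),
    [/\ measurable_fun U01 U, measurable_fun U01 W,
       (forall t, 0 < t < 1 -> `|U t| <= B) /\ (forall t, 0 <= W t),
       (\int[leb]_(t in `]0%R, 1%R[) (W t)%:E <= (trace_const * (energy u k + energy u l))%:E)%E &
       forall t, 0 < t < 1 -> jump k l u (geo M k (edge_par e t)) = U t /\
         dot (avg_grad k l u (geo M k (edge_par e t)))
             (avg_grad k l u (geo M k (edge_par e t))) <= W t].
Proof.
move=> kl ekl su; have [e' [b par]] := interface_param GM kl ekl.
have [hk1 hk2] := hmin_le_grid k; have [hl1 hl2] := hmin_le_grid l.
have [Uk [Wk [Bk [mUk mWk [UBk Wk0] iWk tk]]]] :=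
  edge_data C0 (geo_chart GM BM k) (@geo_cont _ _ GM k) (deg_ge2 k) (su k) e false hmin_gt0 hk1 hk2.
have [Ul [Wl [Bl [mUl mWl [UBl Wl0] iWl tl]]]] :=
  edge_data C0 (geo_chart GM BM l) (@geo_cont _ _ GM l) (deg_ge2 l) (su l) e' b hmin_gt0 hl1 hl2.
exists (fun t => Uk t - Ul t), (fun t => 2^-1 * Wk t + 2^-1 * Wl t), (Bk + Bl).
have half0 : 0 <= 2^-1 :> R by [].
split.
- exact: measurable_funB.
- exact: (measurable_funD (measurable_funM (measurable_cst _) mWk) (measurable_funM (measurable_cst _) mWl)).
- split=> t; last by rewrite addr_ge0// mulr_ge0.
  by move=> t01; rewrite (le_trans (ler_normB _ _))// lerD ?UBk ?UBl.
- apply: (@le_trans _ _ (2^-1 * (256 * C ^+ 6 * ((deg M k).+1%:R ^+ 2 / hmin M) * energy u k) +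
      2^-1 * (256 * C ^+ 6 * ((deg M l).+1%:R ^+ 2 / hmin M) * energy u l))%:E).
    by apply: integral_comb_le.
  rewrite lee_fin.
  have := deg_factor k (energy_ge0 u k); have := deg_factor l (energy_ge0 u l).
  move: (_ * energy u k) (_ * energy u l) => A B h1 h2.
  rewrite [leRHS](_ : _ = 2^-1 * (2 * trace_const * energy u k) + 2^-1 * (2 * trace_const * energy u l)); last by field.
  by apply: lerD; rewrite ler_wpM2l.
move=> t t01; have [E uk ul] := par t t01.
have [Ek Gk] := tk t t01 uk; have [El Gl] := tl t t01 ul.
rewrite /jump /avg_grad -/(subdom k) -/(subdom l) in Ek Gk El Gl *.
rewrite /= in Ek Gk; rewrite Ek {1}E El; split => //.
move: Gk Gl; rewrite -E; move: (trace (subdom k) _ _) (trace (subdom l) _ _) => x y Gx Gy.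
have : dot (2^-1 *: (x + y)) (2^-1 *: (x + y)) <= 2^-1 * dot x x + 2^-1 * dot y y.
  rewrite -subr_ge0 (_ : _ - _ = 4^-1 * ((x.1 - y.1) ^+ 2 + (x.2 - y.2) ^+ 2)).
    by rewrite mulr_ge0// addr_ge0 ?sqr_ge0.
  by rewrite /dot /= /GRing.scale /=; field.
move/le_trans; apply; apply: lerD; exact: ler_wpM2l.
Qed.

End Estimates.

(** * Estimates of the single integrals in the three forms *)

Section Terms.
Context {R : realType} (M : multipatch R) (C Ch : R) (C0 : 0 < C) (Ch0 : 0 < Ch).
Context (GM : geometry M) (BM : geo_bounds M C).
Context (pmin2 : (2 <= pmin M)%N) (hminmax : Ch * hmax M <= hmin M).
Implicit Types (x y z : R * R) (t : R) (k l : 'I_(npatch M)) (b : bool) (e : bool * bool).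
Implicit Types (u v : R * R -> R).
Local Notation leb := (@lebesgue_measure R).
Local Notation U01 := (`]0, 1[%classic : set (measurableTypeR R)).
Local Notation tc := (trace_const M C Ch).

Lemma interface_integralE k l e (f : R * R -> R) : iedge M k l = Some e ->
  interface_integral k l f =
  \int[leb]_(t in `]0, 1[) (f (geo M k (edge_par e t)) * arc_factor (geo M k) e t).
Proof. by move=> ekl; rewrite /interface_integral ekl. Qed.

Definition jump_energy u k l : R :=
  interface_integral k l (fun x => jump k l u x * jump k l u x).

Lemma jump_energy_ge0 u k l : 0 <= jump_energy u k l.
Proof.
rewrite /jump_energy /interface_integral; case: iedge => // e.
by apply: Rintegral_ge0 => t _; rewrite mulr_ge0 ?sqrtr_ge0// -expr2 sqr_ge0.
Qed.

Let arc k e : measurable_fun U01 (arc_factor (geo M k) e) /\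
  forall t, 0 < t < 1 -> 0 <= arc_factor (geo M k) e t <= 2 * C.
Proof.
split; first exact: (measurable_arc_factor C0 (geo_chart GM BM k) (@geo_cont _ _ GM k) erefl).
move=> t t01; rewrite arc_factor_ge0/=.
exact: (arc_factor_le C0 (geo_chart GM BM k) (@geo_cont _ _ GM k) erefl).
Qed.

(** [jump_energy] is a real number and would be meaningless for an infinite integral. The bound on
    [U] makes the integral finite, so that both notions agree. *)
Lemma jump_energyE k l e u (U : R -> R) (B : R) : iedge M k l = Some e ->
  measurable_fun U01 U -> (forall t, 0 < t < 1 -> `|U t| <= B) ->
  (forall t, 0 < t < 1 -> jump k l u (geo M k (edge_par e t)) = U t) ->
  (\int[leb]_(t in `]0%R, 1%R[) (U t ^+ 2 * arc_factor (geo M k) e t)%:E)%E = (jump_energy u k l)%:E.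
Proof.
move=> ekl mU UB JU; have [ma a01] := arc k e.
have -> : jump_energy u k l = \int[leb]_(t in `]0, 1[) (U t ^+ 2 * arc_factor (geo M k) e t).
  rewrite /jump_energy (interface_integralE _ ekl); apply: eq_Rintegral => t /set_mem.
  by rewrite /= in_itv/= => t01; rewrite JU// -expr2.
rewrite fineK//; apply: integrable_fin_num; first exact: measurable_itv.
apply: measurable_bounded_integrable.
- exact: measurable_itv.
- have := @lebesgue_measure_itv R `]0, 1[; rewrite /= lte_fin ltr01 -EFinB => E.
  by rewrite [X in (X < _)%E]E ltry.
- exact: (measurable_funM (measurable_funX 2 mU) ma).
exists (B ^+ 2 * (2 * C)); split; first exact: num_real.
move=> r Br t; rewrite /= in_itv/= => t01; have /andP[a0 a1] := a01 t t01.
rewrite ger0_norm; last by rewrite mulr_ge0 ?sqr_ge0.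
apply: le_trans (ltW Br); apply: ler_pM => //; first exact: sqr_ge0.
rewrite -[_ ^+ 2]real_normK ?num_real// ler_sqr ?nnegrE ?UB//.
exact: le_trans (normr_ge0 _) (UB t t01).
Qed.

Let split_interface (kl : 'I_(npatch M) * 'I_(npatch M)) : kl \in interfaces M ->
  exists2 e, (kl.1 < kl.2)%N & iedge M kl.1 kl.2 = Some e.
Proof. by rewrite inE => /andP[kl12]; case: (iedge M kl.1 kl.2) => // e _; exists e. Qed.

Let measurable_jump e k (U : R -> R) : measurable_fun U01 U ->
  measurable_fun U01 (fun t => U t ^+ 2 * arc_factor (geo M k) e t).
Proof. by move=> mU; exact: (measurable_funM (measurable_funX 2 mU) (arc k e).1). Qed.

Lemma interface_cross (kl : 'I_(npatch M) * 'I_(npatch M)) u v (a : R) :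
  kl \in interfaces M -> pgrid M u -> pgrid M v -> 0 < a ->
  `|interface_integral kl.1 kl.2 (fun x => jump kl.1 kl.2 u x * jump kl.1 kl.2 v x)| <=
  2^-1 * a * jump_energy u kl.1 kl.2 + 2^-1 * a^-1 * jump_energy v kl.1 kl.2.
Proof.
case: kl => k l /split_interface[e /= kl ekl] su sv a0.
have [U [W [B [mU _ [UB _] _ UE]]]] := interface_data C0 Ch0 GM BM pmin2 hminmax kl ekl su.
have [V [X [D [mV _ [VD _] _ VE]]]] := interface_data C0 Ch0 GM BM pmin2 hminmax kl ekl sv.
have JU := jump_energyE ekl mU UB (fun t t01 => (UE t t01).1).
have JV := jump_energyE ekl mV VD (fun t t01 => (VE t t01).1).
have half0 : 0 <= 2^-1 :> R by [].
have [_ a01] := arc k e.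
rewrite (interface_integralE _ ekl).
apply: (@Rintegral_norm_le _ _ (measurableTypeR R) leb _ _ (fun t => 2^-1 * a * (U t ^+ 2 * arc_factor (geo M k) e t) +
    2^-1 * a^-1 * (V t ^+ 2 * arc_factor (geo M k) e t))).
  move=> t; rewrite /= in_itv/= => t01; have [-> _] := UE t t01; have [-> _] := VE t t01.
  have /andP[w0 _] := a01 t t01.
  rewrite normrM (ger0_norm w0) (le_trans (ler_wpM2r w0 (young (U t) (V t) a0)))//.
  by rewrite le_eqVlt; apply/orP; left; apply/eqP; ring.
apply: integral_comb_le.
- exact: measurable_itv.
- exact: measurable_jump.
- exact: measurable_jump.
- by move=> t; rewrite /= in_itv/= => /a01/andP[w0 _]; rewrite mulr_ge0 ?sqr_ge0.
- by move=> t; rewrite /= in_itv/= => /a01/andP[w0 _]; rewrite mulr_ge0 ?sqr_ge0.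
- by rewrite mulr_ge0// ltW.
- by rewrite mulr_ge0// invr_ge0 ltW.
- by rewrite JU.
- by rewrite JV.
Qed.

(** Young's inequality splits the product. The arc length factor stays with the jump but is bounded
    by 2C next to the gradient, whose majorant is integrated in the edge parameter. *)
Lemma interface_flux (kl : 'I_(npatch M) * 'I_(npatch M)) u v (a : R) (n : R * R -> R * R) :
  kl \in interfaces M -> pgrid M u -> pgrid M v -> 0 < a -> (forall x, dot (n x) (n x) <= 1) ->
  `|interface_integral kl.1 kl.2 (fun x => jump kl.1 kl.2 u x * dot (avg_grad kl.1 kl.2 v x) (n x))| <=
  2^-1 * a * jump_energy u kl.1 kl.2 + a^-1 * C * (tc * (energy v kl.1 + energy v kl.2)).
Proof.
case: kl => k l /split_interface[e /= kl ekl] su sv a0 n1.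
have [U [W [B [mU _ [UB _] _ UE]]]] := interface_data C0 Ch0 GM BM pmin2 hminmax kl ekl su.
have [V [X [D [_ mX [_ X0] iX XE]]]] := interface_data C0 Ch0 GM BM pmin2 hminmax kl ekl sv.
have JU := jump_energyE ekl mU UB (fun t t01 => (UE t t01).1).
have half0 : 0 <= 2^-1 :> R by [].
have ai0 : 0 <= a^-1 by rewrite invr_ge0 ltW.
have [_ a01] := arc k e.
rewrite (interface_integralE _ ekl).
apply: (@Rintegral_norm_le _ _ (measurableTypeR R) leb _ _ (fun t => 2^-1 * a * (U t ^+ 2 * arc_factor (geo M k) e t) +
    a^-1 * C * X t)).
  move=> t; rewrite /= in_itv/= => t01; have [-> _] := UE t t01; have [_] := XE t t01.
  have /andP[w0 w1] := a01 t t01; move: (avg_grad _ _ _ _) => g gX.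
  rewrite normrM (ger0_norm w0) (le_trans (ler_wpM2r w0 (young _ _ a0)))//.
  rewrite mulrDr mulrDl; apply: lerD.
    by rewrite le_eqVlt; apply/orP; left; apply/eqP; ring.
  have dX : dot g (n (geo M k (edge_par e t))) ^+ 2 <= X t.
    rewrite (le_trans (dot_sqr_le _ _))// -[leRHS]mulr1.
    by apply: ler_pM; rewrite ?dot_ge0.
  have := ler_pM (sqr_ge0 _) w0 dX w1; move: (dot _ _ ^+ 2) (arc_factor _ _ _) => d w h.
  rewrite (_ : _ * w = 2^-1 * a^-1 * (d * w)); last by ring.
  rewrite (_ : a^-1 * C * X t = 2^-1 * a^-1 * (X t * (2 * C))); last by field; rewrite gt_eqF.
  by apply: ler_wpM2l => //; exact: mulr_ge0.
apply: integral_comb_le => //.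
- exact: measurable_jump.
- by move=> t; rewrite /= in_itv/= => /a01/andP[w0 _]; rewrite mulr_ge0 ?sqr_ge0.
- by rewrite mulr_ge0// ltW.
- by rewrite mulr_ge0// ltW.
- by rewrite JU.
Qed.

Lemma bulk_cross k u v (a : R) : pgrid M u -> pgrid M v -> 0 < a ->
  `|\int[leb2]_(x in subdom k) dot (grad u x) (grad v x)| <=
  2^-1 * a * energy u k + 2^-1 * a^-1 * energy v k.
Proof.
move=> su sv a0; have half0 : 0 <= 2^-1 :> R by [].
have FC := geo_chart GM BM k; have d2 := deg_ge2 pmin2 k.
have Eu := patch_energyE C0 FC d2 (su k); have Ev := patch_energyE C0 FC d2 (sv k).
have mu w : pgrid M w -> measurable_fun (subdom k : set (measurableTypeR R * measurableTypeR R)) (grad_sqr w).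
  by move=> sw; apply: (grad_sqr_measurable C0 FC (patch_derivable d2 (sw k)) (patch_pd_continuous d2 (sw k))).
apply: (@Rintegral_norm_le _ _ _ leb2 _ _ (fun x => 2^-1 * a * grad_sqr u x + 2^-1 * a^-1 * grad_sqr v x)).
  move=> x _; rewrite (le_trans (dot_young _ _ a0))//.
  by rewrite le_eqVlt; apply/orP; left; apply/eqP; rewrite /grad_sqr; ring.
apply: integral_comb_le.
- exact: chart_image_mplane C0 FC.
- exact: mu.
- exact: mu.
- by move=> x _; exact: grad_sqr_ge0.
- by move=> x _; exact: grad_sqr_ge0.
- by rewrite mulr_ge0// ltW.
- by rewrite mulr_ge0// invr_ge0 ltW.
- by rewrite /subdom Eu.
- by rewrite /subdom Ev.
Qed.

End Terms.

(** * Coercivity and boundedness *)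

Section Global.
Context {R : realType} (M : multipatch R) (C Ch : R) (C0 : 0 < C) (Ch0 : 0 < Ch).
Context (GM : geometry M) (BM : geo_bounds M C).
Context (pmin2 : (2 <= pmin M)%N) (hminmax : Ch * hmax M <= hmin M).
Implicit Types (u v : R * R -> R) (a : R).

Definition jumps u : R := \sum_(kl in interfaces M) jump_energy u kl.1 kl.2.

Lemma jumps_ge0 u : 0 <= jumps u.
Proof. by apply: sumr_ge0 => kl _; exact: jump_energy_ge0. Qed.

Lemma ipH1_ge0 u : 0 <= ipH1 M u u.
Proof. by apply: sumr_ge0 => k _; exact: energy_ge0. Qed.

Lemma ipCE sigma u : ipC M sigma u u = sigma / hmax M * jumps u.
Proof. by []. Qed.

Lemma ipH1_bound u v a : pgrid M u -> pgrid M v -> 0 < a ->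
  `|ipH1 M u v| <= 2^-1 * a * ipH1 M u u + 2^-1 * a^-1 * ipH1 M v v.
Proof.
move=> su sv a0; rewrite /ipH1 (le_trans (ler_norm_sum _ _ _))// !mulr_sumr -big_split/=.
by apply: ler_sum => k _; apply: (bulk_cross C0 GM BM pmin2).
Qed.

Lemma ipC_bound s u v a : pgrid M u -> pgrid M v -> 0 < a -> 0 <= s / hmax M ->
  `|ipC M s u v| <= s / hmax M * (2^-1 * a * jumps u + 2^-1 * a^-1 * jumps v).
Proof.
move=> su sv a0 s0; rewrite /ipC normrM (ger0_norm s0) ler_wpM2l//.
rewrite (le_trans (ler_norm_sum _ _ _))// /jumps !mulr_sumr -big_split/=.
by apply: ler_sum => kl klI; apply: (interface_cross C0 Ch0 GM BM pmin2 hminmax).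
Qed.

(** The product of [C] from the arc length, the geometric part of [trace_const], and the count of
    neighbours in [sum_interfaces_le]. *)
Definition flux_const : R := C * (512 * C ^+ 6 / Ch) * (2 * (1600 * C ^+ 4)).

Lemma flux_const_gt0 : 0 < flux_const.
Proof.
have n0 n : 0 < n.+1%:R :> R by exact: ltr0Sn.
have C6 : 0 < C ^+ 6 by exact: exprn_gt0.
have C4 : 0 < C ^+ 4 by exact: exprn_gt0.
apply: mulr_gt0; last by apply: mulr_gt0; [exact: n0|apply: mulr_gt0; [exact: n0|exact: C4]].
by apply: mulr_gt0; [exact: C0|apply: divr_gt0; [apply: mulr_gt0; [exact: n0|exact: C6]|exact: Ch0]].
Qed.

Lemma ipB_bound u v a : pgrid M u -> pgrid M v -> 0 < a ->
  `|ipB M u v| <= 2^-1 * a * jumps u +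
    a^-1 * (flux_const * ((pmax M)%:R ^+ 2 / hmax M)) * ipH1 M v v.
Proof.
move=> su sv a0; pose tc := trace_const M C Ch.
have tc0 : 0 <= tc.
  have C6 : 0 <= C ^+ 6 by apply: exprn_ge0; exact: ltW.
  apply: mulr_ge0; apply: divr_ge0; [|exact: ltW|exact: sqr_ge0|exact/ltW/hmax_gt0].
  by apply: mulr_ge0; [exact: ler0n|exact: C6].
apply: (@le_trans _ _ (\sum_(kl in interfaces M) (2^-1 * a * jump_energy u kl.1 kl.2 +
    a^-1 * C * (tc * (energy v kl.1 + energy v kl.2))))).
  rewrite /ipB (le_trans (ler_norm_sum _ _ _))//; apply: ler_sum => kl klI.
  apply: (interface_flux C0 Ch0 GM BM pmin2 hminmax) => //.
  by move=> x; exact: outer_normal_le1.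
rewrite big_split/= -mulr_sumr lerD2l -mulr_sumr -mulr_sumr.
have := sum_interfaces_le C0 GM BM (energy_ge0 v).
rewrite -[\sum_k energy v k]/(ipH1 M v v); move: (\sum_(_ in _) _) (ipH1 M v v) => S H SH.
rewrite [leRHS](_ : _ = a^-1 * C * (tc * (2 * (1600 * C ^+ 4) * H))); last first.
  by rewrite /tc /trace_const /flux_const; ring.
apply: ler_wpM2l; first by rewrite mulr_ge0 ?invr_ge0// ltW.
exact: ler_wpM2l.
Qed.

Context (sigma : R) (sigma_ge : (pmax M)%:R ^+ 2 * (8 * flux_const) <= sigma).

(** The coefficient of the energy in [ipB_bound], to be compared with the penalty weight [s]. *)
Let b : R := flux_const * ((pmax M)%:R ^+ 2 / hmax M).
Let s : R := sigma / hmax M.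

Let b_gt0 : 0 < b.
Proof.
have [x /subset_closure] := dom_nonempty GM; rewrite (patch_cover GM) => -[k _ _].
rewrite mulr_gt0 ?flux_const_gt0// divr_gt0 ?(hmax_gt0 GM)// exprn_gt0// ltr0n.
by apply: leq_trans (deg_le_pmax k); exact: ltnW (deg_ge2 pmin2 k).
Qed.

Let s_ge : 8 * b <= s.
Proof.
rewrite /s ler_pdivlMr ?(hmax_gt0 GM)// (le_trans _ sigma_ge)// le_eqVlt.
by apply/orP; left; apply/eqP; rewrite /b; field; rewrite gt_eqF// (hmax_gt0 GM).
Qed.

Let s_gt0 : 0 < s.
Proof. by apply: lt_le_trans s_ge; rewrite mulr_gt0. Qed.

Let b_le : s^-1 * b <= 2^-1.
Proof.
rewrite mulrC ler_pdivrMr ?s_gt0//.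
have h2 : 0 <= 2^-1 :> R by rewrite invr_ge0 ler0n.
apply: le_trans (ler_wpM2l h2 s_ge); rewrite mulrA ler_peMl ?(ltW b_gt0)//.
by rewrite mulrC ler_pdivlMr ?ltr0n// mul1r ler_nat.
Qed.

Lemma normQ_sqr u : normQ M sigma u ^+ 2 = ipH1 M u u + s * jumps u.
Proof. by rewrite sqr_sqrtr// addr_ge0 ?ipH1_ge0// ipCE mulr_ge0 ?jumps_ge0// ltW. Qed.

Lemma ipA_coercive u : pgrid M u -> 2^-1 * normQ M sigma u ^+ 2 <= ipA M sigma u u.
Proof.
move=> su; rewrite normQ_sqr /ipA ipCE -/s.
(* With a = 4b the consistency term is at most 2b times the jumps plus a quarter of the energy. It
   occurs twice, and with 8b <= s it consumes half of each part of the norm. *)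
have a0 : 0 < 4 * b by rewrite mulr_gt0.
have := ipB_bound su su a0; rewrite -/b.
have -> : (4 * b)^-1 * b = 4^-1 by field; rewrite gt_eqF.
have sJ : 8 * b * jumps u <= s * jumps u by rewrite ler_wpM2r ?jumps_ge0.
move: (ler_norm (ipB M u u)) sJ.
rewrite (_ : 2^-1 * (4 * b) * jumps u = 4^-1 * (8 * b * jumps u)); last by field.
move: (8 * b * jumps u) (s * jumps u) (ipH1 M u u) (ipB M u u) => bJ sJ H B; lra.
Qed.

(** With the parameter a for the energy and the penalty, as for B(u,v) and s/a for B(v,u), the four
    bounds add up to a Q(u) + Q(v)/a. Optimizing a only after summation gives the product of the
    full norms. *)
Lemma ipA_bounded u v : pgrid M u -> pgrid M v ->
  ipA M sigma u v <= 2 * (normQ M sigma u * normQ M sigma v).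
Proof.
move=> su sv; pose Q w := ipH1 M w w + s * jumps w.
have Q0 w : 0 <= Q w by rewrite addr_ge0 ?ipH1_ge0// mulr_ge0 ?jumps_ge0// ltW.
rewrite /normQ -[X in _ * (Num.sqrt X * _)]/(Q u) -[X in _ * (_ * Num.sqrt X)]/(Q v).
apply: young_optimal => // a a0; have ai0 : 0 < a^-1 by rewrite invr_gt0.
have H := ipH1_bound su sv a0.
have Cc := ipC_bound su sv a0 (ltW s_gt0).
have B1 := ipB_bound su sv (mulr_gt0 a0 s_gt0).
have B2 := ipB_bound sv su (mulr_gt0 ai0 s_gt0).
rewrite -/b -/s in Cc B1 B2.
have bs c : 0 < c -> (c * s)^-1 * b <= 2^-1 * c^-1.
  by move=> c0; rewrite invfM -mulrA mulrC ler_pM2r ?invr_gt0// b_le.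
have h1 := ler_wpM2r (ipH1_ge0 v) (bs a a0).
have h2 := ler_wpM2r (ipH1_ge0 u) (bs a^-1 ai0); rewrite invrK in h2.
have leN (X Y : R) : `|X| <= Y -> - X <= Y by rewrite -normrN; exact/le_trans/ler_norm.
have t1 := le_trans (ler_norm _) H.
have t2 := le_trans (leN _ _ B1) (lerD (lexx _) h1).
have t3 := le_trans (leN _ _ B2) (lerD (lexx _) h2).
have t4 := le_trans (ler_norm _) Cc.
apply: le_trans (lerD (lerD (lerD t1 t2) t3) t4) _.
rewrite /Q.
move: (ipH1 M u u) (ipH1 M v v) (jumps u) (jumps v) (s) => Hu Hv Ju Jv r.
by rewrite le_eqVlt; apply/orP; left; apply/eqP; field; rewrite gt_eqF.
Qed.

End Global.

Theorem theorem8 (R : realType) (CG Ch : R) (CG_gt0 : 0 < CG) (Ch_gt0 : 0 < Ch) :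
  exists sigma0 c1 c2 : R,
    [/\ 0 < sigma0, 0 < c1, 0 < c2 &
      forall M : multipatch R,
        geometry M -> geo_bounds M CG ->
        (2 <= pmin M)%N -> Ch * hmax M <= hmin M ->
      forall sigma : R, (pmax M)%:R ^+ 2 * sigma0 <= sigma ->
      forall u v : R * R -> R, Vh M u -> Vh M v ->
        c1 * normQ M sigma u ^+ 2 <= ipA M sigma u u /\
        ipA M sigma u v <= c2 * (normQ M sigma u * normQ M sigma v)].
Proof.
(* The 8 gives 8b <= s, from which the coercivity constant 1/2 and the continuity constant 2 follow
   for all data. *)
exists (8 * flux_const CG Ch), 2^-1, 2; split=> //.
  by rewrite mulr_gt0// flux_const_gt0.
move=> M GM BM pm hm sigma sg u v [_ _ _ su] [_ _ _ sv]; split.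
  exact: (ipA_coercive CG_gt0 Ch_gt0 GM BM pm hm sg).
exact: (ipA_bounded CG_gt0 Ch_gt0 GM BM pm hm sg).
Qed.
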